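(* As $p\searrow1$, the functionals $\tilde{\mathcal{E}}_s^p$ $\Gamma$-converge to $\tilde{\mathcal{E}}_s^1$ in the $L^1_{\rm loc}(\mathbb{R}^n)$-topology: $$\Gamma\text{-}\lim_{p\searrow1}\tilde{\mathcal{E}}_s^p=\tilde{\mathcal{E}}_s^1 .$$
   Context: Throughout, $\Omega\subset\mathbb{R}^n$ is a bounded open set with Lipschitz boundary, $s\in(0,1)$, $\mathcal{C}\Omega:=\mathbb{R}^n\setminus\Omega$ and $Q(\Omega):=\mathbb{R}^{2n}\setminus(\mathcal{C}\Omega)^2$. For $q\in[1,\infty)$ let $$\mathcal{X}^q(\Omega):=\left\{u\in L^1_{\rm loc}(\mathbb{R}^n): \iint_{Q(\Omega)}\frac{|u(x)-u(y)|^q}{|x-y|^{n+sq}}\,dx\,dy<\infty\right\},$$ and define the extended functional on $L^1_{\rm loc}(\mathbb{R}^n)$ $$\tilde{\mathcal{E}}_s^q(u):=\begin{cases}\dfrac1{2q}\displaystyle\iint_{Q(\Omega)}\frac{|u(x)-u(y)|^q}{|x-y|^{n+sq}}\,dx\,dy & \text{if }u\in\mathcal{X}^q(\Omega),\\ +\infty&\text{if }u\in L^1_{\rm loc}(\mathbb{R}^n)\setminus\mathcal{X}^q(\Omega).\end{cases}$$ $\Gamma$-convergence is understood sequentially: for every $u\in L^1_{\rm loc}(\mathbb{R}^n)$ and every sequence $p_k\searrow1$ ($p_k>1$), (1) for every sequence $u_k\to u$ in $L^1_{\rm loc}(\mathbb{R}^n)$ one has $\tilde{\mathcal{E}}_s^1(u)\le\liminf_{k\to\infty}\tilde{\mathcal{E}}_s^{p_k}(u_k)$;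 and (2) there exists a sequence $u_k\to u$ in $L^1_{\rm loc}(\mathbb{R}^n)$ with $\tilde{\mathcal{E}}_s^1(u)=\lim_{k\to\infty}\tilde{\mathcal{E}}_s^{p_k}(u_k)$. *)

(* Defs.v *)
From HB Require Import structures.
From mathcomp Require Import all_boot all_order all_algebra.
From mathcomp Require Import all_classical all_reals all_analysis.
From mathcomp Require Import measurable_realfun.
Set Implicit Arguments.
Unset Strict Implicit.
Unset Printing Implicit Defensive.
Import Order.TTheory GRing.Theory Num.Theory.
Import numFieldNormedType.Exports.
Local Open Scope classical_set_scope.
Local Open Scope ring_scope.

Fact rV_display : measure_display.
Proof. exact: default_measure_display. Qed.

(** R^n is ['rV[R]_n]; its library topology is the usual one (given by the
    sup norm), and it is equipped with the Borel sigma-algebra. *)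
Section borel_rV.
Context {R : realType} {n : nat}.

Let borel : set (set 'rV[R]_n) := <<s [set A | open A] >>.

Let borel0 : borel set0.
Proof. exact: sigma_algebra0. Qed.

Let borelC A : borel A -> borel (~` A).
Proof. exact: sigma_algebraC. Qed.

Let borel_bigcup (F : (set 'rV[R]_n)^nat) :
  (forall i, borel (F i)) -> borel (\bigcup_i F i).
Proof. exact: sigma_algebra_bigcup. Qed.

HB.instance Definition _ := @isMeasurable.Build rV_display 'rV[R]_n borel
  borel0 borelC borel_bigcup.

Lemma open_measurable_rV (A : set 'rV[R]_n) : open A -> measurable A.
Proof. by move=> oA; exact: sub_sigma_algebra. Qed.

End borel_rV.

Section borel_rV_theory.
Context {R : realType}.

Lemma measurable_coord n (i : 'I_n) :
  measurable_fun setT (fun v : 'rV[R]_n => v ord0 i : measurableTypeR R).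
Proof.
apply: (measurability _ (RGenOpens.measurableE R)) => _ [_ [a [b ->]] <-].
rewrite setTI; apply: open_measurable_rV.
apply: open_comp; last exact: interval_open.
by move=> v _; exact: coord_continuous.
Qed.

Lemma measurable_box n (A : 'I_n -> set (measurableTypeR R)) :
  (forall i, measurable (A i)) ->
  measurable [set v : 'rV[R]_n | forall i, A i (v ord0 i)].
Proof.
move=> mA; rewrite (_ : mkset _ =
    \bigcap_(i in [set: 'I_n]) ((fun v : 'rV[R]_n => v ord0 i) @^-1` A i)).
  apply: fin_bigcap_measurable => // i _.
  by rewrite -[X in measurable X]setTI; exact: measurable_coord.
by apply/seteqP; split=> [v Av i _|v Av i]; exact: Av.
Qed.

Let cell n (p : 'rV[rat]_n * nat) : set 'rV[R]_n :=
  [set v | forall i, `|ratr (p.1 ord0 i) - v ord0 i| < p.2.+1%:R^-1].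

Let open_cells n (U : set 'rV[R]_n) : open U ->
  U = \bigcup_(p in [set p | cell p `<=` U]) cell p.
Proof.
move=> oU; apply/seteqP; split; last first.
  by move=> v [p /= pU pv]; exact: pU.
move=> v Uv.
have /nbhs_ballP[e /= e0 vU] : nbhs v U by exact: open_nbhs_nbhs.
have [k ke] : exists k : nat, k.+1%:R^-1 < e / 2.
  have := near_infty_natSinv_lt (PosNum (divr_gt0 e0 (ltr0n _ 2))).
  by case=> k _ /(_ k (leqnn k)) /= ?; exists k.
have qP i : exists q : rat, `|ratr q - v ord0 i| < k.+1%:R^-1.
  have : v ord0 i - k.+1%:R^-1 < v ord0 i + k.+1%:R^-1.
    by rewrite ltrD2l gtrN// invr_gt0 ltr0n.
  move=> /rat_in_itvoo[q]; rewrite in_itv/= => /andP[q1 q2]; exists q.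
  by rewrite ltr_norml ltrBrDr ltrBlDr addrC q1 addrC.
have [q qv] := choice qP.
exists (\row_i q i, k); last by move=> i /=; rewrite mxE.
move=> w /= wq; apply: vU; split => // i j; rewrite ord1.
have := wq j; rewrite /= mxE => wqj; rewrite /ball/=.
have -> : v ord0 j - w ord0 j =
    (ratr (q j) - w ord0 j) - (ratr (q j) - v ord0 j).
  by rewrite opprB [RHS]addrC addrA subrK.
rewrite (le_lt_trans (ler_normB _ _))// (splitr e).
by rewrite ltrD// (lt_trans _ ke).
Qed.

Lemma measurable_fun_rV d (T : measurableType d) n (f : T -> 'rV[R]_n) :
  (forall i, measurable_fun setT (fun t => f t ord0 i : measurableTypeR R)) ->
  measurable_fun setT f.
Proof.
move=> mf; apply: (@measurability _ _ _ _ _ f [set A | open A]) => //.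
move=> _ [U oU <-]; rewrite setTI (open_cells oU) preimage_bigcup.
rewrite bigcup_mkcond; apply: countable_bigcupT_measurable => // p.
case: ifPn => // _.
rewrite (_ : _ @^-1` _ = \bigcap_(i in [set: 'I_n])
    ((fun t => f t ord0 i) @^-1` [set x | `|ratr (p.1 ord0 i) - x| < p.2.+1%:R^-1])).
  apply: fin_bigcap_measurable => // i _; rewrite -[X in measurable X]setTI.
  by apply: mf => //; apply: open_measurable; exact: ball_open.
by apply/seteqP; split=> [t ft i _|t ft i]; exact: ft.
Qed.

End borel_rV_theory.

(** Lebesgue measure on R^n, by iterated products; see [leb_box]. *)
Fixpoint leb {R : realType} (n : nat) : set 'rV[R]_n -> \bar R :=
  match n with
  | 0%N => \d_ (0 : 'rV[R]_0)
  | n.+1 => pushforward (@lebesgue_measure R \x @leb R n)%E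
      (fun p => row_mx (p.1%:M : 'rV_1) p.2 : 'rV_(1 + n))
  end.
Arguments leb {R} n.

Section leb_theory.
Context {R : realType}.

Let join n (p : measurableTypeR R * 'rV[R]_n) : 'rV[R]_n.+1 :=
  row_mx (p.1%:M : 'rV_1) p.2 : 'rV_(1 + n).

Let split n (v : 'rV[R]_n.+1) : measurableTypeR R * 'rV[R]_n :=
  (v ord0 ord0, \row_i v ord0 (lift ord0 i)).

Let join0 n (p : measurableTypeR R * 'rV[R]_n) : join p ord0 ord0 = p.1.
Proof.
rewrite (_ : ord0 = lshift n (ord0 : 'I_1)); last exact/val_inj.
apply: (etrans (row_mxEl (p.1%:M : 'rV_1) p.2 ord0 ord0)).
by rewrite mxE eqxx mulr1n.
Qed.

Let joinS n (p : measurableTypeR R * 'rV[R]_n) i :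
  join p ord0 (lift ord0 i) = p.2 ord0 i.
Proof.
rewrite (_ : lift ord0 i = rshift 1 i); last exact/val_inj.
exact: (row_mxEr (p.1%:M : 'rV_1)).
Qed.

Let joinK n : cancel (@join n) (@split n).
Proof.
move=> [x v]; rewrite /split join0; congr pair.
by apply/rowP => i; rewrite mxE joinS.
Qed.

Let splitK n : cancel (@split n) (@join n).
Proof.
move=> v; apply/rowP => i; case: (unliftP ord0 i) => [j|] ->.
  by rewrite joinS mxE.
by rewrite join0.
Qed.

Let measurable_join n : measurable_fun setT (@join n).
Proof.
apply: measurable_fun_rV => i; case: (unliftP ord0 i) => [j|] ->.
  under eq_fun do rewrite joinS.
  exact: measurableT_comp (measurable_coord j) measurable_snd.
under eq_fun do rewrite join0.
exact: measurable_fst.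
Qed.

Let measurable_split n : measurable_fun setT (@split n).
Proof.
apply: measurable_fun_pair; first exact: measurable_coord.
apply: measurable_fun_rV => i; under eq_fun do rewrite mxE.
exact: measurable_coord.
Qed.

Section leb_step.
Variables (n : nat) (mu : {sigma_finite_measure set 'rV[R]_n -> \bar R}).

Let nu : set 'rV[R]_n.+1 -> \bar R :=
  pushforward (lebesgue_measure \x mu)%E (@join n).

Let measurable_preimage_join (A : set 'rV[R]_n.+1) :
  measurable A -> measurable (@join n @^-1` A).
Proof. by move=> mA; rewrite -[X in measurable X]setTI; exact: measurable_join. Qed.

Let nu0 : nu set0 = 0%E.
Proof. by rewrite /nu /pushforward preimage_set0 measure0. Qed.

Let nu_ge0 A : (0 <= nu A)%E.
Proof. by rewrite /nu /pushforward; exact: measure_ge0. Qed.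

Let nu_sigma_additive : semi_sigma_additive nu.
Proof.
move=> F mF tF mUF; rewrite /nu /pushforward preimage_bigcup.
apply: measure_semi_sigma_additive.
- by move=> i; exact: measurable_preimage_join.
- apply/trivIsetP => /= i j _ _ ij; rewrite -preimage_setI.
  by move/trivIsetP : tF => /(_ _ _ _ _ ij) ->//; rewrite preimage_set0.
- by rewrite -preimage_bigcup; exact: measurable_preimage_join.
Qed.

HB.instance Definition _ := isMeasure.Build _ _ _ nu nu0 nu_ge0 nu_sigma_additive.

Let nu_sigma_finite : sigma_finite setT nu.
Proof.
have /sigma_finiteP[F [FT ndF Foo]] := sigma_finiteT (@lebesgue_measure R).
have /sigma_finiteP[G [GT ndG Goo]] := sigma_finiteT mu.
have mFG k : measurable (F k `*` G k).
  by have [? _] := Foo k; have [? _] := Goo k; exact: measurableX.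
exists (fun k => @split n @^-1` (F k `*` G k)).
  rewrite -preimage_bigcup (_ : \bigcup_k _ = setT) ?preimage_setT//.
  rewrite -subTset => -[x y] _.
  have [i _ Fx] : (\bigcup_k F k) x by rewrite -FT.
  have [j _ Gy] : (\bigcup_k G k) y by rewrite -GT.
  exists (maxn i j) => //; split=> /=.
    by move: x Fx; exact/subsetPset/ndF/leq_maxl.
  by move: y Gy; exact/subsetPset/ndG/leq_maxr.
move=> k; split.
  by rewrite -[X in measurable X]setTI; exact: measurable_split.
have [mFk Fkoo] := Foo k; have [mGk Gkoo] := Goo k.
rewrite /nu /pushforward -comp_preimage (_ : _ \o _ = id).
  by rewrite preimage_id product_measure1E// lte_mul_pinfty// ge0_fin_numE.
by apply/funext => p; exact: joinK.
Qed.

HB.instance Definition _ := Measure_isSigmaFinite.Build _ _ _ nu nu_sigma_finite.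

Local Lemma leb_step : exists nu : {sigma_finite_measure set 'rV[R]_n.+1 -> \bar R},
  nu = pushforward (lebesgue_measure \x mu)%E (@join n) :> (set _ -> _).
Proof. by exists [the {sigma_finite_measure set _ -> \bar R} of nu]. Qed.

End leb_step.

Let leb_sigma_finite_measure n :
  exists mu : {sigma_finite_measure set 'rV[R]_n -> \bar R},
    mu = leb n :> (set _ -> _).
Proof.
elim: n => [|n [mu muE]].
  by exists [the {sigma_finite_measure set _ -> \bar R} of \d_ (0 : 'rV[R]_0)].
by have [nu nuE] := leb_step mu; exists nu; rewrite nuE /= -muE.
Qed.

Let leb0 n : leb n set0 = 0%E :> \bar R.
Proof. by have [mu <-] := leb_sigma_finite_measure n; exact: measure0. Qed.

Let leb_ge0 n A : (0 <= leb n A :> \bar R)%E.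
Proof. by have [mu <-] := leb_sigma_finite_measure n; exact: measure_ge0. Qed.

Let leb_sigma_additive n : semi_sigma_additive (@leb R n).
Proof.
have [mu <-] := leb_sigma_finite_measure n.
exact: measure_semi_sigma_additive.
Qed.

HB.instance Definition _ n := isMeasure.Build _ _ _ (@leb R n)
  (@leb0 n) (@leb_ge0 n) (@leb_sigma_additive n).

Let leb_sigma_finite n : sigma_finite setT (@leb R n).
Proof.
have [mu <-] := leb_sigma_finite_measure n; exact: sigma_finiteT.
Qed.

HB.instance Definition _ n :=
  Measure_isSigmaFinite.Build _ _ _ (@leb R n) (@leb_sigma_finite n).

Lemma leb_box n (A : 'I_n -> set (measurableTypeR R)) :
  (forall i, measurable (A i)) ->
  leb n [set v | forall i, A i (v ord0 i)] =
  (\prod_(i < n) lebesgue_measure (A i))%E.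
Proof.
elim: n A => [|n IHn] A mA.
  by rewrite big_ord0 /= diracE mem_set// => -[].
rewrite big_ord_recl -IHn//= /pushforward -product_measure1E//; last first.
  by apply: (measurable_box (A := fun i => A (lift ord0 i))) => i; exact: mA.
congr ((_ \x _)%E _); apply/seteqP; split=> [[x v] /= Axv|[x v] /= [Ax Av] i].
  split; first by have := Axv ord0; rewrite (join0 (x, v)).
  by move=> i; have := Axv (lift ord0 i); rewrite (joinS (x, v)).
case: (unliftP ord0 i) => [j|] ->; first by rewrite (joinS (x, v)).
by rewrite (join0 (x, v)).
Qed.

End leb_theory.

Section fractional_energy.
Context {R : realType}.
Local Open Scope ereal_scope.

Definition enorm n (v : 'rV[R]_n) : R :=
  Num.sqrt (\sum_(i < n) v ord0 i ^+ 2)%R.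

(** Near each boundary point, and up to an orthogonal change of coordinates
    [y = x *m U], the set is the open region above the graph of a Lipschitz
    function of all coordinates but the last one. *)
Definition lipschitz_boundary n (Omega : set 'rV[R]_n.+1) :=
  forall x0, (closure Omega `\` interior Omega) x0 ->
  exists (U : 'M[R]_n.+1) (g : 'rV[R]_n -> R),
    [/\ U *m U^T = 1%:M,
        lipschitz g &
        \forall x \near x0,
          Omega x <->
          (g (col' ord_max (x *m U)) < (x *m U) ord0 ord_max)%R].

(** Functions are representatives of their classes modulo null sets; every
    class of Lebesgue measurable functions has a Borel representative. *)
Definition L1loc n : set ('rV[R]_n -> R) :=
  [set u | measurable_fun setT (u : _ -> measurableTypeR R) /\
    forall K, compact K -> \int[leb n]_(x in K) `|u x|%:E < +oo].

Definition L1loc_cvg n (u_ : ('rV[R]_n -> R)^nat) (u : 'rV[R]_n -> R) :=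
  forall K, compact K ->
    \int[leb n]_(x in K) `|u_ k x - u x|%:E @[k --> \oo] --> 0.

Definition Qset n (Omega : set 'rV[R]_n) : set ('rV[R]_n * 'rV[R]_n) :=
  ~` (~` Omega `*` ~` Omega).

(** On the diagonal, a null set, the integrand is [0] since [x / 0 = 0]. *)
Definition gagliardo n (Omega : set 'rV[R]_n) (s q : R) (u : 'rV[R]_n -> R) :
    \bar R :=
  \int[leb n \x leb n]_(z in Qset Omega)
    (`|u z.1 - u z.2| `^ q / enorm (z.1 - z.2) `^ (n%:R + s * q))%:E.

Definition Xspace n (Omega : set 'rV[R]_n) (s q : R) : set ('rV[R]_n -> R) :=
  [set u | L1loc u /\ gagliardo Omega s q u < +oo].

Definition ext_energy n (Omega : set 'rV[R]_n) (s q : R) (u : 'rV[R]_n -> R) :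
    \bar R :=
  if u \in Xspace Omega s q then (2 * q)^-1%:E * gagliardo Omega s q u
  else +oo.

(** Sequential Gamma-convergence, in [L1loc], of a family [F p] to [F0] as [p]
    decreases to [p0]. *)
Definition Gamma_cvg_at_right n (F : R -> ('rV[R]_n -> R) -> \bar R) (p0 : R)
    (F0 : ('rV[R]_n -> R) -> \bar R) :=
  forall u, L1loc u ->
  forall p_ : R^nat, (forall k, p0 < p_ k)%R -> p_ @ \oo --> p0 ->
  (forall u_ : ('rV[R]_n -> R)^nat,
     (forall k, L1loc (u_ k)) -> L1loc_cvg u_ u ->
     F0 u <= limn_einf (fun k => F (p_ k) (u_ k))) /\
  (exists u_ : ('rV[R]_n -> R)^nat,
     [/\ forall k, L1loc (u_ k), L1loc_cvg u_ u &
         F (p_ k) (u_ k) @[k --> \oo] --> F0 u]).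

End fractional_energy.

(* Main.v *)
Require Import Defs.
From HB Require Import structures.
From mathcomp Require Import all_boot all_order all_algebra.
From mathcomp Require Import all_classical all_reals all_analysis.
From mathcomp Require Import measurable_realfun.
From mathcomp Require Import zify ring lra.
Set Implicit Arguments.
Unset Strict Implicit.
Unset Printing Implicit Defensive.
Import Order.TTheory GRing.Theory Num.Theory.
Import numFieldNormedType.Exports.
Local Open Scope classical_set_scope.
Local Open Scope ring_scope.

(** Write [G p u] for the double integral over [Q(Omega)], and
    [t = |u x - u y| / |x - y|^s] for the Hoelder quotient of a pair; the density
    of [G p u] is then [t^p |x - y|^(-n)], and [p] only acts on [t].

    Lower bound ([gagliardo_liminf]). Since [t <= t^p + (p - 1)] ([le_powR_add]), on a
    part of [Q(Omega)] where [x] and [y] are bounded and [|x - y|] is bounded below,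
    the seminorm with exponent 1 of [u_k] is at most [G p_k u_k] up to [O(p_k - 1)].
    On such a part the seminorm with exponent 1 is continuous in L1, so its values
    at [u_k] tend to the value at [u]. Exhausting [Q(Omega)] gives the inequality.

    Upper bound ([recovery_sequence]). If [t <= C] on [Q(Omega)], then
    [t^p <= C^(p - 1) t], so [G p v] is asymptotically at most [G 1 v]. It thus
    suffices to approximate any [u] with [G 1 u] finite, in L1loc and up to a small
    increase of [G 1], by functions with bounded quotients, and to extract a
    diagonal sequence. The approximation has two steps.

    - [cutoff_approx]: truncate [u], then multiply it by a cutoff [psi] that
      vanishes within [r] of the boundary. This adds at most a constant times the
      energy of [psi], which is [O(|S| r^(-s))] where [S] is the strip on which
      [psi] varies ([cutoff_energy_le]). As the boundary is locally a Lipschitz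
      graph, [|S| = O(r)], and the energy is [O(r^(1 - s))] ([boundary_cutoff]).

    - [regular_approx]: the resulting function vanishes near the boundary. Its
      restriction to [Omega], extended by 0, has finite energy over the whole
      space; replace it by a mollification. This does not increase the whole
      space energy, which is convex and invariant under translations
      ([energy_mollify]). The interaction with the exterior changes at distances
      bounded below only, where the kernel is integrable, hence by a multiple of
      the L1 error. The new function is Lipschitz in [Omega] and unchanged
      outside, and its quotients on [Q(Omega)] are bounded because it vanishes
      near the boundary. *)

(* Keeps unification from unfolding the recursive definition of the measure. *)
Opaque leb.

(** * Norms, measurability and translations *)

Section rV_norm.
Context {R : realType}.

Lemma mx_coord_le m n (A : 'M[R]_(m, n)) i j : `|A i j| <= `|A|.
Proof.
rewrite [in leRHS]/Num.norm/= mx_normrE.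
exact: (le_bigmax 0 (fun ij : 'I_m * 'I_n => `|A ij.1 ij.2|) (i, j)).
Qed.

Lemma rV_normP n (v : 'rV[R]_n) (c : R) : 0 <= c ->
  (forall i, `|v ord0 i| <= c) <-> `|v| <= c.
Proof.
move=> c0; split=> [vc|vc i]; last exact: le_trans (mx_coord_le _ _ _) vc.
rewrite [`|v|]/Num.norm/= mx_normrE.
by apply/bigmax_leP; split => // -[i j] _ /=; rewrite ord1.
Qed.

Lemma rV_norm_ltP n (v : 'rV[R]_n) (c : R) : 0 < c ->
  (forall i, `|v ord0 i| < c) <-> `|v| < c.
Proof.
move=> c0; split=> [vc|vc i]; last exact: le_lt_trans (mx_coord_le _ _ _) vc.
rewrite [`|v|]/Num.norm/= mx_normrE.
by apply/bigmax_ltP; split => // -[i j] _ /=; rewrite ord1.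
Qed.

(** A linear map is Lipschitz for the sup norm; applied to the changes of
    coordinates that flatten the boundary. *)
Lemma mulmx_norm_le n p (v : 'rV[R]_n) (A : 'M[R]_(n, p)) :
  `|v *m A| <= n%:R * `|A| * `|v|.
Proof.
apply/rV_normP => [|i]; first by rewrite !mulr_ge0.
rewrite mxE (le_trans (ler_norm_sum _ _ _))//.
rewrite (le_trans (ler_sum _ (fun k _ => _ : _ <= `|A| * `|v|)))//.
  by move=> k _; rewrite normrM mulrC ler_pM// mx_coord_le.
by rewrite sumr_const card_ord -mulrA mulr_natl.
Qed.

Context {n : nat}.
Implicit Types (v : 'rV[R]_n.+1).

Lemma norm_le_enorm v : `|v| <= enorm v.
Proof.
apply/rV_normP; first exact: sqrtr_ge0.
move=> i; rewrite -sqrtr_sqr ler_sqrt ?sumr_ge0// => [|j _]; last exact: sqr_ge0.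
by rewrite (bigD1 i)//= lerDl sumr_ge0// => j _; exact: sqr_ge0.
Qed.

Lemma enorm_le_norm v : enorm v <= n.+1%:R * `|v|.
Proof.
have -> : n.+1%:R * `|v| = Num.sqrt ((n.+1%:R * `|v|) ^+ 2).
  by rewrite sqrtr_sqr ger0_norm// mulr_ge0.
rewrite ler_sqrt ?sqr_ge0//.
apply: (@le_trans _ _ (n.+1%:R * `|v| ^+ 2)).
  rewrite (le_trans (ler_sum _ (fun i _ => _ : _ <= `|v| ^+ 2)))//.
    by move=> i _; rewrite -real_normK ?num_real// lerXn2r ?nnegrE// mx_coord_le.
  by rewrite sumr_const card_ord mulr_natl.
rewrite exprMn ler_wpM2r ?sqr_ge0// -natrX ler_nat; exact: leq_pmulr.
Qed.

Lemma enorm_ge0 v : 0 <= enorm v. Proof. exact: sqrtr_ge0. Qed.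

Lemma enormN v : enorm (- v) = enorm v.
Proof. by rewrite /enorm; under eq_bigr do rewrite mxE sqrrN. Qed.

End rV_norm.

Section rV_measurability.
Context {R : realType} {n : nat}.
Local Notation E := 'rV[R]_n.

Lemma continuous_measurable_rV (f : E -> R) : continuous f ->
  measurable_fun setT f.
Proof.
move=> cf; apply: (measurability _ (RGenOpens.measurableE R)).
move=> _ [_ [a [b ->]] <-]; rewrite setTI; apply: open_measurable_rV.
by apply: open_comp; last exact: interval_open; move=> v _; exact: cf.
Qed.

Lemma measurable_rVD d (T : measurableType d) (f g : T -> E) :
  measurable_fun setT f -> measurable_fun setT g ->
  measurable_fun setT (fun t => f t + g t).
Proof.
move=> mf mg; apply: measurable_fun_rV => i.
under eq_fun do rewrite mxE.
by apply: measurable_funD; exact: (measurableT_comp (measurable_coord i)).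
Qed.

Lemma measurable_rVN d (T : measurableType d) (f : T -> E) :
  measurable_fun setT f -> measurable_fun setT (fun t => - f t).
Proof.
move=> mf; apply: measurable_fun_rV => i.
under eq_fun do rewrite mxE.
by apply: measurable_funN; exact: (measurableT_comp (measurable_coord i)).
Qed.

Lemma measurable_rVB d (T : measurableType d) (f g : T -> E) :
  measurable_fun setT f -> measurable_fun setT g ->
  measurable_fun setT (fun t => f t - g t).
Proof. by move=> mf mg; apply: measurable_rVD => //; exact: measurable_rVN. Qed.

Lemma measurable_enorm : measurable_fun setT (@enorm R n).
Proof.
apply: (@measurableT_comp _ _ _ _ _ _ (@Num.sqrt R)).
  by apply: continuous_measurable_fun; exact: sqrt_continuous.
apply: measurable_sum => i; apply: measurable_funX.
exact: measurable_coord.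
Qed.

End rV_measurability.

Section translation.
Context {R : realType}.

Section dim1.
Variable a : R.
Let mshift : measurable_fun setT
  ((fun x => x + a) : measurableTypeR R -> measurableTypeR R).
Proof. exact: measurable_funD. Qed.

Let mu_shift : {measure set (measurableTypeR R) -> \bar R} :=
  @measure_function_pushforward__canonical__measure_function_Measure
    _ _ _ _ _ lebesgue_measure _ mshift.

Lemma lebesgue_measure_translate (A : set (measurableTypeR R)) : measurable A ->
  lebesgue_measure ((fun x => x + a) @^-1` A) = lebesgue_measure A.
Proof.
move=> mA; apply/esym; apply: (lebesgue_measure_unique (mu := mu_shift)) => //.
move=> _ [[x y] _ <-].
rewrite /= /pushforward/= (_ : _ @^-1` _ = `]x - a, y - a]%classic).
  by rewrite !lebesgue_measure_itv/= !lte_fin ltrD2r -!EFinB opprB addrA subrK.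
by apply/seteqP; split => z /=; rewrite !in_itv/= ltrBlDr lerBrDr.
Qed.

End dim1.

Context {n : nat}.
Local Notation E := 'rV[R]_n.

Let boxes : set (set E) := [set B | exists2 A : 'I_n -> set (measurableTypeR R),
  (forall i, measurable (A i)) & B = [set v : E | forall i, A i (v ord0 i)]].

(** The identity is measurable from the sigma-algebra generated by products of
    Borel sets to the Borel one, because its coordinates are. *)
Let measurable_boxes : measurable = <<s boxes >>.
Proof.
apply/seteqP; split; last first.
  apply: smallest_sub; first exact: sigma_algebra_measurable.
  by move=> _ [A mA ->]; exact: measurable_box.
move=> B mB.
have mid : measurable_fun setT (id : g_sigma_algebraType boxes -> E).
  apply: measurable_fun_rV => i _ A mA; rewrite setTI; apply: sub_sigma_algebra.
  exists (fun j => if j == i then A else setT); first by move=> j; case: ifPn.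
  apply/seteqP; split => [v /= Av j|v /= /(_ i)]; last by rewrite eqxx.
  by case: ifPn => // /eqP ->.
by have := mid measurableT _ mB; rewrite setTI preimage_id.
Qed.

Lemma measurable_translate (a : E) : measurable_fun setT (fun x : E => x + a).
Proof. by apply: measurable_rVD. Qed.

Section translate.
Variable a : E.
Let leb_shift : {measure set E -> \bar R} :=
  @measure_function_pushforward__canonical__measure_function_Measure
    _ _ _ _ _ (leb n) _ (measurable_translate a).

Let g k : set E := [set v : E | forall i : 'I_n, `]- k%:R, k%:R[%classic (v ord0 i)].

(** The measure and its translate agree on products of Borel sets, which form a
    pi-system generating the Borel sigma-algebra. *)
Let leb_shiftE (B : set E) : measurable B -> leb_shift B = leb n B.
Proof.
apply: (measure_unique boxes g measurable_boxes) => //.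
- move=> _ _ [A mA ->] [A' mA' ->]; exists (fun i => A i `&` A' i).
    by move=> i; exact: measurableI.
  apply/seteqP; split=> [v [Av A'v] i|v AA'v]; first by split.
  by split => i; have [] := AA'v i.
- by move=> k; exists (fun=> `]- k%:R, k%:R[%classic).
- rewrite -subTset => v _; exists (Num.truncn `|v|).+1 => // i /=.
  rewrite in_itv/= -ltr_norml (le_lt_trans _ (truncnS_gt _))//.
  exact: mx_coord_le.
- move=> _ [A mA ->]; rewrite /= /pushforward leb_box//.
  rewrite [X in leb n X](_ : _ =
      [set v : E | forall i, ((fun x => x + a ord0 i) @^-1` A i) (v ord0 i)]).
    rewrite (leb_box (A := fun i => (fun x => x + a ord0 i) @^-1` A i)); first by apply: eq_bigr => i _; exact: lebesgue_measure_translate.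
    move=> i; rewrite -[X in measurable X]setTI; by apply: measurable_funD => //; exact: mA.
  by apply/seteqP; split => v Av i; have := Av i; rewrite /= mxE.
- move=> k; rewrite /= /pushforward.
  rewrite [X in leb n X](_ : _ =
      [set v : E | forall i, `]- k%:R - a ord0 i, k%:R - a ord0 i[%classic (v ord0 i)]).
    rewrite (leb_box (A := fun i => `]- k%:R - a ord0 i, k%:R - a ord0 i[%classic))//; rewrite ltey_eq; apply/orP; left.
    apply: prode_fin_num => i _; rewrite lebesgue_measure_itv; case: ifPn => // _.
  by apply/seteqP; split => v Av i; have := Av i; rewrite /= mxE !in_itv/= ltrBlDr ltrBrDr.
Qed.

Let integral_leb_shift (f : E -> \bar R) :
  (\int[leb_shift]_x f x = \int[leb n]_x f x)%E.
Proof. by apply: eq_measure_integral => B mB _; rewrite leb_shiftE. Qed.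

Lemma ge0_integral_translate (f : E -> \bar R) :
  measurable_fun setT f -> (forall x, 0 <= f x)%E ->
  (\int[leb n]_x f (x + a)%R = \int[leb n]_x f x)%E.
Proof.
move=> mf f0; rewrite -[RHS]integral_leb_shift.
by rewrite (ge0_integral_pushforward (measurable_translate a) (leb n))// => x _;
  exact: f0.
Qed.

Lemma integrable_translate (f : E -> \bar R) :
  measurable_fun setT f -> (leb n).-integrable setT f ->
  (leb n).-integrable setT (fun x => f (x + a)%R).
Proof.
move=> mf /integrableP[_ foo]; apply/integrableP; split.
  exact: (measurableT_comp mf (measurable_translate a)).
rewrite (ge0_integral_translate (f := fun x => `|f x|%E))//.
exact: measurableT_comp.
Qed.

Lemma integral_translate (f : E -> \bar R) :
  (leb n).-integrable setT f ->
  (\int[leb n]_x f (x + a)%R = \int[leb n]_x f x)%E.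
Proof.
move=> intf; have mf := measurable_int _ intf.
rewrite -[RHS]integral_leb_shift.
rewrite (integral_pushforward (measurable_translate a) mf)//; exact: integrable_translate.
Qed.

End translate.
End translation.

(** * The fractional kernel *)

Section leb_balls.
Context {R : realType} {n : nat}.
Local Notation E := 'rV[R]_n.+1.
Implicit Types (x y v : E) (r c q s : R).

Lemma measurable_rV_norm : measurable_fun setT (fun v : E => `|v|).
Proof. by apply: continuous_measurable_rV => v; exact: norm_continuous. Qed.

Lemma norm_ball_box x r : 0 < r -> [set y | `|x - y| < r] =
  [set y : E | forall i, `]x ord0 i - r, x ord0 i + r[%classic (y ord0 i)].
Proof.
move=> r0; apply/seteqP; split=> y /= => [/(rV_norm_ltP _ r0) xy i|xy].
  by have := xy i; rewrite !mxE in_itv/= distrC ltr_distl.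
by apply/(rV_norm_ltP _ r0) => i; have := xy i; rewrite !mxE in_itv/= distrC ltr_distl.
Qed.

Lemma measurable_norm_ball x r : measurable [set y : E | `|x - y| < r].
Proof.
have mn : measurable_fun setT (fun y : E => `|x - y|).
  by apply: (measurableT_comp measurable_rV_norm); exact: measurable_rVB.
rewrite -[X in measurable X]setTI (_ : [set _ | _] =
    (fun y : E => `|x - y|) @^-1` `]-oo, r[%classic); first exact: mn.
by apply/seteqP; split => y /=; rewrite in_itv.
Qed.

Lemma leb_norm_ball x r : 0 < r ->
  leb n.+1 [set y | `|x - y| < r] = ((2 * r) ^+ n.+1)%:E.
Proof.
move=> r0; rewrite norm_ball_box//.
rewrite (leb_box (A := fun i => `]x ord0 i - r, x ord0 i + r[%classic))//.
rewrite (eq_bigr (fun=> (2 * r)%:E)) => [|i _].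
  by rewrite -(big_morph EFin EFinM (erefl _)) prodr_const card_ord.
rewrite lebesgue_measure_itv/= lte_fin ltrD2l gtrN// -EFinB; congr EFin; ring.
Qed.

(** Covering the mass of [f] by countably many balls, with [f] at most [a j] on
    the [j]-th one, bounds its integral by a geometric series. *)
Lemma integral_le_ball_series (f : E -> R) x (a rho : R^nat) c q :
  measurable_fun setT f -> (forall y, 0 <= f y) ->
  (forall j, 0 <= a j) -> (forall j, 0 < rho j) -> 0 <= c -> 0 < q < 1 ->
  (forall y, 0 < f y -> exists j, f y <= a j /\ `|x - y| < rho j) ->
  (forall j, a j * (2 * rho j) ^+ n.+1 <= c * q ^+ j) ->
  (\int[leb n.+1]_y (f y)%:E <= (c / (1 - q))%:E)%E.
Proof.
move=> mf f0 a0 rho0 c0 /andP[q0 q1] fP aP.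
pose B j := [set y | `|x - y| < rho j].
have mB j : measurable (B j) by exact: measurable_norm_ball.
pose g j y := ((a j)%:E * (\1_(B j) y)%:E)%E : \bar R.
have mg j : measurable_fun setT (g j).
  apply/measurable_EFinP/measurable_funM => //; exact: measurable_indic.
have g0 j y : (0 <= g j y)%E by rewrite /g -EFinM lee_fin mulr_ge0.
apply: (@le_trans _ _ (\int[leb n.+1]_y \sum_(j <oo) g j y)%E).
  apply: ge0_le_integral => //.
  - by move=> y _; rewrite lee_fin.
  - by apply/measurable_EFinP.
  - exact: ge0_emeasurable_sum.
  move=> y _; have := f0 y; rewrite le_eqVlt => /predU1P[<-|fy].
    exact: nneseries_ge0.
  have [j [fa yj]] := fP _ fy.
  apply: (@le_trans _ _ (g j y)).
    by rewrite /g indicE mem_set// mule1 lee_fin.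
  rewrite (nneseriesD1 (n := j))//=.
  by rewrite leeDl//; exact: nneseries_ge0.
rewrite integral_nneseries//.
apply: lime_le; first by apply: is_cvg_nneseries => j _ _; exact: integral_ge0.
apply: nearW => k.
apply: (@le_trans _ _ (\sum_(0 <= j < k) (c * q ^+ j)%:E)%E).
  apply: lee_sum => j _; rewrite /g ge0_integralZl//.
  - rewrite integral_indic// setIT (_ : _ (B j) = ((2 * rho j) ^+ n.+1)%:E).
      by rewrite -EFinM lee_fin.
    exact: leb_norm_ball.
  - exact/measurable_EFinP/measurable_indic.
  - by rewrite lee_fin.
rewrite sumEFin lee_fin; have := @geometric_le_lim R k c q c0 q0.
by rewrite gtr0_norm//; apply.
Qed.

End leb_balls.

Section measurable_of_pair.
Context d (T : measurableType d) {R : realType} {n : nat}.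
Local Notation E := 'rV[R]_n.+1.
Implicit Types (f g : T -> E).

Lemma measurable_norm_rVB f g : measurable_fun setT f -> measurable_fun setT g ->
  measurable_fun setT (fun t => `|f t - g t|).
Proof.
by move=> mf mg; apply: (measurableT_comp measurable_rV_norm); exact: measurable_rVB.
Qed.

Lemma measurable_natr (b : T -> bool) : measurable_fun setT b ->
  measurable_fun setT (fun t => (b t)%:R : R).
Proof.
move=> mb; rewrite (_ : (fun t => _) = \1_(b @^-1` [set true])).
  by apply: measurable_indic; rewrite -[X in measurable X]setTI; exact: mb.
apply/funext => t; rewrite indicE; case: (boolP (b t)) => bt; first by rewrite mem_set.
by rewrite memNset//= => b1; rewrite b1 in bt.
Qed.

End measurable_of_pair.

Section kernel.
Context {R : realType} {n : nat}.
Local Notation E := 'rV[R]_n.+1.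
Implicit Types (x y v : E) (r c q s : R).

(** The kernel of the seminorm with exponent 1, in dimension [n.+1]. *)
Definition frac_kernel s v : R := (enorm v `^ (n.+1%:R + s))^-1.

Lemma kernel_ge0 s v : 0 <= frac_kernel s v.
Proof. by rewrite invr_ge0 powR_ge0. Qed.

Lemma kernelN s v : frac_kernel s (- v) = frac_kernel s v.
Proof. by rewrite /frac_kernel enormN. Qed.

Lemma measurable_frac_kernel s : measurable_fun setT (frac_kernel s).
Proof.
have -> : frac_kernel s = (fun v => enorm v `^ (- (n.+1%:R + s))).
  by apply/funext => v; rewrite powRN.
apply: (@measurableT_comp _ _ _ _ _ _ (fun x : R => x `^ _)).
  exact: measurable_powR.
exact: measurable_enorm.
Qed.

Lemma measurable_kernel_rVB d (T : measurableType d) (f g : T -> E) s :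
  measurable_fun setT f -> measurable_fun setT g ->
  measurable_fun setT (fun t => frac_kernel s (f t - g t)).
Proof.
by move=> mf mg; apply: (measurableT_comp (measurable_frac_kernel s)); exact: measurable_rVB.
Qed.

Lemma measurable_far_kernel s r :
  measurable_fun setT (fun v : E => (r <= `|v|)%R%:R * frac_kernel s v).
Proof.
apply: measurable_funM; last exact: measurable_frac_kernel.
by apply/measurable_natr/measurable_fun_ler => //; exact: measurable_rV_norm.
Qed.

(** The two factors are kept apart because the second cancels against the
    volume of a ball of radius [rho]. *)
Lemma kernel_le s v rho : 0 < s -> 0 < rho -> rho <= `|v| ->
  frac_kernel s v <= rho `^ (- s) / rho ^+ n.+1.
Proof.
move=> s0 rho0 rhov; rewrite powRN -invfM mulrC -powR_mulrn ?(ltW rho0)//.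
rewrite -powRD; last by rewrite (gt_eqF rho0) implybT.
rewrite lef_pV2 ?posrE ?powR_gt0//; last first.
  by rewrite (lt_le_trans rho0)// (le_trans rhov)// norm_le_enorm.
apply: ge0_ler_powR; rewrite ?nnegrE ?enorm_ge0 ?(ltW rho0)//.
  by rewrite ltW// addr_gt0.
by rewrite (le_trans rhov)// norm_le_enorm.
Qed.

Lemma kernel_ge s v rho : 0 < s -> v != 0 -> `|v| <= rho ->
  1 <= (n.+1%:R * rho) `^ (n.+1%:R + s) * frac_kernel s v.
Proof.
move=> s0 v0 vr.
have e0 : 0 < enorm v by rewrite (lt_le_trans _ (norm_le_enorm _))// normr_gt0.
rewrite ler_pdivlMr ?powR_gt0// mul1r; apply: ge0_ler_powR.
- by rewrite ltW// addr_gt0.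
- exact: enorm_ge0.
- by rewrite nnegrE mulr_ge0// (le_trans _ vr).
- by rewrite (le_trans (enorm_le_norm _))// ler_wpM2l.
Qed.

Let powR2N_itv (t : R) : 0 < t -> 0 < (2 : R) `^ (- t) < 1.
Proof.
move=> t0; rewrite powR_gt0//= powRN invf_lt1 ?powR_gt0//.
have := @gt0_ltr_powR R _ t0 1 2; rewrite powR1; apply; rewrite ?nnegrE//.
by rewrite ltr1n.
Qed.

Let dyadic (t : R) : 1 <= t -> exists j, 2 ^+ j <= t < 2 ^+ j.+1.
Proof.
move=> t1; have ex : exists j, t < 2 ^+ j.+1.
  exists (Num.truncn t); rewrite (lt_le_trans (truncnS_gt _))//.
  by rewrite -natrX ler_nat; exact: ltnW (ltn_expl _ _).
case: (ex_minnP ex) => -[|j] tj jmin; first by exists 0%N; rewrite expr0 t1.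
by exists j.+1; rewrite tj andbT leNgt; apply/negP => /jmin; rewrite ltnn.
Qed.

(** Integrability at infinity: the shell [2^j r <= |x - y| < 2^(j+1) r] contributes
    a constant times [(2^j r)^(-s)], a geometric series as [s > 0]. *)
Lemma kernel_far s : 0 < s -> exists2 C, 0 <= C & forall x r, 0 < r ->
  (\int[leb n.+1]_y ((r <= `|x - y|)%R%:R * frac_kernel s (x - y))%:E
    <= (C * r `^ (- s))%:E)%E.
Proof.
move=> s0; pose q := 2 `^ (- s) : R.
have q01 : 0 < q < 1.
  exact: powR2N_itv.
exists (4 ^+ n.+1 / (1 - q)).
  by rewrite divr_ge0// subr_ge0; case/andP: q01 => _ /ltW.
move=> x r r0; pose rho j : R := 2 ^+ j * r.
have rho0 j : 0 < rho j by rewrite mulr_gt0// exprn_gt0.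
rewrite mulrAC.
apply: (integral_le_ball_series (x := x)
  (a := fun j => rho j `^ (- s) / rho j ^+ n.+1) (rho := fun j => 2 * rho j)) => //.
- apply: measurable_funM; last exact: measurable_kernel_rVB.
  by apply/measurable_natr/measurable_fun_ler => //; exact: measurable_norm_rVB.
- by move=> y; rewrite mulr_ge0// kernel_ge0.
- by move=> j; rewrite divr_ge0 ?powR_ge0// exprn_ge0// ltW.
- by move=> j; rewrite mulr_gt0.
- by rewrite mulr_ge0 ?powR_ge0.
- move=> y; case: (leP r `|x - y|) => [rxy _|_]; last by rewrite mul0r ltxx.
  rewrite mul1r; have [|j /andP[j1 j2]] := dyadic (t := `|x - y| / r).
    by rewrite ler_pdivlMr// mul1r.
  exists j; split; first by apply: kernel_le => //; rewrite -ler_pdivlMr.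
  by rewrite mulrA -exprS -ltr_pdivrMr.
- move=> j; rewrite mulrA -natrM mulnn -[(2 ^ 2)%N]/4%N [(_ * rho j) ^+ _]exprMn mulrCA.
  rewrite divfK ?gt_eqF ?exprn_gt0// -mulrA ler_pM2l ?exprn_gt0//.
  rewrite {1}/rho powRM ?exprn_ge0 ?(ltW r0)// mulrC ler_wpM2l ?powR_ge0//.
  by rewrite -powR_mulrn// powRAC powR_mulrn// powR_ge0.
Qed.

(** Integrability at the origin against a Lipschitz profile: the shell
    [2^(-j-1) r < |x - y| <= 2^(-j) r] contributes a constant times
    [2^(-j (1 - s)) r^(-s)], a geometric series as [s < 1]. *)
Lemma kernel_near s : 0 < s < 1 -> exists2 C, 0 <= C & forall x r, 0 < r ->
  (\int[leb n.+1]_y ((`|x - y| < r)%R%:R * (`|x - y| / r) * frac_kernel s (x - y))%:E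
    <= (C * r `^ (- s))%:E)%E.
Proof.
move=> /andP[s0 s1]; pose q := 2 `^ (- (1 - s)) : R.
have q01 : 0 < q < 1.
  by apply: powR2N_itv; rewrite subr_gt0.
exists (2 * 8 ^+ n.+1 / (1 - q)).
  by rewrite divr_ge0 ?mulr_ge0// subr_ge0; case/andP: q01 => _ /ltW.
move=> x r r0; pose rho j : R := r / 2 ^+ j.+1.
have rho0 j : 0 < rho j by rewrite divr_gt0// exprn_gt0.
rewrite mulrAC.
(* The shell [r / 2^(j+1) < |x - y| <= r / 2^j] lies in the ball of radius
   [4 rho j], and there the profile is at most [2 rho j / r]. *)
apply: (integral_le_ball_series (x := x)
  (a := fun j => 2 * rho j / r * (rho j `^ (- s) / rho j ^+ n.+1)) (rho := fun j => 4 * rho j)) => //.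
- apply: measurable_funM; last exact: measurable_kernel_rVB.
  apply: measurable_funM; last exact/measurable_funM/measurable_cst/measurable_norm_rVB.
  by apply/measurable_natr/measurable_fun_ltr => //; exact: measurable_norm_rVB.
- by move=> y; rewrite !mulr_ge0 ?kernel_ge0// invr_ge0 ltW.
- by move=> j; rewrite !mulr_ge0 ?powR_ge0 ?invr_ge0 ?exprn_ge0 ?ltW.
- by move=> j; rewrite mulr_gt0.
- by rewrite !mulr_ge0 ?powR_ge0.
- move=> y; case: (ltP `|x - y| r) => [xyr|_]; last by rewrite !mul0r ltxx.
  rewrite mul1r; have [->|xy0] := eqVneq (x - y) 0.
    by rewrite normr0 !mul0r ltxx.
  have nxy : 0 < `|x - y| by rewrite normr_gt0.
  move=> _; have [|j /andP[j1 j2]] := dyadic (t := r / `|x - y|).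
    by rewrite ler_pdivlMr// mul1r ltW.
  move: j1 j2; rewrite ler_pdivlMr// ltr_pdivrMr// => j1 j2.
  have le2 : `|x - y| <= 2 * rho j.
    rewrite (_ : 2 * rho j = r / 2 ^+ j); first by rewrite ler_pdivlMr ?exprn_gt0// mulrC.
    by rewrite /rho exprS; field; apply: expf_neq0.
  exists j; split.
    apply: ler_pM; rewrite ?kernel_ge0 ?divr_ge0 ?(ltW r0)//.
      by rewrite ler_pM2r ?invr_gt0.
    by apply: kernel_le => //; rewrite ler_pdivrMr ?exprn_gt0// mulrC ltW.
  rewrite (le_lt_trans le2)// ltr_pM2r// ltr_nat//.
- move=> j; rewrite (_ : 2 * (4 * rho j) = 8 * rho j); last by ring.
  rewrite [(8 * _) ^+ _]exprMn.
  rewrite (_ : 2 * rho j / r * _ * _ =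
      2 * 8 ^+ n.+1 * (rho j `^ (- s) * rho j / r)); last first.
    by field; rewrite !gt_eqF ?exprn_gt0.
  rewrite -[leRHS]mulrA ler_pM2l ?mulr_gt0 ?exprn_gt0//.
  rewrite ler_pdivrMr//.
  have h (t : R) : 0 < t -> t `^ (- s) * t = t `^ (1 - s).
    by move=> t0; rewrite -{2}(powRr1 (ltW t0)) -powRD 1?addrC// (gt_eqF t0) implybT.
  rewrite h// mulrAC h// /rho powRM ?invr_ge0 ?exprn_ge0 ?(ltW r0)//.
  rewrite ler_pM2l ?powR_gt0//.
  rewrite -(@powR_invn _ 2 j.+1 (ler0n R 2)) -(powR_mulrn j (powR_ge0 _ _)).
  rewrite -!powRrM.
  by rewrite ler_powR ?ler1n// -natr1; nra.
Qed.

End kernel.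

(** * Neighbourhoods of a Lipschitz boundary *)

Section small_covers.
Context {R : realType} {n : nat}.
Local Notation E := 'rV[R]_n.+1.
Implicit Types (A B Omega : set E) (x y z : E).

(** Upper Minkowski content of codimension 1 is finite: this is what bounds the
    volume of the [r]-neighbourhood of the boundary by a multiple of [r]. *)
Definition thin A := exists (D : nat) (C : R), 0 < C /\
  forall m, (0 < m)%N -> exists cs : seq E, (size cs <= D * m ^ n)%N /\
    forall z, A z -> exists2 c, c \in cs & `|z - c| <= C / m%:R.

Lemma thin0 : thin set0.
Proof.
by exists 0%N, 1; split => // m _; exists [::]; split => // z [].
Qed.

Lemma subset_thin A B : A `<=` B -> thin B -> thin A.
Proof.
move=> AB [D [C [C0 h]]]; exists D, C; split => // m /h[cs [sz csP]].
by exists cs; split => // z /AB/csP.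
Qed.

Lemma thinU A B : thin A -> thin B -> thin (A `|` B).
Proof.
move=> [D [C [C0 hA]]] [D' [C' [C'0 hB]]].
exists (D + D')%N, (Num.max C C'); split; first by rewrite lt_max C0.
move=> m m0; have [cs [sz csP]] := hA m m0; have [cs' [sz' csP']] := hB m m0.
exists (cs ++ cs'); split; first by rewrite size_cat mulnDl leq_add.
move=> z [/csP|/csP'] [c ccs zc]; exists c; rewrite ?mem_cat ?ccs ?orbT//;
  rewrite (le_trans zc)// ler_wpM2r ?invr_ge0// le_max lexx ?orbT//.
Qed.

(** Thinness is stable under finite unions, so on a compact set it is a local
    property. *)
Lemma thin_compact A : compact A ->
  (forall x, A x -> exists2 e, 0 < e & thin (A `&` [set y | `|x - y| < e])) ->
  thin A.
Proof.
move=> cA hA.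
pose good x e := 0 < e /\ thin (A `&` [set y | `|x - y| < e]).
pose e x : R := xget 1 (good x).
have eP x : A x -> good x (e x).
  by move=> /hA[r r0 tr]; apply: xgetPex; exists r.
have := cA; rewrite compact_cover => /(_ E A (fun x => ball x (e x))).
case=> [x Ax|x Ax|D DA AD].
- by apply: ball_open; have [] := eP _ Ax.
- by exists x => //; apply: ballxx; have [] := eP _ Ax.
have lA : {in finmap.enum_fset D, forall x, A x} by move=> x /DA; rewrite inE.
suff : thin (A `&` \bigcup_(i in [set` finmap.enum_fset D]) ball i (e i)).
  by apply: subset_thin => z Az; split => //; exact: AD.
elim: (finmap.enum_fset D) lA => [|x l IH] lA.
  by apply: subset_thin thin0 => y [_ [x]].
apply: (@subset_thin _ ((A `&` [set y | `|x - y| < e x]) `|`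
    (A `&` \bigcup_(i in [set` l]) ball i (e i)))).
  move=> y [Ay [x' /=]]; rewrite inE => /predU1P[->|x'l] x'y.
    by left; split => //; rewrite -ball_normE in x'y.
  by right; split => //; exists x'.
apply: thinU; first by have [] := eP x (lA _ (mem_head _ _)).
by apply: IH => y yl; apply: lA; rewrite inE yl orbT.
Qed.

Lemma norm_col'_le (v w : E) (j : 'I_n.+1) : `|col' j v - col' j w| <= `|v - w|.
Proof.
apply/rV_normP => // i; rewrite !mxE.
by have := mx_coord_le (v - w) ord0 (lift j i); rewrite !mxE.
Qed.

(** The projection of the graph along the last axis lies in a cube of side
    [2 B]; cutting that cube into [m ^ n] cells and picking one point of the graph
    over each cell gives the centres, at distance [O(1 / m)] from every point
    over the same cell because [g] is Lipschitz. *)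
Lemma thin_graph A (U : 'M[R]_n.+1) (g : 'rV[R]_n -> R) (L B : R) :
  0 <= L -> 0 < B -> U *m U^T = 1%:M ->
  (forall a b, `|g a - g b| <= L * `|a - b|) ->
  (forall x, A x -> `|x *m U| < B /\ g (col' ord_max (x *m U)) = (x *m U) ord0 ord_max) ->
  thin A.
Proof.
move=> L0 B0 UU gL AP.
pose K := n.+1%:R * `|U^T| * (1 + L).
have K0 : 0 <= K by rewrite !mulr_ge0// addr_ge0.
exists 1%N, (K * (2 * B) + 1); split.
  by rewrite ltr_wpDl// mulr_ge0// mulr_ge0// ltW.
case=> // m _.
pose t x (i : 'I_n) := (col' ord_max (x *m U) ord0 i + B) / (2 * B) * m.+1%:R.
pose idx x : {ffun 'I_n -> 'I_m.+1} := [ffun i => inord (Num.truncn (t x i))].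
have tP x i : A x -> 0 <= t x i < m.+1%:R.
  move=> /AP[xB _].
  have : `|(x *m U) ord0 (lift ord_max i)| < B by rewrite (le_lt_trans (mx_coord_le _ _ _)).
  rewrite ltr_norml => /andP[x1 x2]; rewrite /t mxE; apply/andP; split.
    rewrite mulr_ge0// divr_ge0//; lra.
  rewrite gtr_pMl// ltr_pdivrMr; lra.
(* Over a cell that meets no point of [A], [rep] returns the arbitrary value
   [0]. *)
pose rep f : E := xget 0 [set x | A x /\ idx x = f].
exists [seq rep f | f <- enum {: {ffun 'I_n -> 'I_m.+1}}]; split.
  by rewrite size_map -cardE card_ffun !card_ord mul1n.
move=> z Az; exists (rep (idx z)).
  by apply/mapP; exists (idx z) => //; rewrite mem_enum.
have [Ac ic] : A (rep (idx z)) /\ idx (rep (idx z)) = idx z.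
  by apply: (xgetPex 0 (P := [set x | A x /\ idx x = idx z])); exists z.
move: (rep _) Ac ic => c Ac ic.
have [_ zg] := AP _ Az; have [_ cg] := AP _ Ac.
pose d := (2 * B) / m.+1%:R.
have d0 : 0 <= d by rewrite divr_ge0// mulr_ge0// ltW.
have coord : `|col' ord_max (z *m U) - col' ord_max (c *m U)| <= d.
  apply/rV_normP => // i.
  have : Num.truncn (t c i) = Num.truncn (t z i).
    have := congr1 (fun f : {ffun 'I_n -> 'I_m.+1} => f i : nat) ic.
    rewrite !ffunE !inordK//.
      have /andP[t0 tm] := tP z i Az.
      by rewrite -(ltr_nat R) (le_lt_trans _ tm)// truncn_le.
    have /andP[t0 tm] := tP c i Ac.
    by rewrite -(ltr_nat R) (le_lt_trans _ tm)// truncn_le.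
  have /andP[tz0 _] := tP z i Az; have /andP[tc0 _] := tP c i Ac.
  have /andP[z1 z2] := truncn_itv tz0; have /andP[c1 c2] := truncn_itv tc0.
  move=> tE; rewrite tE in c1 c2.
  have : `|t z i - t c i| <= 1.
    by rewrite ler_distl; apply/andP; split; move: z1 z2 c1 c2; rewrite -natr1; lra.
  rewrite /t -mulrBl -mulrBl -(mulrA _ _^-1) normrM.
  rewrite [X in _ * X]ger0_norm; last by rewrite mulr_ge0// invr_ge0 mulr_ge0// ltW.
  rewrite -ler_pdivlMr; last by rewrite mulr_gt0// invr_gt0 mulr_gt0.
  rewrite !mxE div1r invfM invrK opprD addrACA subrr addr0.
  by rewrite /d mulrC.
have zc : `|z *m U - c *m U| <= (1 + L) * d.
  move: coord zg cg; move: (z *m U) (c *m U) => p q coord pg qg.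
  apply/rV_normP => [|i]; first by rewrite mulr_ge0// addr_ge0.
  case: (unliftP ord_max i) => [j|] ->.
    have := le_trans (mx_coord_le _ ord0 j) coord; rewrite !mxE => /le_trans; apply.
    by rewrite ler_peMl// lerDl.
  rewrite !mxE -pg -qg (le_trans (gL _ _))// mulrDl mul1r.
  by rewrite (@le_trans _ _ (L * d))// ?ler_wpM2l// lerDr.
have UU' : z - c = (z *m U - c *m U) *m U^T.
  by rewrite -mulmxBl -mulmxA UU mulmx1.
rewrite UU' (le_trans (mulmx_norm_le _ _))//.
rewrite (@le_trans _ _ (K * d))//.
  by rewrite /K -[leRHS]mulrA ler_wpM2l// mulr_ge0.
rewrite /d mulrA ler_wpM2r ?invr_ge0//.
by rewrite lerDl.
Qed.

(** The local description identifies the domain with the region above a graph; a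
    boundary point lies on the graph itself, since [h], the height of the graph
    over the point, is nonnegative off [Omega] and a limit of negative values. *)
Lemma boundary_thin Omega : bounded_set Omega -> open Omega ->
  lipschitz_boundary Omega -> thin (closure Omega `\` Omega).
Proof.
move=> bO oO lO; apply: thin_compact.
  apply: bounded_closed_compact.
    have [M M0 OM] := pinfty_ex_gt0 bO.
    exists (M + 1); split; first exact: num_real.
    move=> M' MM' x [clx _] /=.
    have [x' [Ox' xx']] := clx _ (nbhsx_ballx x 1 ltr01).
    rewrite -ball_normE/= in xx'.
    rewrite -(subrK x' x) (le_trans (ler_normD _ _))//.
    by have := OM x' Ox'; rewrite /=; lra.
  apply: closedI; first exact: closed_closure.
  exact: open_closedC.
move=> x0 bx0; have [] := lO x0; first by have /interior_id -> := oO.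
move=> U [g [UU lg /nbhs_ballP[e /= e0 eO]]].
exists e => //.
have [L L0 gL'] := pinfty_ex_gt0 lg.
have gL a b : `|g a - g b| <= L * `|a - b| by exact: (gL' (a, b)).
pose K := n.+1%:R * `|U|.
have K0 : 0 <= K by rewrite mulr_ge0.
apply: (thin_graph (U := U) (g := g) (L := L) (B := K * (`|x0| + e) + 1)) => //.
- exact: ltW.
- by rewrite ltr_wpDl// mulr_ge0// addr_ge0// ltW.
move=> x [[clx nOx] xe]; split.
  rewrite (le_lt_trans (mulmx_norm_le _ _))//.
  rewrite (@le_lt_trans _ _ (K * (`|x0| + e)))// ?ltrDl// ler_wpM2l//.
  rewrite -(subrK x0 x) (le_trans (ler_normD _ _))// addrC lerD2l distrC.
  exact: ltW.
pose h y := g (col' ord_max (y *m U)) - (y *m U) ord0 ord_max.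
have hL y y' : `|h y - h y'| <= (L + 1) * K * `|y - y'|.
  have -> : h y - h y' = (g (col' ord_max (y *m U)) - g (col' ord_max (y' *m U))) -
      ((y *m U) ord0 ord_max - (y' *m U) ord0 ord_max) by rewrite /h; ring.
  rewrite (le_trans (ler_normB _ _))// -mulrA mulrDl mul1r.
  have yy' : `|y *m U - y' *m U| <= K * `|y - y'| by rewrite -mulmxBl mulmx_norm_le.
  apply: lerD.
    rewrite (le_trans (gL _ _))// ler_wpM2l ?(ltW L0)//.
    exact: le_trans (norm_col'_le _ _ _) yy'.
  apply: le_trans yy'; have := mx_coord_le (y *m U - y' *m U) ord0 ord_max.
  by move: (y *m U) (y' *m U) => p q; rewrite !mxE.
have h0 : 0 <= h x.
  rewrite subr_ge0 leNgt; apply/negP => hx; apply: nOx; apply/eO => //.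
  by rewrite -ball_normE.
suff : h x = 0 by move=> /eqP; rewrite subr_eq0 => /eqP.
apply/eqP; rewrite eq_le h0 andbT leNgt; apply/negP => hx.
pose r := Num.min (e - `|x0 - x|) (h x / ((L + 1) * K + 1)).
have K1 : 0 < (L + 1) * K + 1 by rewrite ltr_wpDl// mulr_ge0// addr_ge0// ltW.
have r0 : 0 < r by rewrite lt_min subr_gt0 xe divr_gt0.
have [x' [Ox' xx']] := clx _ (nbhsx_ballx x r r0).
move: xx'; rewrite -ball_normE/= lt_min => /andP[xx'1 xx'2].
have : h x' < 0.
  rewrite subr_lt0; apply/eO => //; rewrite -ball_normE/=.
  rewrite -(subrK x x0) -addrA (le_lt_trans (ler_normD _ _))//.
  by move: xx'1; rewrite ltrBrDl.
have := hL x x'; move: xx'2; rewrite ltr_pdivlMr// => xx'2.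
rewrite ler_norml => /andP[_ +] h'0.
by rewrite mulrDr mulr1 in xx'2; have := normr_ge0 (x - x'); lra.
Qed.

(** The first point of the segment from [x] to [y] outside [Omega] is a boundary
    point. *)
Lemma segment_meets_boundary Omega x y : open Omega -> Omega x -> ~ Omega y ->
  exists z, [/\ (closure Omega `\` Omega) z, `|x - z| <= `|x - y| & `|y - z| <= `|x - y|].
Proof.
move=> oO Ox nOy.
pose p (t : R) := x + t *: (y - x).
have pB t u : `|p t - p u| = `|t - u| * `|x - y|.
  by rewrite /p opprD addrACA subrr add0r -scalerBl normrZ (distrC y).
have p0 : p 0 = x by rewrite /p scale0r addr0.
have p1 : p 1 = y by rewrite /p scale1r addrC subrK.
pose T : set R := [set t | 0 <= t <= 1 /\ ~ Omega (p t)].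
have T1 : T 1 by split; rewrite ?p1// ler01 lexx.
have lT : lbound T 0 by move=> t [/andP[]].
have hT : has_inf T by split; [exists 1|exists 0].
pose t0 := inf T.
have t00 : 0 <= t0 by apply: lb_le_inf => //; exists 1.
have t01 : t0 <= 1 by apply: ge_inf => //; exists 0.
have D1 : 0 < `|x - y| + 1 by rewrite ltr_wpDl.
have nO0 : ~ Omega (p t0).
  move=> Op; have /nbhs_ballP[e /= e0 eO] : nbhs (p t0) Omega by exact: open_nbhs_nbhs.
  have [t Tt tt0] := inf_adherent (divr_gt0 e0 D1) hT; have [_ nOt] := Tt.
  apply: nOt; apply: eO; rewrite -ball_normE/= pB.
  have tT : t0 <= t by apply: ge_inf => //; exists 0.
  rewrite distrC ger0_norm ?subr_ge0//.
  have : t - t0 < e / (`|x - y| + 1) by rewrite ltrBlDl.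
  rewrite ltr_pdivlMr// mulrDr mulr1 => /(le_lt_trans _); apply.
  by rewrite lerDl subr_ge0.
exists (p t0); split.
- split => // B /nbhs_ballP[e /= e0 eB].
  have t0n : t0 != 0 by apply/eqP => t00'; apply: nO0; rewrite t00' p0.
  have tpos : 0 < t0 by rewrite lt0r t0n.
  pose t := Num.max 0 (t0 - e / (`|x - y| + 1)).
  have tt0 : t < t0 by rewrite gt_max tpos/= gtrBl divr_gt0.
  have t0' : 0 <= t by rewrite le_max lexx.
  exists (p t); split.
    apply: contrapT => nOt; have : t0 <= t.
      apply: ge_inf; first by exists 0.
      by split => //; rewrite t0'/= (le_trans (ltW tt0)).
    by rewrite leNgt tt0.
  apply: eB; rewrite -ball_normE/= pB ger0_norm ?subr_ge0 ?(ltW tt0)//.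
  have : t0 - t <= e / (`|x - y| + 1).
    by rewrite lerBlDl -lerBlDr le_max lexx orbT.
  rewrite ler_pdivlMr// mulrDr mulr1 => /(lt_le_trans _); apply.
  by rewrite ltrDl subr_gt0.
- by rewrite -{1}p0 pB sub0r normrN ger0_norm// ler_piMl.
- by rewrite -{1}p1 pB ger0_norm ?subr_ge0// ler_piMl// lerBlDr lerDl.
Qed.

End small_covers.

Section cutoff.
Context {R : realType} {n : nat}.
Local Notation E := 'rV[R]_n.+1.
Implicit Types (Omega S : set E) (x y z c : E) (psi : E -> R).

Lemma min_dist (a b a' b' d : R) :
  `|a - a'| <= d -> `|b - b'| <= d -> `|Num.min a b - Num.min a' b'| <= d.
Proof.
rewrite !ler_norml => /andP[a1 a2] /andP[b1 b2].
by case: (leP a b) => ab; case: (leP a' b') => ab'; apply/andP; split; lra.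
Qed.

Lemma max0_dist (a a' d : R) : `|a - a'| <= d -> `|Num.max 0 a - Num.max 0 a'| <= d.
Proof.
rewrite !ler_norml => /andP[a1 a2].
by case: (leP 0 a) => a0; case: (leP 0 a') => a'0; apply/andP; split; lra.
Qed.

(** The minimum of the radial cutoffs [max 0 (|x - c| / r - 2)] over the centres
    [c], and 1: it keeps the Lipschitz constant [1 / r] whatever their number. *)
Lemma cutoff_balls (r : R) (cs : seq E) : 0 < r -> exists psi S,
  [/\ forall x, 0 <= psi x <= 1, forall x y, `|psi x - psi y| <= `|x - y| / r &
      forall x c, psi x != 0 -> c \in cs -> 2 * r < `|x - c|] /\
  [/\ measurable S, forall x, ~ S x -> psi x = 1 &
      (leb n.+1 S <= ((size cs)%:R * (6 * r) ^+ n.+1)%:E)%E].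
Proof.
move=> r0; elim: cs => [|c cs [psi [S [[psi01 psiL psi0] [mS psi1 lS]]]]].
  exists (cst 1), set0; split; split => //=.
  - by move=> x; rewrite ler01 lexx.
  - by move=> x y; rewrite subrr normr0 divr_ge0// ltW.
  - by rewrite measure0 mul0r.
pose f x := Num.max 0 (`|x - c| / r - 2).
exists (fun x => Num.min (psi x) (f x)), (S `|` [set y | `|c - y| < 3 * r]).
have f0 x : 0 <= f x by rewrite le_max lexx.
split; split.
- move=> x; have /andP[h0 h1] := psi01 x.
  by rewrite le_min h0 f0/= ge_min h1.
- move=> x y; apply: min_dist => //; apply: max0_dist.
  rewrite opprB addrA subrK -mulrBl normrM [X in _ * X]gtr0_norm ?invr_gt0//.
  rewrite ler_wpM2r ?invr_ge0 ?(ltW r0)//.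
  by rewrite (le_trans (ler_dist_dist _ _))// opprB addrA subrK.
- move=> x c' mn; have /andP[p0 _] := psi01 x; rewrite inE => /predU1P[->|c'cs].
    rewrite ltNge; apply/negP => xc; move/eqP: mn; apply.
    have -> : f x = 0 by apply/max_idPl; rewrite subr_le0 ler_pdivrMr.
    by rewrite min_r.
  by apply: psi0 => //; apply: contra_neq mn => ->; rewrite min_l.
- by apply: measurableU => //; exact: measurable_norm_ball.
- move=> x /not_orP[nS /negP]; rewrite -leNgt distrC => xc.
  rewrite psi1// min_l// le_max; apply/orP; right.
  by rewrite lerBrDr ler_pdivlMr// -natrD.
- have r3 : 0 < 3 * r by rewrite mulr_gt0.
  apply: le_trans (@measureU2 _ _ _ (leb n.+1) _ _ mS (measurable_norm_ball _ _)) _.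
  rewrite (_ : (size (c :: cs))%:R * (6 * r) ^+ n.+1 =
    (size cs)%:R * (6 * r) ^+ n.+1 + (2 * (3 * r)) ^+ n.+1); last first.
    by rewrite /= -natr1 mulrDl mul1r mulrA -natrM.
  by rewrite EFinD -(leb_norm_ball c r3); apply: leeD.
Qed.

(** The [r]-neighbourhood of the boundary has volume [O(r)], so a cutoff at scale
    [r] lives on a strip [S] with [|S| r^(-s) = O(r^(1 - s))]. That quantity
    bounds its energy, and [s < 1] makes it small. *)
Lemma boundary_cutoff Omega (s eta : R) : bounded_set Omega -> open Omega ->
  lipschitz_boundary Omega -> 0 < s < 1 -> 0 < eta ->
  exists r psi S, [/\ 0 < r, forall x, 0 <= psi x <= 1,
      forall x y, `|psi x - psi y| <= `|x - y| / r &
      forall x y, psi x != 0 \/ psi y != 0 -> Omega x -> ~ Omega y -> r < `|x - y|] /\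
  [/\ measurable S, forall x, ~ S x -> psi x = 1,
      (leb n.+1 S <= eta%:E)%E & (leb n.+1 S * (r `^ (- s))%:E <= eta%:E)%E].
Proof.
move=> bO oO lO /andP[s0 s1] eta0.
have [D [C [C0 DC]]] := boundary_thin bO oO lO.
pose K1 := D%:R * (6 * C) ^+ n.+1; pose K2 := K1 * C `^ (- s).
have K10 : 0 <= K1 by rewrite mulr_ge0// exprn_ge0// mulr_ge0// ltW.
have K20 : 0 <= K2 by rewrite mulr_ge0// powR_ge0.
(* Large enough for both smallness conditions, [K1 / m] and [K2 / m^(1 - s)]. *)
pose m := (Num.truncn (K1 / eta) + Num.truncn ((K2 / eta) `^ (1 - s)^-1)).+1.
have m0 : 0 < m%:R :> R by rewrite ltr0n.
have mK1 : K1 / eta <= m%:R.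
  by rewrite ltW// (lt_le_trans (truncnS_gt _))// ler_nat ltnS leq_addr.
have mK2 : K2 / eta <= m%:R `^ (1 - s).
  have : (K2 / eta) `^ (1 - s)^-1 <= m%:R.
    by rewrite ltW// (lt_le_trans (truncnS_gt _))// ler_nat ltnS leq_addl.
  move=> /(ge0_ler_powR (r := 1 - s)).
  rewrite -powRrM mulVf ?gt_eqF ?subr_gt0// powRr1 ?divr_ge0 ?(ltW eta0)//; apply.
  - by rewrite subr_ge0 ltW.
  - by rewrite nnegrE powR_ge0.
  - by rewrite nnegrE ltW.
have [cs [sz csP]] := DC m (ltn0Sn _).
pose r := C / m%:R; have r0 : 0 < r by rewrite divr_gt0.
have [psi [S [[psi01 psiL psi0] [mS psi1 lS]]]] := cutoff_balls cs r0.
have far x z : psi x != 0 -> (closure Omega `\` Omega) z -> r < `|x - z|.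
  move=> px /csP[c ccs zc]; have := psi0 _ _ px ccs.
  move: zc; rewrite -/r => zc xc; have := ler_distD z x c; lra.
have lS1 : (leb n.+1 S <= (K1 / m%:R)%:E)%E.
  rewrite (le_trans lS)// lee_fin.
  apply: (@le_trans _ _ ((D * m ^ n)%:R * (6 * r) ^+ n.+1)).
    by rewrite ler_wpM2r ?ler_nat// exprn_ge0// mulr_ge0// ltW.
  rewrite /K1 /r natrM natrX mulrA [X in _ * X <= _]exprMn exprVn.
  rewrite [m%:R ^+ n.+1]exprS le_eqVlt; apply/orP; left; apply/eqP.
  by field; rewrite (gt_eqF m0) expf_neq0// (gt_eqF m0).
exists r, psi, S; split; split => //.
- move=> x y pxy Ox nOy.
  have [z [bz xz yz]] := segment_meets_boundary oO Ox nOy.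
  by case: pxy => /far/(_ bz); move=> /lt_le_trans; apply.
- rewrite (le_trans lS1)// lee_fin ler_pdivrMr//.
  by rewrite -ler_pdivrMl// mulrC.
- apply: (@le_trans _ _ ((K1 / m%:R)%:E * (r `^ (- s))%:E)%E).
    by rewrite lee_wpmul2r// lee_fin powR_ge0.
  rewrite -EFinM lee_fin /r powRM ?invr_ge0 ?(ltW C0)//.
  rewrite mulrACA -/K2.
  have -> : m%:R^-1 * m%:R^-1 `^ (- s) = (m%:R `^ (1 - s))^-1 :> R.
    rewrite -{1}(powRr1 (_ : 0 <= m%:R^-1)) ?invr_ge0// -powRD; last first.
      by rewrite invr_eq0 (gt_eqF m0) implybT.
    by rewrite -(powR_inv1 (ltW m0)) -powRrM mulN1r powRN.
  by rewrite ler_pdivrMr ?powR_gt0// -ler_pdivrMl// mulrC.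
Qed.

End cutoff.

(** * Mollification of translation invariant energies *)

Section lipschitz_measurable.
Context {R : realType} {n : nat}.
Local Notation E := 'rV[R]_n.+1.

Lemma lipschitz_measurable (f : E -> R) (L : R) :
  (forall x y, `|f x - f y| <= L * `|x - y|) -> measurable_fun setT f.
Proof.
move=> fL; apply: continuous_measurable_rV => x; move=> B /nbhs_ballP[e /= e0 eB]; apply/nbhs_ballP.
have L1 : 0 < `|L| + 1 by rewrite ltr_wpDl.
exists (e / (`|L| + 1)); first exact: divr_gt0.
move=> y; rewrite -ball_normE/= ltr_pdivlMr// => xy.
apply: eB; rewrite -ball_normE/= (le_lt_trans (fL _ _))// (le_lt_trans _ xy)// mulrC.
by rewrite ler_wpM2l// (le_trans (ler_norm _))// lerDl.
Qed.

End lipschitz_measurable.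

Section mollifier.
Context {R : realType} {n : nat}.
Local Notation E := 'rV[R]_n.+1.
Local Notation mu := (leb n.+1).

Record mollifier (eps : R) (rho : E -> R) : Prop := Mollifier {
  mollifier_ge0 : forall z, 0 <= rho z ;
  mollifier_int : (\int[mu]_z (rho z)%:E = 1)%E ;
  mollifier_supp : forall z, rho z != 0 -> `|z| < eps ;
  mollifier_le : forall z, rho z <= 2 / eps ^+ n.+1 ;
  mollifier_lip : exists2 L, 0 <= L & forall z z', `|rho z - rho z'| <= L * `|z - z'|
}.

(** A normalised cone; its mass is at least that of half the indicator of the
    ball of radius [eps / 2], whence the bound [2 / eps ^ n.+1]. *)
Lemma mollifier_exists (eps : R) : 0 < eps -> exists rho, mollifier eps rho.
Proof.
move=> eps0.
pose theta (z : E) := Num.max 0 (1 - `|z| / eps).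
have theta0 z : 0 <= theta z by rewrite le_max lexx.
have theta1 z : theta z <= 1.
  by rewrite ge_max ler01/= gerBl divr_ge0// ltW.
have thetaL z z' : `|theta z - theta z'| <= eps^-1 * `|z - z'|.
  have h : `|(1 - `|z| / eps) - (1 - `|z'| / eps)| <= eps^-1 * `|z - z'|.
    rewrite opprB addrC addrA subrK -mulrBl normrM mulrC gtr0_norm ?invr_gt0//.
    by rewrite ler_wpM2l ?invr_ge0 ?(ltW eps0)// distrC ler_dist_dist.
  exact: max0_dist.
have mtheta : measurable_fun setT theta := lipschitz_measurable thetaL.
have theta_supp z : theta z != 0 -> `|z| < eps.
  apply: contraNT; rewrite -leNgt => epsz; apply/eqP/max_idPl.
  by rewrite subr_le0 ler_pdivlMr// mul1r.
have mB r := @measurable_norm_ball R n 0 r.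
have B r : 0 < r -> (\int[mu]_z (\1_[set y : E | (`|0 - y| < r)%R] z)%:E =
    ((2 * r) ^+ n.+1)%:E)%E.
  move=> r0; rewrite integral_indic ?setIT//.
  exact: leb_norm_ball.
have IZ : (\int[mu]_z (theta z)%:E <= ((2 * eps) ^+ n.+1)%:E)%E.
  rewrite -B//; apply: ge0_le_integral => //.
  - by move=> z _; rewrite lee_fin.
  - exact/measurable_EFinP.
  - by apply/measurable_EFinP; apply: measurable_indic.
  move=> z _; rewrite lee_fin indicE.
  have [->|/theta_supp ze] := eqVneq (theta z) 0; first by [].
  by rewrite mem_set//= sub0r normrN.
have IZ' : ((eps ^+ n.+1 / 2)%:E <= \int[mu]_z (theta z)%:E)%E.
  have e2 : 0 < eps / 2 by rewrite divr_gt0.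
  rewrite (_ : _%:E = (2^-1%:E * \int[mu]_z (\1_[set y : E | (`|0 - y| < eps / 2)%R] z)%:E)%E);
    last by rewrite B// -EFinM mulrC mulrCA divff// mulr1.
  rewrite -ge0_integralZl//; last first.
  - by apply/measurable_EFinP; apply: measurable_indic.
  apply: ge0_le_integral => //.
  - by apply/measurable_EFinP/measurable_funM => //.
  - exact/measurable_EFinP.
  move=> z _; rewrite -EFinM lee_fin indicE.
  have [|_] := boolP (z \in _); last by rewrite mulr0.
  rewrite inE/= sub0r normrN => ze.
  rewrite mulr1 le_max; apply/orP; right.
  have : `|z| / eps < 2^-1 by rewrite ltr_pdivrMr// mulrC.
  lra.
pose Z := fine (\int[mu]_z (theta z)%:E)%E.
have ZE : (\int[mu]_z (theta z)%:E = Z%:E)%E.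
  rewrite fineK// ge0_fin_numE ?(le_lt_trans IZ) ?ltry//.
  by apply: integral_ge0 => z _; rewrite lee_fin.
have epsn : 0 < eps ^+ n.+1 by rewrite exprn_gt0.
have Zge : eps ^+ n.+1 / 2 <= Z by rewrite -lee_fin -ZE.
have Z0 : 0 < Z by rewrite (lt_le_trans _ Zge)// divr_gt0.
exists (fun z => theta z / Z); split.
- by move=> z; rewrite divr_ge0// ltW.
- under eq_integral do rewrite mulrC EFinM.
  rewrite ge0_integralZl//.
  + by rewrite ZE -EFinM mulVf// gt_eqF.
  + exact/measurable_EFinP.
  + by move=> z _; rewrite lee_fin.
  + by rewrite lee_fin invr_ge0 ltW.
- by move=> z tz; apply: theta_supp; apply: contra_neq tz => ->; rewrite mul0r.
- move=> z; rewrite ler_pdivrMr// (le_trans (theta1 z))//.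
  by rewrite mulrAC ler_pdivlMr// mul1r mulrC -ler_pdivrMr.
- exists (eps^-1 / Z); first by rewrite divr_ge0 ?invr_ge0// ltW.
  move=> z z'; rewrite -mulrBl normrM [X in _ * X]gtr0_norm ?invr_gt0//.
  by rewrite mulrAC ler_wpM2r// invr_ge0 ltW.
Qed.

End mollifier.

Section average.
Context {R : realType} {n : nat}.
Local Notation E := 'rV[R]_n.+1.
Local Notation mu := (leb n.+1).
Variables (eps : R) (rho : E -> R).
Hypothesis rhoP : mollifier eps rho.

(** The class on which averages against a mollifier are finite and linear. *)
Definition bounded_measurable (h : E -> R) :=
  measurable_fun setT h /\ exists M, forall z, `|h z| <= M.

Definition average (h : E -> R) := fine (\int[mu]_z (h z * rho z)%:E)%E.

Lemma measurable_mollifier : measurable_fun setT rho.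
Proof. by have [L _ rL] := mollifier_lip rhoP; exact: lipschitz_measurable rL. Qed.

Let intrho : mu.-integrable setT (fun z => (rho z)%:E).
Proof.
apply/integrableP; split; first by apply/measurable_EFinP; exact: measurable_mollifier.
under eq_integral => z _ do rewrite /= ger0_norm ?(mollifier_ge0 rhoP)//.
by rewrite (mollifier_int rhoP) ltry.
Qed.

Lemma integrable_average h : bounded_measurable h ->
  mu.-integrable setT (fun z => (h z * rho z)%:E).
Proof.
move=> [mh [M hM]].
apply: le_integrable (integrableZl measurableT M intrho) => //.
  by apply/measurable_EFinP/measurable_funM => //; exact: measurable_mollifier.
move=> z _ /=; rewrite lee_fin !normrM ler_wpM2r//.
by rewrite (le_trans (hM z))// ler_norm.
Qed.

Lemma averageE h : bounded_measurable h ->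
  (average h)%:E = (\int[mu]_z (h z * rho z)%:E)%E.
Proof.
by move=> bh; rewrite fineK//; exact: integrable_fin_num (integrable_average bh).
Qed.

Lemma bounded_measurable_cst c : bounded_measurable (cst c).
Proof. by split => //; exists `|c|. Qed.

Lemma bounded_measurableB h g : bounded_measurable h -> bounded_measurable g ->
  bounded_measurable (fun z => h z - g z).
Proof.
move=> [mh [M hM]] [mg [M' gM]]; split; first exact: measurable_funB.
by exists (M + M') => z; rewrite (le_trans (ler_normB _ _))// lerD.
Qed.

Lemma average_cst c : average (cst c) = c.
Proof.
apply: EFin_inj; rewrite averageE; last exact: bounded_measurable_cst.
under eq_integral do rewrite EFinM.
rewrite integralZl//.
rewrite [X in (_ * X)%E](_ : _ = 1%E) ?mule1//; exact: mollifier_int rhoP.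
Qed.

Lemma averageB h g : bounded_measurable h -> bounded_measurable g ->
  average (fun z => h z - g z) = average h - average g.
Proof.
move=> bh bg; apply: EFin_inj; rewrite EFinB !averageE//; last exact: bounded_measurableB.
rewrite -integralB_EFin//; [|exact: integrable_average..].
by apply: eq_integral => z _; rewrite mulrBl EFinB.
Qed.

Lemma average_norm_le h : bounded_measurable h ->
  (`|average h|%:E <= \int[mu]_z (`|h z| * rho z)%:E)%E.
Proof.
move=> bh; rewrite -abse_EFin averageE//.
apply: le_trans (le_abse_integral _ _ _) _ => //.
  by have /measurable_int := integrable_average bh.
rewrite le_eqVlt; apply/orP; left; apply/eqP; apply: eq_integral => z _ /=.
by rewrite normrM [X in _ * X]ger0_norm// (mollifier_ge0 rhoP).
Qed.

Lemma average_norm_bound (h : E -> R) M : measurable_fun setT h -> (forall z : E, `|h z| <= M) ->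
  `|average h| <= M.
Proof.
move=> mh hM; rewrite -lee_fin (le_trans (average_norm_le _))//.
  by split => //; exists M.
rewrite -(average_cst M) averageE; last exact: bounded_measurable_cst.
apply: ge0_le_integral => //.
- by move=> z _; rewrite lee_fin mulr_ge0// (mollifier_ge0 rhoP).
- apply/measurable_EFinP/measurable_funM; last exact: measurable_mollifier.
  exact: measurableT_comp.
- by apply/measurable_EFinP/measurable_funM => //; exact: measurable_mollifier.
- by move=> z _; rewrite lee_fin ler_wpM2r// (mollifier_ge0 rhoP).
Qed.

Lemma average_neq0 h : average h != 0 -> exists2 z, `|z| < eps & h z != 0.
Proof.
move=> a0; apply: contrapT => nex; move/eqP: a0; apply.
rewrite /average (eq_integral (cst 0%E)) ?integral0// => z _.
have [->|rz] := eqVneq (rho z) 0; first by rewrite mulr0.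
have [->|hz] := eqVneq (h z) 0; first by rewrite mul0r.
by exfalso; apply: nex; exists z => //; exact: mollifier_supp rz.
Qed.

End average.

Section whole_space_energy.
Context {R : realType} {n : nat} (s : R).
Local Notation E := 'rV[R]_n.+1.
Local Notation mu := (leb n.+1).
Local Notation K := (@frac_kernel R n s).

(** The seminorm with exponent 1 over pairs of points of the whole space; unlike
    the one over [Qset Omega], it is invariant under translations. *)
Definition energy (f : E -> R) : \bar R :=
  (\int[mu \x mu]_z (`|f z.1 - f z.2| * K (z.1 - z.2))%:E)%E.

Lemma energy_density_ge0 (f : E -> R) x y : 0 <= `|f x - f y| * K (x - y).
Proof. by rewrite mulr_ge0// kernel_ge0. Qed.

Lemma measurable_energy_density (f : E -> R) : measurable_fun setT f ->
  measurable_fun setT (fun z : E * E => (`|f z.1 - f z.2| * K (z.1 - z.2))%:E).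
Proof.
move=> mf; apply/measurable_EFinP/measurable_funM.
  apply: measurableT_comp => //; apply: measurable_funB.
    exact: (measurableT_comp mf measurable_fst).
  exact: (measurableT_comp mf measurable_snd).
exact: measurable_kernel_rVB.
Qed.

Lemma measurable_energy_density_l (f : E -> R) x : measurable_fun setT f ->
  measurable_fun setT (fun y : E => (`|f x - f y| * K (x - y))%:E).
Proof.
move=> mf; apply/measurable_EFinP/measurable_funM.
  by apply: measurableT_comp => //; exact: measurable_funB.
exact: measurable_kernel_rVB.
Qed.

Lemma energyE (f : E -> R) : measurable_fun setT f ->
  energy f = (\int[mu]_x \int[mu]_y (`|f x - f y| * K (x - y))%:E)%E.
Proof.
move=> mf; apply: (fubini_tonelli1 (fun z : E * E => (`|f z.1 - f z.2| * K (z.1 - z.2))%:E)).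
  exact: measurable_energy_density.
by move=> z; rewrite lee_fin energy_density_ge0.
Qed.

Lemma energy_translate (f : E -> R) (a : E) : measurable_fun setT f ->
  energy (fun x => f (x + a)) = energy f.
Proof.
move=> mf.
have mfa : measurable_fun setT (fun x : E => f (x + a)).
  exact: (measurableT_comp mf (measurable_translate a)).
rewrite (energyE mfa) (energyE mf).
rewrite -[RHS](ge0_integral_translate a).
- apply: eq_integral => x _.
  rewrite -[RHS](ge0_integral_translate a).
  + by apply: eq_integral => y _; rewrite opprD addrACA subrr addr0.
  + exact: measurable_energy_density_l.
  + by move=> y; rewrite lee_fin energy_density_ge0.
- apply: (measurable_fun_fubini_tonelli_F (fun z : E * E => (`|f z.1 - f z.2| * K (z.1 - z.2))%:E)).
    exact: measurable_energy_density.
  by move=> z; rewrite lee_fin energy_density_ge0.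
- by move=> x; apply: integral_ge0 => y _; rewrite lee_fin energy_density_ge0.
Qed.

End whole_space_energy.

Section convolution.
Context {R : realType} {n : nat}.
Local Notation E := 'rV[R]_n.+1.
Local Notation mu := (leb n.+1).
Variables (eps : R) (rho : E -> R).
Hypothesis rhoP : mollifier eps rho.
Variables (w : E -> R) (M : R).
Hypotheses (mw : measurable_fun setT w) (wM : forall x, `|w x| <= M).

Definition mollify (x : E) := average rho (fun z => w (z + x)).

Let M0 : 0 <= M. Proof. exact: le_trans (normr_ge0 _) (wM 0). Qed.

Lemma bounded_measurable_translate x : bounded_measurable (fun z => w (z + x)).
Proof.
split; last by exists M.
exact: (measurableT_comp mw (measurable_translate x)).
Qed.

Lemma mollify_bound x : `|mollify x| <= M.
Proof.
apply: (average_norm_bound rhoP) => //.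
by have [] := bounded_measurable_translate x.
Qed.

Lemma mollify_neq0 x : mollify x != 0 -> exists2 y : E, `|x - y| < eps & w y != 0.
Proof.
move=> /(average_neq0 rhoP)[z ze wz]; exists (z + x) => //.
by rewrite opprD addrCA subrr addr0 normrN.
Qed.

Lemma mollify_dist x y :
  (`|mollify x - mollify y|%:E <=
   \int[mu]_z (`|w ((z : E) + x) - w ((z : E) + y)| * rho z)%:E)%E.
Proof.
rewrite -(averageB rhoP); [|exact: bounded_measurable_translate..].
apply: (average_norm_le rhoP); apply: bounded_measurableB;
  exact: bounded_measurable_translate.
Qed.

Lemma mollify_error x :
  (`|mollify x - w x|%:E <= \int[mu]_z (`|w ((z : E) + x)%R - w x| * rho z)%:E)%E.
Proof.
rewrite -{1}(average_cst rhoP (w x)) -(averageB rhoP);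
  [|exact: bounded_measurable_translate|exact: bounded_measurable_cst].
apply: (average_norm_le rhoP); apply: bounded_measurableB.
  exact: bounded_measurable_translate.
exact: bounded_measurable_cst.
Qed.

Let mrho := measurable_mollifier rhoP.

Let mwr x : measurable_fun setT (fun t => w t * rho (t - x)).
Proof.
apply: measurable_funM => //.
exact: (measurableT_comp mrho (measurable_translate (- x))).
Qed.

Let integrable_wr x : mu.-integrable setT (fun t => (w t * rho ((t : E) - x))%:E).
Proof.
have := integrable_translate (- x) _
  (integrable_average rhoP (bounded_measurable_translate x)).
set f := (X in mu.-integrable _ X).
have -> : f = (fun t => (w t * rho (t - x))%:E).
  by apply/funext => t; rewrite /f/= subrK.
apply; apply/measurable_EFinP/measurable_funM => //.
exact: (measurableT_comp mw (measurable_translate x)).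
Qed.

(** Puts the dependence on [x] on the mollifier. *)
Lemma mollifyE x : (mollify x)%:E = (\int[mu]_t (w t * rho ((t : E) - x))%:E)%E.
Proof.
rewrite (averageE rhoP (bounded_measurable_translate x)).
rewrite -[RHS](integral_translate x) //.
by apply: eq_integral => z _; rewrite addrK.
Qed.

(** Written with the variable on the mollifier ([mollifyE]), the difference of two
    values inherits the Lipschitz constant of the mollifier. *)
Lemma mollify_lipschitz B : 0 < B -> (forall x, w x != 0 -> `|x| < B) ->
  exists2 L, 0 <= L & forall x y, `|mollify x - mollify y| <= L * `|x - y|.
Proof.
move=> B0 wB; have [L L0 rL] := mollifier_lip rhoP.
exists (M * L * (2 * B) ^+ n.+1).
  by rewrite !mulr_ge0// exprn_ge0// mulr_ge0// ltW.
move=> x y; rewrite -lee_fin.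
rewrite -abse_EFin EFinB !mollifyE -integralB_EFin//;
  [|exact: integrable_wr..].
have mB := @measurable_norm_ball R n 0 B.
have mD : measurable_fun setT (fun t => w t * rho (t - x) - w t * rho (t - y)).
  by apply: measurable_funB; exact: mwr.
apply: le_trans (le_abse_integral _ _ _) _ => //.
  exact/measurable_EFinP.
apply: (@le_trans _ _ (\int[mu]_t ((M * L * `|x - y|)%:E * (\1_[set t : E | (`|0 - t| < B)%R] t)%:E))%E).
  apply: ge0_le_integral => //.
  - by apply/measurable_EFinP; exact: measurableT_comp.
  - by apply/measurable_EFinP/measurable_funM => //.
  move=> t _ /=; rewrite lee_fin indicE.
  have [->|wt] := eqVneq (w t) 0.
    by rewrite !mul0r subrr normr0 !mulr_ge0.
  rewrite mem_set/= ?sub0r ?normrN ?wB// mulr1 -mulrBr normrM -mulrA ler_pM//.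
  by rewrite (le_trans (rL _ _))// opprB addrC addrA subrK distrC.
rewrite ge0_integralZl//.
- rewrite integral_indic// ?setIT.
  rewrite (_ : _ [set _ | _] = ((2 * B) ^+ n.+1)%:E); last exact: leb_norm_ball.
  by rewrite -EFinM lee_fin mulrAC.
- by apply/measurable_EFinP; exact: measurable_indic.
- by rewrite lee_fin !mulr_ge0.
Qed.

Variable s : R.
Local Notation K := (@frac_kernel R n s).
Local Notation energy := (@energy R n s).

(** A mollified function is an average of translates, all of the same energy, and
    the energy is convex. *)
Lemma energy_mollify : measurable_fun setT mollify ->
  (energy mollify <= energy w)%E.
Proof.
move=> mm.
pose H x y t : R := `|w (t + x) - w (t + y)| * rho t * K (x - y).
have H0 x y t : 0 <= H x y t.
  by rewrite !mulr_ge0 ?kernel_ge0// (mollifier_ge0 rhoP).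
have mH d (T : measurableType d) (f g h : T -> E) : measurable_fun setT f ->
    measurable_fun setT g -> measurable_fun setT h ->
    measurable_fun setT (fun p => (H (f p) (g p) (h p))%:E).
  move=> mf mg mh; apply/measurable_EFinP/measurable_funM; last exact: measurable_kernel_rVB.
  apply: measurable_funM; last exact: (measurableT_comp mrho mh).
  apply: measurableT_comp => //; apply: measurable_funB;
    by apply: (measurableT_comp mw); exact: measurable_rVD.
pose J (p : E * E) := (\int[mu]_y (H p.1 y p.2)%:E)%E.
have mJ : measurable_fun setT J.
  apply: (measurable_fun_fubini_tonelli_F (fun q : (E * E) * E => (H q.1.1 q.2 q.1.2)%:E)).
    apply: mH; last exact: (measurableT_comp measurable_snd measurable_fst).
      exact: (measurableT_comp measurable_fst measurable_fst).
    exact: measurable_snd.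
  by move=> q; rewrite lee_fin.
have J0 p : (0 <= J p)%E by apply: integral_ge0 => y _; rewrite lee_fin.
rewrite (energyE s mm).
apply: (@le_trans _ _ (\int[mu]_x \int[mu]_t J (x, t))%E).
  apply: ge0_le_integral; first exact: measurableT.
  - by move=> x _; apply: integral_ge0 => y _; rewrite lee_fin energy_density_ge0.
  - apply: (measurable_fun_fubini_tonelli_F (fun z : E * E =>
      (`|mollify z.1 - mollify z.2| * K (z.1 - z.2))%:E)).
      exact: measurable_energy_density.
    by move=> z; rewrite lee_fin energy_density_ge0.
  - exact: (measurable_fun_fubini_tonelli_F J).
  move=> x _.
  rewrite -(fubini_tonelli (fun p : E * E => (H x p.1 p.2)%:E)).
  - apply: ge0_le_integral; first exact: measurableT.
    + by move=> y _; rewrite lee_fin energy_density_ge0.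
    + exact: measurable_energy_density_l.
    + apply: (measurable_fun_fubini_tonelli_F (fun p : E * E => (H x p.1 p.2)%:E)).
        by apply: mH.
      by move=> p; rewrite lee_fin.
    move=> y _; rewrite /H /=; under eq_integral do rewrite mulrC EFinM.
    rewrite ge0_integralZl//.
    * by rewrite mulrC EFinM lee_wpmul2l ?lee_fin ?kernel_ge0//; exact: mollify_dist.
    * apply/measurable_EFinP/measurable_funM => //.
      apply: measurableT_comp => //; apply: measurable_funB;
        exact: (measurableT_comp mw (measurable_translate _)).
    * by move=> t _; rewrite lee_fin mulr_ge0// (mollifier_ge0 rhoP).
    * by rewrite lee_fin kernel_ge0.
  - by apply: mH.
  - by move=> p; rewrite lee_fin.
rewrite (fubini_tonelli J)//.
rewrite -[leRHS]mule1 -(mollifier_int rhoP) -ge0_integralZl//.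
- rewrite le_eqVlt; apply/orP; left; apply/eqP; apply: eq_integral => t _.
  have mwt : measurable_fun setT (fun x : E => w (x + (t : E))).
    exact: (measurableT_comp mw (measurable_translate _)).
  pose f x y : \bar R := (`|w (x + (t : E)) - w (y + (t : E))| * K (x - y))%:E.
  have f0 x y : (0 <= f x y)%E by rewrite lee_fin mulr_ge0 ?kernel_ge0.
  have mf x : measurable_fun setT (f x) by exact: (measurable_energy_density_l s x mwt).
  have mF : measurable_fun setT (fun x => \int[mu]_y f x y)%E.
    apply: (measurable_fun_fubini_tonelli_F (fun z : E * E => f z.1 z.2)) => //.
    exact: (measurable_energy_density s mwt).
  have rt0 : (0 <= (rho t)%:E)%E by rewrite lee_fin (mollifier_ge0 rhoP).
  have -> : energy w = (\int[mu]_x \int[mu]_y f x y)%E.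
    by rewrite -(energy_translate s t mw) (energyE s mwt).
  have F0 x : setT x -> (0 <= \int[mu]_y f x y)%E by move=> _; exact: integral_ge0.
  rewrite muleC -(ge0_integralZl mu measurableT mF F0 rt0).
  apply: eq_integral => x _.
  rewrite -(ge0_integralZl mu measurableT (mf x) (fun y _ => f0 x y) rt0).
  by apply: eq_integral => y _; rewrite /H /f /= -EFinM mulrA (mulrC (rho t)) !(addrC t).
- by apply/measurable_EFinP; exact: mrho.
- by move=> t _; rewrite lee_fin (mollifier_ge0 rhoP).
- by apply: integral_ge0 => z _; rewrite lee_fin energy_density_ge0.
Qed.

(** Only differences at distance less than [eps] enter the error, and there the
    kernel is bounded below, so the error is controlled by the energy. *)
Lemma mollify_L1_error : 0 < eps -> 0 < s -> measurable_fun setT mollify ->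
  (\int[mu]_x `|mollify x - w x|%:E <=
    (2 / eps ^+ n.+1 * (n.+1%:R * eps) `^ (n.+1%:R + s))%:E * energy w)%E.
Proof.
move=> eps0 s0 mm; set C := (2 / _ * _).
have C0 : 0 <= C.
  by rewrite mulr_ge0 ?powR_ge0// divr_ge0// exprn_ge0// ltW.
rewrite energyE// -ge0_integralZl//; last 2 first.
- apply: (measurable_fun_fubini_tonelli_F (fun z : E * E => (`|w z.1 - w z.2| * K (z.1 - z.2))%:E)).
    exact: measurable_energy_density.
  by move=> z; rewrite lee_fin energy_density_ge0.
- by move=> x _; apply: integral_ge0 => y _; rewrite lee_fin energy_density_ge0.
apply: ge0_le_integral => //.
- by apply/measurable_EFinP; apply: measurableT_comp => //; exact: measurable_funB.
- apply: measurable_funeM.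
  apply: (measurable_fun_fubini_tonelli_F (fun z : E * E => (`|w z.1 - w z.2| * K (z.1 - z.2))%:E)).
    exact: measurable_energy_density.
  by move=> z; rewrite lee_fin energy_density_ge0.
move=> x _; apply: (le_trans (mollify_error x)).
pose F (y : E) := (`|w x - w y| * K (x - y))%:E.
have mF : measurable_fun setT F by exact: measurable_energy_density_l.
have F0 y : (0 <= F y)%E by rewrite lee_fin energy_density_ge0.
have mFx : measurable_fun setT (fun z : E => F (z + x)).
  exact: (measurableT_comp mF (measurable_translate x)).
rewrite -[X in (_ <= _ * X)%E](ge0_integral_translate x mF F0).
rewrite -ge0_integralZl//.
apply: ge0_le_integral => //.
- by move=> z _; rewrite lee_fin mulr_ge0// (mollifier_ge0 rhoP).
- apply/measurable_EFinP/measurable_funM => //.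
  apply: measurableT_comp => //; apply: measurable_funB => //.
  exact: (measurableT_comp mw (measurable_translate _)).
- exact: measurable_funeM.
move=> z _; rewrite /F -EFinM lee_fin mulrCA (distrC (w x)).
have [->|z0] := eqVneq (z : E) 0; first by rewrite add0r subrr normr0 !mul0r.
rewrite ler_wpM2l// opprD addrCA subrr addr0 kernelN.
have [->|/(mollifier_supp rhoP)/ltW zeps] := eqVneq (rho z) 0.
  by rewrite mulr_ge0// kernel_ge0.
apply: (le_trans (mollifier_le rhoP z)).
rewrite (_ : C * K z = 2 / eps ^+ n.+1 * ((n.+1%:R * eps) `^ (n.+1%:R + s) * K z));
  last by rewrite mulrA.
by rewrite ler_peMr ?divr_ge0 ?exprn_ge0 ?(ltW eps0)//; exact: kernel_ge.
Qed.

End convolution.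

(** * Extended real limits inferior and superior *)

Section extended_real_limits.
Context {R : realType}.
Implicit Types (u : (\bar R)^nat) (l : \bar R).
Local Open Scope ereal_scope.

Lemma limn_einf_ge u l :
  (forall a : R, a%:E < l -> \forall k \near \oo, a%:E <= u k) -> l <= limn_einf u.
Proof.
move=> ul.
have ge_a (a : R) : a%:E < l -> a%:E <= limn_einf u.
  move=> /ul[k _ ak]; rewrite limn_einf_lim.
  apply: lime_ge; first exact: is_cvg_einfs.
  exists k => // j /= kj; apply: le_ereal_inf_tmp => _ [i /= ji <-].
  by apply: ak => /=; exact: leq_trans ji.
move: (limn_einf u) ge_a => x ge_a {ul u}.
case: x l ge_a => [x||] [l||] ge_a; rewrite ?leey ?leNye//.
- by apply/lee_subgt0Pr => e e0; rewrite -EFinB; apply: ge_a; rewrite lte_fin gtrBl.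
- by have := ge_a (x + 1)%R (ltry _); rewrite lee_fin gerDl ler10.
- by have := ge_a (l - 1)%R; rewrite lte_fin gtrBl ltr01 => /(_ isT).
- by have := ge_a 0%R (ltry _).
Qed.

Lemma cvge0_lt u (e : R) : (0 < e)%R -> u @ \oo --> 0 ->
  \forall k \near \oo, u k < e%:E.
Proof.
move=> e0 cu.
have n0 : nbhs 0 [set y : \bar R | y < e%:E].
  by apply: open_nbhs_nbhs; split; [exact: open_ereal_lt_ereal|rewrite /= lte_fin].
exact: (cu _ n0).
Qed.

Lemma limn_esup_le u l :
  (forall a : R, l < a%:E -> \forall k \near \oo, u k <= a%:E) -> limn_esup u <= l.
Proof.
move=> ul; rewrite -leeN2 -limn_einfN; apply: limn_einf_ge => a al.
have : l < (- a)%:E by rewrite EFinN lteNr.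
by move=> /ul; apply: filterS => k /=; rewrite EFinN leeNr.
Qed.

Lemma cvg_einf_esup u l : l <= limn_einf u -> limn_esup u <= l ->
  u @ \oo --> l.
Proof.
move=> lu ul.
apply: (@squeeze_cvge _ _ _ _ (einfs u) _ (esups u)).
- by near=> k; apply/andP; split; [apply: ereal_inf_lbound|apply: ereal_sup_ubound];
    exists k => //=.
- have -> : l = limn (einfs u).
    by apply/eqP; rewrite eq_le -limn_einf_lim lu/= (le_trans _ ul)// limn_einf_sup.
  exact: is_cvg_einfs.
- have -> : l = limn (esups u).
    by apply/eqP; rewrite eq_le -limn_esup_lim ul andbT (le_trans lu)// limn_einf_sup.
  exact: is_cvg_esups.
Unshelve. all: by end_near. Qed.

End extended_real_limits.

(** * Lower semicontinuity along varying exponents *)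

Section gagliardo_theory.
Context {R : realType} {n : nat}.
Local Notation E := 'rV[R]_n.+1.
Local Notation mu := (leb n.+1).
Implicit Types (Omega : set E) (u v : E -> R) (s q p : R).

Definition density s q u (z : E * E) : R :=
  `|u z.1 - u z.2| `^ q / enorm (z.1 - z.2) `^ (n.+1%:R + s * q).

Lemma density_ge0 s q u z : 0 <= density s q u z.
Proof. by rewrite divr_ge0// powR_ge0. Qed.

Lemma density1 s u z : density s 1 u z = `|u z.1 - u z.2| * frac_kernel s (z.1 - z.2).
Proof. by rewrite /density powRr1// mulr1. Qed.

Lemma measurable_density s q u : measurable_fun setT u ->
  measurable_fun setT (density s q u).
Proof.
move=> mf; apply: measurable_funM; last first.
  exact: (measurable_kernel_rVB (s * q) measurable_fst measurable_snd).
apply: (measurableT_comp (measurable_powR q)).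
apply: measurableT_comp => //; apply: measurable_funB.
  exact: (measurableT_comp mf measurable_fst).
exact: (measurableT_comp mf measurable_snd).
Qed.

Lemma measurable_Qset Omega : open Omega -> measurable (Qset Omega).
Proof.
move=> oO; apply: measurableC; apply: measurableX; apply: measurableC;
  exact: open_measurable_rV.
Qed.

Lemma gagliardo_ge0 Omega s q u : (0 <= gagliardo Omega s q u)%E.
Proof. by apply: integral_ge0 => z _; rewrite lee_fin density_ge0. Qed.

(** Off [Xspace], a locally integrable function has infinite seminorm, so both
    branches of the definition are the same formula. *)
Lemma ext_energyE Omega s q u : 0 < q -> L1loc u ->
  ext_energy Omega s q u = ((2 * q)^-1%:E * gagliardo Omega s q u)%E.
Proof.
move=> q0 lu; rewrite /ext_energy; case: ifPn => // /negP nX.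
have -> : gagliardo Omega s q u = +oo%E.
  apply/eqP; rewrite -leye_eq leNgt; apply/negP => Goo; apply: nX.
  by rewrite inE; split.
by rewrite gt0_muley// lte_fin invr_gt0 mulr_gt0.
Qed.

(** Writing [t^p = t exp ((p - 1) ln t)], both exponentials involved lie above
    their tangents: [t^p >= t + (p - 1) t ln t] and [t ln t >= t - 1]; and [t >= 0]
    absorbs the rest. *)
Lemma le_powR_add (t p : R) : 1 <= p -> 0 <= t -> t <= t `^ p + (p - 1).
Proof.
move=> p1; rewrite le_eqVlt => /predU1P[<-|t0].
  by rewrite addr_ge0 ?powR_ge0// subr_ge0.
have -> : t `^ p = t * expR ((p - 1) * ln t).
  rewrite -{1}(subrK 1 p) addrC powRD ?(gt_eqF t0) ?implybT// powRr1 ?(ltW t0)//.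
  by rewrite /powR (gt_eqF t0).
have h1 := expR_ge1Dx ((p - 1) * ln t).
have h2 : 1 - ln t <= t^-1.
  by have := expR_ge1Dx (- ln t); rewrite expRN lnK ?posrE.
have h3 : t - t * ln t <= 1.
  have := ler_wpM2l (ltW t0) h2; rewrite mulrBr mulr1 divff// gt_eqF//.
have := ler_wpM2l (ltW t0) h1; nra.
Qed.

(** An exhaustion of [Qset Omega], up to the diagonal, by sets of finite measure
    on which the kernel is bounded. *)
Definition truncated_Qset Omega (m : nat) : set (E * E) :=
  Qset Omega `&` [set z | m.+1%:R^-1 <= `|z.1 - z.2| /\ `|z.1| <= m%:R /\ `|z.2| <= m%:R].

Lemma measurable_truncated_Qset Omega m : open Omega ->
  measurable (truncated_Qset Omega m).
Proof.
move=> oO; apply: measurableI; first exact: measurable_Qset.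
have mN (f : E * E -> E) : measurable_fun setT f -> measurable_fun setT (fun z => `|f z|).
  by move=> mf; exact: (measurableT_comp measurable_rV_norm mf).
rewrite (_ : [set z | _] = ((fun z => `|z.1 - z.2|) @^-1` `[m.+1%:R^-1, +oo[ `&`
    ((fun z => `|z.1|) @^-1` `]-oo, m%:R] `&` (fun z => `|z.2|) @^-1` `]-oo, m%:R]))).
  apply: measurableI.
    rewrite -[X in measurable X]setTI; apply: mN => //.
    exact: measurable_rVB measurable_fst measurable_snd.
  apply: measurableI; rewrite -[X in measurable X]setTI; apply: mN => //.
by apply/seteqP; split => z /=; rewrite !in_itv/= andbT => -[? [? ?]].
Qed.

Lemma compact_norm_le (r : R) : compact [set x : E | `|x| <= r].
Proof.
apply: bounded_closed_compact.
  by exists r; split; [exact: num_real|] => M mM x /= /le_trans; apply; exact: ltW.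
have -> : [set x : E | `|x| <= r] = (fun x : E => `|x|) @^-1` [set t | t <= r] by [].
apply: closed_comp; last exact: closed_le.
by move=> x _; exact: norm_continuous.
Qed.

Lemma measurable_norm_le (r : R) : measurable [set x : E | `|x| <= r].
Proof.
rewrite (_ : [set x | _] = (fun x : E => `|x|) @^-1` `]-oo, r]).
  by rewrite -[X in measurable X]setTI; exact: measurable_rV_norm.
by apply/seteqP; split => x /=; rewrite in_itv.
Qed.

Lemma nondecreasing_truncated_Qset Omega :
  {homo truncated_Qset Omega : i j / (i <= j)%N >-> (i <= j)%O}.
Proof.
move=> i j ij; apply/subsetPset => z [Qz [z1 [z2 z3]]]; split => //; split.
  by rewrite (le_trans _ z1)// lef_pV2 ?posrE// ler_nat.
by split; [apply: le_trans z2 _|apply: le_trans z3 _]; rewrite ler_nat.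
Qed.

Lemma bigcup_truncated_Qset Omega z : Qset Omega z -> z.1 != z.2 ->
  (\bigcup_m truncated_Qset Omega m) z.
Proof.
move=> Qz z12; have nz : 0 < `|z.1 - z.2| by rewrite normr_gt0 subr_eq0.
pose a := Num.truncn `|z.1 - z.2|^-1.
pose b := Num.truncn `|z.1|; pose c := Num.truncn `|z.2|.
have [la lb lc] : [/\ (a < (a + b + c).+2)%N, (b < (a + b + c).+1)%N &
    (c < (a + b + c).+1)%N] by clearbody a b c; split; lia.
exists (a + b + c).+1 => //; split => //; split.
  rewrite invf_ple ?posrE// ltW// (lt_le_trans (truncnS_gt _))// ler_nat.
  exact: la.
by split; rewrite ltW// (lt_le_trans (truncnS_gt _))// ler_nat; [exact: lb|exact: lc].
Qed.

(** Monotone convergence; the diagonal, which the exhaustion misses, carries no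
    density. *)
Lemma truncated_gagliardo_gt Omega s u (a : \bar R) :
  open Omega -> measurable_fun setT u -> (a < gagliardo Omega s 1 u)%E ->
  exists m, (a < \int[mu \x mu]_(z in truncated_Qset Omega m) (density s 1 u z)%:E)%E.
Proof.
move=> oO mu_ aG; apply: contrapT => /forallNP nm.
have md := measurable_density s 1 mu_.
have mA m := measurable_truncated_Qset m oO.
have cv : (\int[mu \x mu]_(z in truncated_Qset Omega m) (density s 1 u z)%:E @[m --> \oo] -->
    \int[mu \x mu]_(z in \bigcup_m truncated_Qset Omega m) (density s 1 u z)%:E)%E.
  apply: ge0_nondecreasing_set_cvg_integral => //.
  - exact: nondecreasing_truncated_Qset.
  - by move=> m; apply/measurable_EFinP; exact: measurable_funTS.
  - by move=> m z _; rewrite lee_fin density_ge0.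
have : (gagliardo Omega s 1 u <= a)%E; last by rewrite leNgt aG.
rewrite (_ : gagliardo Omega s 1 u =
    \int[mu \x mu]_(z in \bigcup_m truncated_Qset Omega m) (density s 1 u z)%:E)%E.
  rewrite -(cvg_lim _ cv)//; apply: lime_le; first by apply/cvg_ex; eexists; exact: cv.
  by apply: nearW => m; rewrite leNgt; apply/negP; exact: nm.
rewrite /gagliardo integral_mkcond [RHS]integral_mkcond; apply: eq_integral => z _.
rewrite /patch; case: ifPn => [|/negP].
  rewrite inE => Qz; case: ifPn => // /negP; rewrite inE => nA.
  have [z12|/eqP z12] := pselect (z.1 = z.2); last first.
    by exfalso; apply: nA; exact: bigcup_truncated_Qset.
  by rewrite z12 !subrr normr0 powR0 ?oner_eq0// mul0r.
rewrite inE => nQ; case: ifPn => //; rewrite inE => -[m _ [Qz _]].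
by exfalso; exact: nQ.
Qed.

(** The exponent [q] acts on the Hoelder quotient only; the remaining weight is
    the same for all [q]. *)
Lemma density_quotient s q u z : 0 < enorm (z.1 - z.2) ->
  density s q u z =
    (`|u z.1 - u z.2| / enorm (z.1 - z.2) `^ s) `^ q / enorm (z.1 - z.2) ^+ n.+1.
Proof.
move=> e0; rewrite /density powRM ?invr_ge0 ?powR_ge0//.
rewrite powRD ?(gt_eqF e0) ?implybT// powR_mulrn ?(ltW e0)//.
rewrite -(powR_inv1 (powR_ge0 _ _)) -!powRrM.
by rewrite mulN1r mulrN powRN invfM [X in _ * X = _]mulrC mulrA.
Qed.

Lemma truncated_Qset_sub Omega m : truncated_Qset Omega m `<=`
  [set x : E | `|0 - x| < m.+1%:R] `*` [set x : E | `|0 - x| < m.+1%:R].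
Proof.
move=> z [_ [_ [z1 z2]]]; split; rewrite /= sub0r normrN.
  by rewrite (le_lt_trans z1)// ltr_nat.
by rewrite (le_lt_trans z2)// ltr_nat.
Qed.

Lemma product_measure_truncated_Qset_le Omega m : open Omega ->
  ((mu \x mu) (truncated_Qset Omega m) <= (((2 * m.+1%:R) ^+ n.+1) ^+ 2)%:E)%E.
Proof.
move=> oO.
have mB := @measurable_norm_ball R n 0 m.+1%:R.
apply: (@le_trans _ _ ((mu \x mu)%E
  ([set x : E | `|0 - x| < m.+1%:R] `*` [set x : E | `|0 - x| < m.+1%:R]))).
  apply: le_measure; rewrite ?inE.
  - exact: measurable_truncated_Qset.
  - exact: measurableX.
  - exact: truncated_Qset_sub.
rewrite product_measure1E// expr2 EFinM.
rewrite le_eqVlt; apply/orP; left; apply/eqP; congr (_ * _)%E; exact: leb_norm_ball.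
Qed.

(** [le_powR_add] applied to the Hoelder quotient: its loss [p - 1] is integrable
    on the truncated set. *)
Lemma truncated_gagliardo_le Omega s p m v : open Omega -> 0 < s -> 1 <= p ->
  measurable_fun setT v ->
  (\int[mu \x mu]_(z in truncated_Qset Omega m) (density s 1 v z)%:E <=
   gagliardo Omega s p v +
   ((p - 1) * (m.+1%:R ^+ n.+1 * ((2 * m.+1%:R) ^+ n.+1) ^+ 2))%:E)%E.
Proof.
move=> oO s0 p1 mv; have mA := measurable_truncated_Qset m oO.
have md q := measurable_density s q mv.
have mdA q : measurable_fun (truncated_Qset Omega m) (fun z => (density s q v z)%:E).
  by apply/measurable_EFinP; exact: measurable_funTS.
pose c := (p - 1) * m.+1%:R ^+ n.+1.
have c0 : 0 <= c by rewrite mulr_ge0// subr_ge0.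
apply: (@le_trans _ _ (\int[mu \x mu]_(z in truncated_Qset Omega m)
    ((density s p v z)%:E + c%:E))%E).
  apply: ge0_le_integral.
  - exact: mA.
  - by move=> z _; rewrite lee_fin density_ge0.
  - exact: mdA.
  - apply: emeasurable_funD; [exact: mdA|exact: measurable_cst].
  move=> z [_ [z12 _]]; rewrite -EFinD lee_fin.
  have e1 : m.+1%:R^-1 <= enorm (z.1 - z.2) := le_trans z12 (norm_le_enorm _).
  have e0 : 0 < enorm (z.1 - z.2) by rewrite (lt_le_trans _ e1)// invr_gt0.
  rewrite !density_quotient// /c.
  set t := `|_ - _| / _; have t0 : 0 <= t by rewrite divr_ge0// powR_ge0.
  rewrite powRr1// (@le_trans _ _ ((t `^ p + (p - 1)) / enorm (z.1 - z.2) ^+ n.+1))//.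
    by rewrite ler_wpM2r ?le_powR_add// invr_ge0 exprn_ge0// ltW.
  rewrite mulrDl lerD2l ler_wpM2l ?subr_ge0// -exprVn.
  rewrite lerXn2r ?nnegrE ?invr_ge0 ?(ltW e0)//.
  by rewrite invf_ple ?posrE.
rewrite ge0_integralD//; last by move=> z _; rewrite lee_fin density_ge0.
apply: leeD.
  apply: ge0_subset_integral => //.
  - exact: measurable_Qset.
  - by apply/measurable_EFinP; exact: measurable_funTS.
  - by move=> z _; rewrite lee_fin density_ge0.
  - by move=> z [].
rewrite integral_cst// mulrA -/c [leRHS]EFinM.
apply: lee_wpmul2l; first by rewrite lee_fin.
exact: product_measure_truncated_Qset_le.
Qed.

Lemma integral_tensor (f g : E -> R) :
  measurable_fun setT f -> measurable_fun setT g ->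
  (forall x, 0 <= f x) -> (forall x, 0 <= g x) ->
  (\int[mu \x mu]_z (f z.1 * g z.2)%:E =
   (\int[mu]_x (f x)%:E) * (\int[mu]_x (g x)%:E))%E.
Proof.
move=> mf mg f0 g0.
have mfg : measurable_fun setT (fun z : E * E => (f z.1 * g z.2)%:E).
  apply/measurable_EFinP/measurable_funM.
    exact: (measurableT_comp mf measurable_fst).
  exact: (measurableT_comp mg measurable_snd).
rewrite (fubini_tonelli1 _ mfg); last by move=> z; rewrite lee_fin mulr_ge0.
rewrite /fubini_F -ge0_integralZr//.
- apply: eq_integral => x _; rewrite -ge0_integralZl//.
  + by apply/measurable_EFinP.
  + by move=> y _; rewrite lee_fin.
  + by rewrite lee_fin.
- by apply/measurable_EFinP.
- by move=> y _; rewrite lee_fin.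
- by apply: integral_ge0 => x _; rewrite lee_fin.
Qed.

(** Where the kernel is bounded, the seminorm is continuous in L1. *)
Lemma truncated_gagliardo_dist Omega s m : open Omega -> 0 < s ->
  exists2 C, 0 <= C & forall u v, measurable_fun setT u -> measurable_fun setT v ->
  (\int[mu \x mu]_(z in truncated_Qset Omega m) (density s 1 u z)%:E <=
   \int[mu \x mu]_(z in truncated_Qset Omega m) (density s 1 v z)%:E +
   C%:E * \int[mu]_(x in [set x : E | (`|x| <= m%:R)%R]) `|v x - u x|%:E)%E.
Proof.
move=> oO s0; have mA := measurable_truncated_Qset m oO.
pose kappa : R := m.+1%:R^-1 `^ (- s) / m.+1%:R^-1 ^+ n.+1.
have kappa0 : 0 <= kappa by rewrite divr_ge0 ?powR_ge0// exprn_ge0.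
pose L : R := (2 * m.+1%:R) ^+ n.+1.
have L0 : 0 <= L by rewrite exprn_ge0// mulr_ge0.
exists (kappa * (2 * L)); first by rewrite !mulr_ge0.
move=> u v mu_ mv.
pose B : set E := [set x | `|x| <= m%:R].
have mB : measurable B := measurable_norm_le m%:R.
pose g : E -> R := \1_B.
pose h x := `|v x - u x| * g x.
have g0 x : 0 <= g x by rewrite /g indicE.
have h0 x : 0 <= h x by rewrite mulr_ge0.
have mg : measurable_fun setT g by exact: measurable_indic.
have mh : measurable_fun setT h.
  by apply: measurable_funM => //; apply: measurableT_comp => //; exact: measurable_funB.
have mdA w : measurable_fun setT w ->
    measurable_fun (truncated_Qset Omega m) (fun z => (density s 1 w z)%:E).
  by move=> mw; apply/measurable_EFinP; apply: measurable_funTS; exact: measurable_density.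
have mhg : measurable_fun setT (fun z : E * E => (h z.1 * g z.2)%:E).
  apply/measurable_EFinP/measurable_funM.
    exact: (measurableT_comp mh measurable_fst).
  exact: (measurableT_comp mg measurable_snd).
have mgh : measurable_fun setT (fun z : E * E => (g z.1 * h z.2)%:E).
  apply/measurable_EFinP/measurable_funM.
    exact: (measurableT_comp mg measurable_fst).
  exact: (measurableT_comp mh measurable_snd).
pose f z : \bar R := ((h z.1 * g z.2)%:E + (g z.1 * h z.2)%:E)%E.
have mf : measurable_fun setT f by exact: emeasurable_funD.
have f0 z : (0 <= f z)%E by rewrite adde_ge0// lee_fin mulr_ge0.
have kf0 z : (0 <= kappa%:E * f z)%E by rewrite mule_ge0// lee_fin.
have mkf : measurable_fun setT (fun z => kappa%:E * f z)%E by exact: measurable_funeM.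
apply: (@le_trans _ _ (\int[mu \x mu]_(z in truncated_Qset Omega m)
    ((density s 1 v z)%:E + kappa%:E * f z))%E).
  apply: ge0_le_integral.
  - exact: mA.
  - by move=> z _; rewrite lee_fin density_ge0.
  - exact: mdA.
  - by apply: emeasurable_funD; [exact: mdA|exact: measurable_funTS].
  move=> z [_ [z12 [z1 z2]]]; have -> : (kappa%:E * f z)%E = (kappa * (h z.1 * g z.2 + g z.1 * h z.2))%:E by [].
  rewrite -EFinD lee_fin !density1.
  rewrite /h /g !indicE !mem_set//= !mulr1 mul1r.
  have Kk : frac_kernel s (z.1 - z.2) <= kappa by apply: kernel_le => //; rewrite invr_gt0.
  have K0 := kernel_ge0 s (z.1 - z.2).
  have d : `|u z.1 - u z.2| <= `|v z.1 - v z.2| + (`|v z.1 - u z.1| + `|v z.2 - u z.2|).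
    have -> : u z.1 - u z.2 = (v z.1 - v z.2) - ((v z.1 - u z.1) - (v z.2 - u z.2)) by ring.
    by rewrite (le_trans (ler_normB _ _))// lerD2l ler_normB.
  rewrite (le_trans (ler_wpM2r K0 d))// mulrDl lerD2l mulrC.
  by rewrite ler_wpM2r// addr_ge0.
rewrite ge0_integralD//; last 3 first.
- by move=> z _; rewrite lee_fin density_ge0.
- exact: mdA.
- exact: measurable_funTS.
apply: leeD2l.
apply: (@le_trans _ _ (\int[mu \x mu]_z (kappa%:E * f z))%E).
  by apply: ge0_subset_integral.
rewrite ge0_integralZl//.
rewrite [X in (_ <= X * _)%E]EFinM -muleA; apply: lee_wpmul2l; first by rewrite lee_fin.
rewrite ge0_integralD//; last 2 first.
- by move=> z _; rewrite lee_fin mulr_ge0.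
- by move=> z _; rewrite lee_fin mulr_ge0.
rewrite !integral_tensor//.
have Ig : (\int[mu]_x (g x)%:E <= L%:E)%E.
  rewrite integral_indic// setIT.
  have -> : L%:E = leb n.+1 [set x : E | `|0 - x| < m.+1%:R] by rewrite leb_norm_ball.
  apply: le_measure; rewrite ?inE//; first exact: measurable_norm_ball.
  by move=> x /=; rewrite sub0r normrN => /le_lt_trans; apply; rewrite ltr_nat.
have Ih : (\int[mu]_x (h x)%:E = \int[mu]_(x in B) `|v x - u x|%:E)%E.
  rewrite [RHS]integral_mkcond; apply: eq_integral => x _.
  rewrite /h /g /patch indicE; case: (x \in B); first by rewrite mulr1.
  by rewrite mulr0.
have Ih0 : (0 <= \int[mu]_x (h x)%:E)%E by apply: integral_ge0 => x _; rewrite lee_fin.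
have Ig0 : (0 <= \int[mu]_x (g x)%:E)%E by apply: integral_ge0 => x _; rewrite lee_fin.
rewrite -/B -Ih [X in (X + _)%E]muleC -ge0_muleDl//.
apply: lee_wpmul2r => //; by rewrite mulr_natl mulr2n EFinD; apply: leeD.
Qed.

(** On a truncated set, the seminorm of [u_ k] with exponent 1 tends to that of
    [u], and exceeds the one with exponent [p_ k] by at most [O(p_ k - 1)]. *)
Lemma gagliardo_liminf Omega s u (u_ : nat -> E -> R) (p_ : R^nat) (a : R) :
  open Omega -> 0 < s -> L1loc u -> (forall k, L1loc (u_ k)) -> L1loc_cvg u_ u ->
  (forall k, 1 < p_ k) -> p_ @ \oo --> (1 : R) ->
  (a%:E < gagliardo Omega s 1 u)%E ->
  \forall k \near \oo, (a%:E < gagliardo Omega s (p_ k) (u_ k))%E.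
Proof.
move=> oO s0 lu lu_ cu p1 cp aG.
have [m am] := truncated_gagliardo_gt oO lu.1 aG.
have [C C0 CP] := truncated_gagliardo_dist m oO s0.
pose D : R := m.+1%:R ^+ n.+1 * ((2 * m.+1%:R) ^+ n.+1) ^+ 2.
have D0 : 0 <= D by rewrite mulr_ge0// ?exprn_ge0// mulr_ge0.
have [e e0 ae] : exists2 e : R, 0 < e & ((a + e)%:E <
    \int[mu \x mu]_(z in truncated_Qset Omega m) (density s 1 u z)%:E)%E.
  move: am; move: (integral _ _ _) => [r||]// => [ar|_]; last by exists 1; rewrite ?ltry.
  exists ((r - a) / 2); first by rewrite divr_gt0// subr_gt0.
  by move: ar; rewrite !lte_fin; lra.
have cI := cu _ (compact_norm_le (r := m%:R)).
have nI : \forall k \near \oo, (C%:E *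
    \int[mu]_(x in [set x : E | (`|x| <= m%:R)%R]) `|u_ k x - u x|%:E <= (e / 2)%:E)%E.
  have C1 : 0 < C + 1 by rewrite ltr_wpDl.
  have : \forall k \near \oo,
      (\int[mu]_(x in [set x : E | (`|x| <= m%:R)%R]) `|u_ k x - u x|%:E < (e / 2 / (C + 1))%:E)%E.
    by apply: cvge0_lt cI; rewrite !divr_gt0.
  apply: filterS => k /ltW Ik.
  have C0' : (0 <= C%:E)%E by rewrite lee_fin.
  apply: (le_trans (lee_wpmul2l C0' Ik)); rewrite -EFinM lee_fin mulrCA ler_piMr//.
    by rewrite divr_ge0// ltW.
  by rewrite ler_pdivrMr// mul1r lerDl.
have nD : \forall k \near \oo, (p_ k - 1) * D < e / 2.
  have D1 : 0 < D + 1 by rewrite ltr_wpDl.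
  have e2 : 0 < e / 2 / (D + 1) by rewrite !divr_gt0.
  have /cvgrPdist_lt/(_ _ e2) := cp; apply: filterS => k.
  rewrite distrC gtr0_norm ?subr_gt0// ltr_pdivlMr// => /(le_lt_trans _); apply.
  by rewrite ler_wpM2l ?lerDl// subr_ge0 ltW.
near=> k.
have h1 := truncated_gagliardo_le m oO s0 (ltW (p1 k)) (lu_ k).1.
have h2 := CP _ _ lu.1 (lu_ k).1.
have : (a%:E + e%:E < gagliardo Omega s (p_ k) (u_ k) + e%:E)%E.
  rewrite -EFinD (lt_le_trans ae)// (le_trans h2)//.
  apply: (le_trans (leeD h1 (_ : _ <= (e / 2)%:E)%E)); first by near: k.
  rewrite -addeA leeD2l// -EFinD lee_fin.
  have : (p_ k - 1) * D < e / 2 by near: k.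
  by rewrite -/D; lra.
by rewrite lteD2rE.
Unshelve. all: by end_near. Qed.

End gagliardo_theory.

(** * Truncation and cutoff near the boundary *)

Section even_kernels.
Context {R : realType} {n : nat}.
Local Notation E := 'rV[R]_n.+1.
Local Notation mu := (leb n.+1).

(** Tonelli, in either order according to the variable that [f] depends on. *)
Lemma even_kernel_integral_le (k f : E -> R) (A : R) :
  measurable_fun setT k -> (forall v, 0 <= k v) -> (forall v, k (- v) = k v) ->
  (forall x, \int[mu]_y (k (x - y))%:E <= A%:E)%E -> 0 <= A ->
  measurable_fun setT f -> (forall x, 0 <= f x) ->
  (\int[mu \x mu]_z ((f z.1 + f z.2) * k (z.1 - z.2))%:E <=
    (2 * A)%:E * \int[mu]_x (f x)%:E)%E.
Proof.
move=> mk k0 kN kA A0 mf f0.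
have mk12 : measurable_fun setT (fun z : E * E => k (z.1 - z.2)).
  by apply: (measurableT_comp mk); exact: measurable_rVB measurable_fst measurable_snd.
have mf1 : measurable_fun setT (fun z : E * E => (f z.1 * k (z.1 - z.2))%:E).
  by apply/measurable_EFinP/measurable_funM => //; exact: (measurableT_comp mf measurable_fst).
have mf2 : measurable_fun setT (fun z : E * E => (f z.2 * k (z.1 - z.2))%:E).
  by apply/measurable_EFinP/measurable_funM => //; exact: (measurableT_comp mf measurable_snd).
have fk1 z : (0 <= (f z.1 * k (z.1 - z.2))%:E)%E by rewrite lee_fin mulr_ge0.
have fk2 z : (0 <= (f z.2 * k (z.1 - z.2))%:E)%E by rewrite lee_fin mulr_ge0.
have mkx x : measurable_fun setT (fun y : E => (k (x - y))%:E).
  by apply/measurable_EFinP; apply: (measurableT_comp mk); exact: measurable_rVB.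
have inner x : (\int[mu]_y (f x * k (x - y))%:E <= A%:E * (f x)%:E)%E.
  under eq_integral do rewrite EFinM.
  rewrite ge0_integralZl//.
  - by rewrite muleC; apply: lee_wpmul2r; rewrite ?lee_fin.
  - by move=> y _; rewrite lee_fin.
  - by rewrite lee_fin.
have outer : (\int[mu]_x (A%:E * (f x)%:E) = A%:E * \int[mu]_x (f x)%:E)%E.
  rewrite ge0_integralZl//.
  - exact/measurable_EFinP.
  - by move=> y _; rewrite lee_fin.
have mAf : measurable_fun setT (fun x => (A%:E * (f x)%:E)%E).
  by apply: measurable_funeM; exact/measurable_EFinP.
have -> : (\int[mu \x mu]_z ((f z.1 + f z.2) * k (z.1 - z.2))%:E =
    \int[mu \x mu]_z (f z.1 * k (z.1 - z.2))%:E +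
    \int[mu \x mu]_z (f z.2 * k (z.1 - z.2))%:E)%E.
  rewrite -ge0_integralD//.
  by apply: eq_integral => z _; rewrite mulrDl EFinD.
rewrite mulr_natl mulr2n EFinD ge0_muleDl ?lee_fin//; apply: leeD.
  rewrite (fubini_tonelli1 _ mf1 fk1) -outer; apply: ge0_le_integral => //.
  - by move=> x _; apply: integral_ge0 => y _; rewrite lee_fin mulr_ge0.
  - exact: measurable_fun_fubini_tonelli_F mf1 fk1.
  - by move=> x _; exact: inner.
rewrite (fubini_tonelli2 _ mf2 fk2) -outer; apply: ge0_le_integral => //.
- by move=> x _; apply: integral_ge0 => y _; rewrite lee_fin mulr_ge0.
- exact: measurable_fun_fubini_tonelli_G mf2 fk2.
move=> y _; apply: le_trans (inner y); rewrite /fubini_G /=.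
rewrite le_eqVlt; apply/orP; left; apply/eqP; apply: eq_integral => x _.
by rewrite -kN opprB.
Qed.

End even_kernels.

Section clamp.
Context {R : realType}.
Implicit Types (M a b : R).

Definition clamp M a : R := Num.max (- M) (Num.min a M).

Lemma clamp_bound M a : 0 <= M -> `|clamp M a| <= M.
Proof.
move=> M0; rewrite /clamp ler_norml.
by case: (leP a M) => h1; [case: (leP (- M) a)|case: (leP (- M) M)] => h2;
  apply/andP; split; lra.
Qed.

Lemma clamp_dist M a b : `|clamp M a - clamp M b| <= `|a - b|.
Proof.
have min_dist_l c : `|Num.min a c - Num.min b c| <= `|a - b|.
  by apply: min_dist => //; rewrite subrr normr0.
have -> : clamp M a - clamp M b =
    Num.max 0 (Num.min a M + M) - Num.max 0 (Num.min b M + M).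
  rewrite /clamp; case: (leP (- M) (Num.min a M)) => h1;
    case: (leP (- M) (Num.min b M)) => h2;
    case: (leP 0 (Num.min a M + M)) => h3; case: (leP 0 (Num.min b M + M)) => h4; lra.
by apply: max0_dist; rewrite opprD addrACA subrr addr0.
Qed.

Lemma clamp_error M a : 0 <= M -> `|clamp M a - a| <= `|a|.
Proof.
move=> M0; rewrite /clamp ler_norml.
by case: (leP a M) => h1; [case: (leP (- M) a)|case: (leP (- M) M)] => h2;
  case: (ger0P a) => h3; apply/andP; split; lra.
Qed.

Lemma clamp_id M a : `|a| <= M -> clamp M a = a.
Proof.
by rewrite ler_norml /clamp => /andP[h1 h2]; rewrite (min_l h2) (max_r h1).
Qed.

Lemma measurable_clamp d (T : measurableType d) M (f : T -> R) :
  measurable_fun setT f -> measurable_fun setT (fun x => clamp M (f x)).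
Proof. by move=> mf; apply: measurable_maxr => //; apply: measurable_minr. Qed.

End clamp.

Section cutoff_approximation.
Context {R : realType} {n : nat}.
Local Notation E := 'rV[R]_n.+1.
Local Notation mu := (leb n.+1).
Variables (Omega : set E) (s : R).
Hypotheses (oO : open Omega) (s01 : 0 < s < 1).
Local Notation K := (@frac_kernel R n s).
Local Notation G := (gagliardo Omega s 1).

Let s0 : 0 < s. Proof. by case/andP: s01. Qed.

(** A pair contributes only if one of its points is in [S]; then the difference of
    [psi] is at most 1, used at distance at least [r] ([kernel_far]), and at most
    [|x - y| / r], used below ([kernel_near]). *)
Lemma cutoff_energy_le : exists2 C, 0 <= C &
  forall r (psi : E -> R) (S : set E), 0 < r -> measurable S ->
  (forall x, 0 <= psi x <= 1) -> (forall x y, `|psi x - psi y| <= `|x - y| / r) ->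
  (forall x, ~ S x -> psi x = 1) ->
  (energy s psi <= C%:E * (mu S * (r `^ (- s))%:E))%E.
Proof.
have [C1 C10 far] := @kernel_far R n s s0.
have [C2 C20 near] := @kernel_near R n s s01.
exists (2 * (C1 + C2)); first by rewrite mulr_ge0// addr_ge0.
move=> r psi S r0 mS psi01 psiL psi1.
have mpsi : measurable_fun setT psi.
  apply: (@lipschitz_measurable _ _ _ r^-1) => x y; by rewrite mulrC.
pose k (v : E) := (r <= `|v|)%R%:R * K v + (`|v| < r)%R%:R * (`|v| / r) * K v.
pose f : E -> R := \1_S.
have mnear : measurable_fun setT (fun v : E => (`|v| < r)%R%:R * (`|v| / r) * K v).
  apply: measurable_funM; last exact: measurable_frac_kernel.
  apply: measurable_funM; last by apply: measurable_funM => //; exact: measurable_rV_norm.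
  by apply/measurable_natr/measurable_fun_ltr => //; exact: measurable_rV_norm.
have near0 (v : E) : 0 <= (`|v| < r)%R%:R * (`|v| / r) * K v.
  by rewrite !mulr_ge0 ?kernel_ge0// invr_ge0 ltW.
have far0 (v : E) : 0 <= (r <= `|v|)%R%:R * K v by rewrite mulr_ge0// kernel_ge0.
have mk : measurable_fun setT k by exact: measurable_funD (measurable_far_kernel s r) mnear.
have k0 v : 0 <= k v by rewrite addr_ge0.
have kN v : k (- v) = k v by rewrite /k normrN kernelN.
have msub (h : E -> R) x : measurable_fun setT h ->
    measurable_fun setT (fun y : E => (h (x - y))%:E).
  by move=> mh; apply/measurable_EFinP; apply: (measurableT_comp mh); exact: measurable_rVB.
have kA x : (\int[mu]_y (k (x - y))%:E <= ((C1 + C2) * r `^ (- s))%:E)%E.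
  rewrite /k; under eq_integral do rewrite EFinD.
  rewrite ge0_integralD//.
  - by rewrite mulrDl EFinD; apply: leeD; [exact: far|exact: near].
  - by move=> y _; rewrite lee_fin.
  - exact: (msub _ _ (measurable_far_kernel s r)).
  - by move=> y _; rewrite lee_fin.
  - exact: (msub _ _ mnear).
have f0 x : 0 <= f x by rewrite /f indicE.
have mf : measurable_fun setT f by exact: measurable_indic.
have A0 : 0 <= (C1 + C2) * r `^ (- s) by rewrite mulr_ge0 ?powR_ge0// addr_ge0.
have := even_kernel_integral_le mk k0 kN kA A0 mf f0.
rewrite integral_indic// setIT.
rewrite [X in (_ <= X)%E -> _](_ : _ = (2 * (C1 + C2))%:E * (mu S * (r `^ (- s))%:E))%E;
  last by rewrite mulrA EFinM -muleA [X in (_ * X)%E]muleC.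
apply: le_trans; rewrite /energy; apply: ge0_le_integral.
- exact: measurableT.
- by move=> z _; rewrite lee_fin energy_density_ge0.
- exact: measurable_energy_density.
- apply/measurable_EFinP/measurable_funM.
    apply: measurable_funD.
      exact: (measurableT_comp mf measurable_fst).
    exact: (measurableT_comp mf measurable_snd).
  by apply: (measurableT_comp mk); exact: measurable_rVB measurable_fst measurable_snd.
move=> [x y] _ /=; rewrite lee_fin.
have [Sxy|] := pselect (S x \/ S y); last first.
  move=> /not_orP[nSx nSy]; rewrite !psi1// subrr normr0 mul0r.
  by rewrite mulr_ge0// addr_ge0.
apply: (@le_trans _ _ (k (x - y))); last first.
  rewrite ler_peMl// /f !indicE; case: Sxy => Sz; rewrite (mem_set Sz)/=.
    by rewrite lerDl.
  by rewrite lerDr.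
rewrite /k -mulrDl ler_wpM2r ?kernel_ge0//.
case: (leP r `|x - y|) => rxy; rewrite ?mul0r ?addr0 ?mul1r ?add0r//.
have /andP[a0 a1] := psi01 x; have /andP[b0 b1] := psi01 y.
rewrite -[leRHS]/(1 : R); by rewrite ler_norml; apply/andP; split; lra.
Qed.

Let mQ := measurable_Qset oO.

Lemma gagliardo_le_add u v c (g : E * E -> R) : measurable_fun setT u ->
  measurable_fun setT v -> 0 <= c -> measurable_fun setT g -> (forall z, 0 <= g z) ->
  (forall z, Qset Omega z -> density s 1 v z <= density s 1 u z + c * g z) ->
  (G v <= G u + c%:E * \int[mu \x mu]_z (g z)%:E)%E.
Proof.
move=> mu_ mv c0 mg g0 vug.
have mdQ w : measurable_fun setT w ->
    measurable_fun (Qset Omega) (fun z => (density s 1 w z)%:E).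
  by move=> mw; apply/measurable_EFinP; apply: measurable_funTS; exact: measurable_density.
have mgE : measurable_fun setT (fun z => (g z)%:E) by exact/measurable_EFinP.
have mcg : measurable_fun setT (fun z => (c%:E * (g z)%:E)%E) by exact: measurable_funeM.
have cg0 z : (0 <= c%:E * (g z)%:E)%E by rewrite mule_ge0 ?lee_fin.
apply: (@le_trans _ _ (\int[mu \x mu]_(z in Qset Omega)
    ((density s 1 u z)%:E + c%:E * (g z)%:E))%E).
  apply: ge0_le_integral.
  - exact: mQ.
  - by move=> z _; rewrite lee_fin density_ge0.
  - exact: mdQ.
  - by apply: emeasurable_funD; [exact: mdQ|exact: measurable_funTS].
  by move=> z Qz; rewrite -EFinM -EFinD lee_fin; exact: vug.
rewrite (ge0_integralD _ mQ); last 4 first.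
- by move=> z _; rewrite lee_fin density_ge0.
- exact: mdQ.
- by move=> z _.
- exact: measurable_funTS.
apply: leeD; first by rewrite le_eqVlt eqxx.
rewrite -ge0_integralZl//; last by move=> z _; rewrite lee_fin.
by apply: ge0_subset_integral.
Qed.

Lemma gagliardo_le (u v : E -> R) : measurable_fun setT u -> measurable_fun setT v ->
  (forall x y, `|v x - v y| <= `|u x - u y|) -> (G v <= G u)%E.
Proof.
move=> mu_ mv vu.
have := @gagliardo_le_add u v 0 (cst 0) mu_ mv.
rewrite mul0e adde0; apply => // z _.
by rewrite mul0r addr0 !density1 ler_wpM2r ?kernel_ge0.
Qed.

Lemma bounded_L1loc (v : E -> R) M :
  measurable_fun setT v -> (forall x, `|v x| <= M) -> L1loc v.
Proof.
move=> mv vM; split=> // A cA.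
have mA : measurable A.
  rewrite -[A]setCK; apply: measurableC; apply: open_measurable_rV.
  by apply: closed_openC; apply: compact_closed => //; exact: norm_hausdorff.
have [B B0 AB] := pinfty_ex_gt0 (compact_bounded cA).
have B1 : 0 < B + 1 by rewrite addr_gt0.
have mB := @measurable_norm_ball R n 0 (B + 1).
have AB' : A `<=` [set x : E | `|0 - x| < B + 1].
  by move=> x /AB /= xB; rewrite sub0r normrN (le_lt_trans xB)// ltrDl.
have mav : measurable_fun setT (fun x => `|v x|%:E).
  by apply/measurable_EFinP; exact: measurableT_comp.
apply: (@le_lt_trans _ _ (\int[mu]_(x in [set x : E | (`|0 - x| < B + 1)%R]) M%:E)%E).
  apply: (@le_trans _ _ (\int[mu]_(x in [set x : E | (`|0 - x| < B + 1)%R]) `|v x|%:E)%E).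
    by apply: ge0_subset_integral => //; exact: measurable_funTS.
  by apply: ge0_le_integral => //; [exact: measurable_funTS|move=> x _; rewrite lee_fin].
rewrite integral_cst//.
rewrite (_ : _ [set _ | _] = ((2 * (B + 1)) ^+ n.+1)%:E); last exact: leb_norm_ball.
by rewrite -EFinM ltry.
Qed.

(** Dominated convergence, as [|clamp M (u x) - u x| <= |u x|]. *)
Lemma truncate_approx u (r eta : R) : L1loc u -> 0 < eta ->
  exists2 M, 0 <= M & (\int[mu]_(x in [set x : E | (`|x| <= r)%R]) `|clamp M (u x) - u x|%:E <= eta%:E)%E.
Proof.
move=> lu eta0; have [mu_ iu] := lu.
pose D : set E := [set x | `|x| <= r].
have mD : measurable D := measurable_norm_le r.
have mf k : measurable_fun D (fun x => `|clamp k%:R (u x) - u x|%:E).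
  apply/measurable_EFinP; apply: measurable_funTS; apply: measurableT_comp => //.
  by apply: measurable_funB => //; exact: measurable_clamp.
have ig : mu.-integrable D (fun x => `|u x|%:E).
  apply/integrableP; split.
    by apply/measurable_EFinP; apply: measurable_funTS; exact: measurableT_comp.
  rewrite (eq_integral (fun x => `|u x|%:E)); last by move=> x _; rewrite /= normr_id.
  exact: iu (compact_norm_le (r := r)).
have cv : ((fun k => \int[mu]_(x in D) `|clamp k%:R (u x) - u x|%:E) @ \oo --> 0)%E.
  have [] := @dominated_convergence _ _ _ mu D mD
    (fun k x => `|clamp k%:R (u x) - u x|%:E) (cst 0%E) (fun x => `|u x|%:E) mf
    (measurable_cst _) _ ig _.
  - apply: aeW => x Dx; apply: cvg_near_cst; exists (Num.truncn `|u x|).+1 => // k /= uk.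
    rewrite clamp_id ?subrr ?normr0// ltW// (lt_le_trans (truncnS_gt _))//.
    by rewrite ler_nat.
  - by apply: aeW => x k Dx; rewrite /= normr_id lee_fin clamp_error.
  - by move=> _ _; rewrite integral0.
have [k _ kP] := cvge0_lt eta0 cv.
by exists k%:R => //; apply: ltW; apply: kP => /=.
Qed.

(** Truncation is 1-Lipschitz, so it does not increase the seminorm; multiplying
    a function bounded by [M] by the cutoff [psi] adds at most [M] times the energy
    of [psi]. *)
Lemma cutoff_approx u (r eta : R) : bounded_set Omega -> lipschitz_boundary Omega ->
  L1loc u -> 0 < eta -> exists (w : E -> R) M rho,
  [/\ measurable_fun setT w, forall x, `|w x| <= M, 0 < rho &
      forall x y, w x != 0 \/ w y != 0 -> Omega x -> ~ Omega y -> rho < `|x - y|] /\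
  ((G w <= G u + eta%:E)%E /\
   (\int[mu]_(x in [set x : E | (`|x| <= r)%R]) `|w x - u x|%:E <= eta%:E)%E).
Proof.
move=> bO lO lu eta0; have [mu_ _] := lu.
have eta2 : 0 < eta / 2 by rewrite divr_gt0.
have [M M0 uM] := truncate_approx r lu eta2.
have [C C0 CP] := cutoff_energy_le.
(* Makes both [M |S| <= eta / 2], for the L1 distance, and [M C |S| r^(-s) <= eta],
   for the energy. *)
pose eta' := Num.min (eta / 2 / (M + 1)) (eta / (M * C + 1)).
have eta'0 : 0 < eta'.
  by rewrite lt_min !divr_gt0// ltr_wpDl// mulr_ge0.
have [rho [psi [S [[rho0 psi01 psiL psiO] [mS psi1 S1 S2]]]]] :=
  boundary_cutoff bO oO lO s01 eta'0.
have mpsi : measurable_fun setT psi.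
  by apply: (@lipschitz_measurable _ _ _ rho^-1) => x y; rewrite mulrC.
pose v x := clamp M (u x).
have mv : measurable_fun setT v by exact: measurable_clamp.
have vM x : `|v x| <= M by exact: clamp_bound.
pose w x := psi x * v x.
have mw : measurable_fun setT w by exact: measurable_funM.
have psin x : `|psi x| <= 1.
  by have /andP[a b] := psi01 x; rewrite ger0_norm.
exists w, M, rho; split; split => //.
- by move=> x; rewrite normrM (le_trans _ (vM x))// ler_piMl.
- move=> x y wxy; apply: psiO; case: wxy => h; [left|right];
    by apply: contra_neq h => h; rewrite /w h mul0r.
- have := @gagliardo_le_add v w M (fun z => `|psi z.1 - psi z.2| * K (z.1 - z.2)) mv mw M0.
  have mg : measurable_fun setT (fun z : E * E => `|psi z.1 - psi z.2| * K (z.1 - z.2)).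
    by apply/measurable_EFinP; exact: measurable_energy_density.
  move=> /(_ mg); have g0 (z : E * E) : 0 <= `|psi z.1 - psi z.2| * K (z.1 - z.2).
    exact: energy_density_ge0.
  move=> /(_ g0); have dw z : Qset Omega z -> density s 1 w z <=
      density s 1 v z + M * (`|psi z.1 - psi z.2| * K (z.1 - z.2)).
    move=> _; rewrite !density1 mulrA -mulrDl ler_wpM2r ?kernel_ge0//.
    have -> : w z.1 - w z.2 = psi z.1 * (v z.1 - v z.2) + v z.2 * (psi z.1 - psi z.2).
      by rewrite /w; ring.
    rewrite (le_trans (ler_normD _ _))// !normrM lerD//.
      by rewrite ler_piMl.
    by rewrite ler_wpM2r.
  move=> /(_ dw) /le_trans; apply; apply: leeD.
    by apply: gagliardo_le => // x y; exact: clamp_dist.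
  have CE := CP rho psi S rho0 mS psi01 psiL psi1.
  apply: (@le_trans _ _ (M%:E * (C%:E * eta'%:E))%E).
    apply: lee_wpmul2l; first by rewrite lee_fin.
    apply: (le_trans CE); apply: lee_wpmul2l; first by rewrite lee_fin.
    exact: S2.
  rewrite -!EFinM lee_fin mulrA.
  have MC1 : 0 < M * C + 1 by rewrite ltr_wpDl// mulr_ge0.
  have : eta' <= eta / (M * C + 1) by rewrite ge_min lexx orbT.
  by rewrite ler_pdivlMr// mulrDr mulr1 mulrC; lra.
- pose D : set E := [set x | `|x| <= r].
  have mD : measurable D := measurable_norm_le r.
  have m1 : measurable_fun D (fun x => (M%:E * (\1_S x)%:E)%E).
    by apply: measurable_funeM; apply/measurable_EFinP; exact: measurable_indic.
  have m2 : measurable_fun D (fun x => `|v x - u x|%:E).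
    apply/measurable_EFinP; apply: measurable_funTS; apply: measurableT_comp => //.
    exact: measurable_funB.
  apply: (@le_trans _ _ (\int[mu]_(x in D) (M%:E * (\1_S x)%:E + `|v x - u x|%:E))%E).
    apply: ge0_le_integral => //.
    + apply/measurable_EFinP; apply: measurable_funTS; apply: measurableT_comp => //.
      exact: measurable_funB.
    + exact: emeasurable_funD.
    move=> x _; rewrite -EFinM -EFinD lee_fin.
    have -> : w x - u x = (w x - v x) + (v x - u x) by ring.
    rewrite (le_trans (ler_normD _ _))// lerD2r indicE.
    have [Sx|nSx] := pselect (S x); last first.
      by rewrite /w psi1// mul1r subrr normr0 mulr_ge0.
    rewrite mem_set// mulr1 /w -{2}(mul1r (v x)) -mulrBl normrM.
    rewrite -[leRHS]mul1r ler_pM//.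
    by have /andP[a b] := psi01 x; rewrite ler_norml; apply/andP; split; lra.
  rewrite ge0_integralD//; last by move=> x _; rewrite -EFinM lee_fin mulr_ge0.
  rewrite [eta](splitr) EFinD; apply: leeD => //.
  rewrite ge0_integralZl//; last by apply/measurable_EFinP; exact: measurable_indic.
  rewrite integral_indic//.
  apply: (@le_trans _ _ (M%:E * eta'%:E)%E).
    apply: lee_wpmul2l; first by rewrite lee_fin.
    apply: le_trans S1; apply: le_measure; rewrite ?inE//; exact: measurableI.
  rewrite -EFinM lee_fin.
  have M1 : 0 < M + 1 by rewrite ltr_wpDl.
  have : eta' <= eta / 2 / (M + 1) by rewrite ge_min lexx.
  by rewrite ler_pdivlMr// mulrDr mulr1 mulrC; lra.
Qed.

End cutoff_approximation.

(** * Regularisation inside the domain *)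

Section regularisation.
Context {R : realType} {n : nat}.
Local Notation E := 'rV[R]_n.+1.
Local Notation mu := (leb n.+1).
Variables (Omega : set E) (s : R).
Hypotheses (bO : bounded_set Omega) (oO : open Omega) (s01 : 0 < s < 1).
Local Notation K := (@frac_kernel R n s).
Local Notation G := (gagliardo Omega s 1).

Let s0 : 0 < s. Proof. by case/andP: s01. Qed.

Variables (w : E -> R) (M rho : R).
Hypotheses (mw : measurable_fun setT w) (wM : forall x, `|w x| <= M) (rho0 : 0 < rho).
Hypothesis wrho : forall x y, w x != 0 \/ w y != 0 -> Omega x -> ~ Omega y -> rho < `|x - y|.
Hypothesis Gw : (G w < +oo)%E.

Let M0 : 0 <= M. Proof. exact: le_trans (normr_ge0 _) (wM 0). Qed.

Let w0 (x : E) : R := \1_Omega x * w x.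

Let w0in x : Omega x -> w0 x = w x.
Proof. by move=> Ox; rewrite /w0 indicE mem_set// mul1r. Qed.

Let w0out x : ~ Omega x -> w0 x = 0.
Proof. by move=> Ox; rewrite /w0 indicE memNset// mul0r. Qed.

Let mO : measurable Omega. Proof. exact: open_measurable_rV. Qed.

Let mw0 : measurable_fun setT w0.
Proof. by apply: measurable_funM => //; exact: measurable_indic. Qed.

Let w0M x : `|w0 x| <= M.
Proof.
by have [Ox|nOx] := pselect (Omega x); [rewrite w0in|rewrite w0out// normr0].
Qed.

(** Interactions at distance at least [r] of a density [f] with the whole space;
    they bound every error term below. *)
Let far_ (r : R) (f : E -> R) (z : E * E) : R :=
  (f z.1 + f z.2) * ((r <= `|z.1 - z.2|)%R%:R * K (z.1 - z.2)).

Let far0 (r : R) v : 0 <= (r <= `|v|)%R%:R * K v.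
Proof. by rewrite mulr_ge0// kernel_ge0. Qed.

Let far_ge0 r f z : (forall x, 0 <= f x) -> 0 <= far_ r f z.
Proof. by move=> f0; rewrite mulr_ge0// addr_ge0. Qed.

Let measurable_far r (f : E -> R) : measurable_fun setT f -> measurable_fun setT (far_ r f).
Proof.
move=> mf; apply: measurable_funM.
  apply: measurable_funD.
    exact: (measurableT_comp mf measurable_fst).
  exact: (measurableT_comp mf measurable_snd).
by apply: (measurableT_comp (measurable_far_kernel s r)); exact: measurable_rVB measurable_fst measurable_snd.
Qed.

Let far_integral_le : exists2 C, 0 <= C & forall r (f : E -> R), 0 < r ->
  measurable_fun setT f -> (forall x, 0 <= f x) ->
  (\int[mu \x mu]_z (far_ r f z)%:E <= (C * r `^ (- s))%:E * \int[mu]_x (f x)%:E)%E.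
Proof.
have [C C0 CP] := @kernel_far R n s s0.
exists (2 * C); first by rewrite mulr_ge0.
move=> r f r0 mf f0; rewrite -mulrA.
apply: (even_kernel_integral_le (measurable_far_kernel s r) (far0 r)); last exact: f0; last exact: mf.
- by move=> v; rewrite normrN kernelN.
- by move=> x; exact: CP.
- by rewrite mulr_ge0// powR_ge0.
Qed.

Let indQ (f : E -> R) : (G f = \int[mu \x mu]_z (\1_(Qset Omega) z * (`|f z.1 - f z.2| * K (z.1 - z.2)))%:E)%E.
Proof.
rewrite /gagliardo integral_mkcond; apply: eq_integral => z _.
rewrite /patch indicE; case: (z \in _); last by rewrite mul0r.
by rewrite mul1r -density1.
Qed.

Let in_Q (x y : E) : Omega x \/ Omega y -> \1_(Qset Omega) (x, y) = 1 :> R.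
Proof. by move=> h; rewrite indicE mem_set// => -[nx ny]; case: h. Qed.

Let notin_Q (x y : E) : ~ Omega x -> ~ Omega y -> \1_(Qset Omega) (x, y) = 0 :> R.
Proof. by move=> nx ny; rewrite indicE memNset//; apply. Qed.

Let mQf (f : E -> R) : measurable_fun setT f -> measurable_fun setT
  (fun z : E * E => (\1_(Qset Omega) z * (`|f z.1 - f z.2| * K (z.1 - z.2)))%:E).
Proof.
move=> mf; apply/measurable_EFinP/measurable_funM.
  by apply: measurable_indic; exact: measurable_Qset.
by apply/measurable_EFinP; exact: measurable_energy_density.
Qed.

Let Qf0 (f : E -> R) z : 0 <= \1_(Qset Omega) z * (`|f z.1 - f z.2| * K (z.1 - z.2)).
Proof. by rewrite mulr_ge0// ?energy_density_ge0// indicE. Qed.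

Let cut_pointwise (x y : E) :
  `|w0 x - w0 y| * K (x - y) <=
  \1_(Qset Omega) (x, y) * (`|w x - w y| * K (x - y)) +
  far_ rho (fun x => M * \1_Omega x) (x, y).
Proof.
pose f x : R := M * \1_Omega x.
have f0 x' : 0 <= f x' by rewrite mulr_ge0// indicE.
have Q0 := Qf0 w (x, y); rewrite /= in Q0.
have F0 := far_ge0 rho (x, y) f0.
have Ksym : K (x - y) = K (y - x) by rewrite -kernelN opprB.
have cross x' y' : Omega x' -> ~ Omega y' ->
    `|w0 x' - w0 y'| * K (x' - y') <= f x' * ((rho <= `|x' - y'|)%R%:R * K (x' - y')).
  move=> Ox nOy; rewrite (w0in Ox) (w0out nOy) subr0.
  have [->|wx] := eqVneq (w x') 0.
    by rewrite normr0 mul0r; apply: mulr_ge0; [exact: f0|exact: far0].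
  rewrite (ltW (wrho (or_introl wx) Ox nOy)) mul1r.
  by apply: ler_wpM2r; [exact: kernel_ge0|rewrite /f indicE (mem_set Ox) mulr1].
have [Ox|nOx] := pselect (Omega x); have [Oy|nOy] := pselect (Omega y).
- rewrite (in_Q (or_introl Ox)) mul1r (w0in Ox) (w0in Oy) lerDl; exact: F0.
- apply: (@le_trans _ _ (far_ rho f (x, y))); last by rewrite lerDr.
  apply: (le_trans (cross _ _ Ox nOy)); rewrite /far_ /=.
  by apply: ler_wpM2r; [exact: far0|rewrite lerDl].
- apply: (@le_trans _ _ (far_ rho f (x, y))); last by rewrite lerDr.
  rewrite (distrC (w0 x)) Ksym; apply: (le_trans (cross _ _ Oy nOx)).
  rewrite /far_ /= (distrC x) Ksym.
  by apply: ler_wpM2r; [exact: far0|rewrite lerDr].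
- rewrite (w0out nOx) (w0out nOy) subrr normr0 mul0r; apply: addr_ge0; [exact: Q0|exact: F0].
Qed.

(** Cutting [w] to [Omega] keeps the energy finite because [w] vanishes near the
    boundary. *)
Let energy_w0 : (energy s w0 < +oo)%E.
Proof.
have [C C0 CP] := far_integral_le.
pose f : E -> R := fun x => M * \1_Omega x.
have f0 x : 0 <= f x by rewrite mulr_ge0// indicE.
have mf : measurable_fun setT f by apply: measurable_funM => //; exact: measurable_indic.
have ff := CP rho f rho0 mf f0.
have [B B0 OB] := pinfty_ex_gt0 bO.
have mB := @measurable_norm_ball R n 0 (B + 1).
have Of : (\int[mu]_x (f x)%:E <= (M * (2 * (B + 1)) ^+ n.+1)%:E)%E.
  rewrite /f; under eq_integral do rewrite EFinM.
  rewrite ge0_integralZl//; last by apply/measurable_EFinP; exact: measurable_indic.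
  rewrite integral_indic// setIT EFinM; apply: lee_wpmul2l; first by rewrite lee_fin.
  rewrite -(@leb_norm_ball R n 0) ?addr_gt0//.
  apply: le_measure; rewrite ?inE// => x /OB /= xB.
  by rewrite /= sub0r normrN (le_lt_trans xB)// ltrDl.
apply: (@le_lt_trans _ _ (G w + \int[mu \x mu]_z (far_ rho f z)%:E)%E).
  rewrite indQ -ge0_integralD//; last 4 first.
  - by move=> z _; rewrite lee_fin.
  - exact: mQf.
  - by move=> z _; rewrite lee_fin far_ge0.
  - by apply/measurable_EFinP; exact: measurable_far.
  rewrite /energy; apply: ge0_le_integral; first exact: measurableT.
  - by move=> z _; rewrite lee_fin energy_density_ge0.
  - exact: measurable_energy_density.
  - by apply: emeasurable_funD; [exact: mQf|apply/measurable_EFinP; exact: measurable_far].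
  by move=> [x y] _; rewrite -EFinD lee_fin; exact: cut_pointwise.
rewrite lte_add_pinfty// (le_lt_trans ff)//.
rewrite (@le_lt_trans _ _ ((C * rho `^ (- s))%:E * (M * (2 * (B + 1)) ^+ n.+1)%:E)%E)//.
  by apply: lee_wpmul2l => //; rewrite lee_fin mulr_ge0// powR_ge0.
by rewrite -EFinM ltry.
Qed.

Section mollified.
Variables (eps : R) (k : E -> R).
Hypotheses (eps0 : 0 < eps) (eps_rho : eps <= rho / 2) (kP : mollifier eps k).

Let vb := mollify k w0.

Let vb_supp x : vb x != 0 -> Omega x /\ forall y, ~ Omega y -> rho / 2 < `|x - y|.
Proof.
move=> /(mollify_neq0 kP)[y xy wy].
have Oy : Omega y by apply: contrapT => nOy; move/eqP: wy; apply; exact: w0out.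
have wy' : w y != 0 by rewrite -w0in.
have far_y y' : ~ Omega y' -> rho / 2 < `|x - y'|.
  move=> nOy'; rewrite ltNge; apply/negP => close.
  have h := ler_distD x y y'; rewrite (distrC y x) in h.
  have := le_trans h (lerD (ltW xy) close).
  move=> /(lt_le_trans (wrho (or_introl wy') Oy nOy')).
  by move: eps_rho; lra.
split => //; apply: contrapT => nOx.
by have := far_y _ nOx; rewrite subrr normr0; have := rho0; lra.
Qed.

(** Outside [Omega] the function is left alone: there it need not be smooth,
    because pairs of exterior points are not in [Qset Omega], and at
    distance less than [rho / 2] across the boundary [v] vanishes. *)
Let v x := if x \in Omega then vb x else w x.

Let vin x : Omega x -> v x = vb x.
Proof. by move=> Ox; rewrite /v mem_set. Qed.

Let vout x : ~ Omega x -> v x = w x.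
Proof. by move=> Ox; rewrite /v memNset. Qed.

Let vbout x : ~ Omega x -> vb x = 0.
Proof. by move=> nOx; apply/eqP; apply/negP => /negP /vb_supp[]. Qed.

Let e x := `|vb x - w0 x|.

Let vbM x : `|vb x| <= M. Proof. exact: (mollify_bound kP mw0 w0M). Qed.

Let vb_lip : exists2 L, 0 <= L & forall x y, `|vb x - vb y| <= L * `|x - y|.
Proof.
have [B B0 OB] := pinfty_ex_gt0 bO.
apply: (mollify_lipschitz kP mw0 w0M (B := B + 1)); first by rewrite addr_gt0.
move=> x wx; have Ox : Omega x.
  by apply: contrapT => nOx; move/eqP: wx; apply; exact: w0out.
by rewrite (le_lt_trans (OB _ Ox))// ltrDl.
Qed.

Let mvb : measurable_fun setT vb.
Proof. by have [L _ vL] := vb_lip; exact: lipschitz_measurable vL. Qed.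

Let mv : measurable_fun setT v.
Proof.
rewrite (_ : v = (fun x => \1_Omega x * vb x + (1 - \1_Omega x) * w x)).
  have mI : measurable_fun setT (\1_Omega : E -> R) by exact: measurable_indic.
  apply: measurable_funD; apply: measurable_funM => //; exact: measurable_funB.
apply/funext => x; rewrite /v indicE; case: (x \in Omega).
  by rewrite mul1r subrr mul0r addr0.
by rewrite mul0r add0r subr0 mul1r.
Qed.

Let me : measurable_fun setT e.
Proof. by apply: measurableT_comp => //; exact: measurable_funB. Qed.

Let e0 x : 0 <= e x. Proof. exact: normr_ge0. Qed.

(** On pairs in [Omega] the densities of [v] and [vb] agree, and so do those of [w]
    and [w0]. Adding the energy of [w0] to one side and that of [vb] to the other
    makes them cancel, and leaves the pairs across the boundary, where only
    distances at least [rho / 2] matter. *)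
Let pointwise x y :
  \1_(Qset Omega) (x, y) * `|v x - v y| + `|w0 x - w0 y| <=
  \1_(Qset Omega) (x, y) * `|w x - w y| + `|vb x - vb y| +
  2 * ((e x + e y) * (rho / 2 <= `|x - y|)%R%:R).
Proof.
have tail0 : 0 <= 2 * ((e x + e y) * (rho / 2 <= `|x - y|)%R%:R).
  by rewrite !mulr_ge0// addr_ge0.
have cross x' y' : Omega x' -> ~ Omega y' ->
    `|vb x' - w y'| + `|w0 x'| <= `|w x' - w y'| + `|vb x'| +
      2 * (e x' * (rho / 2 <= `|x' - y'|)%R%:R).
  move=> Ox nOy; have [ex|ex] := eqVneq (e x') 0.
    have -> : vb x' = w x'.
      by apply/eqP; rewrite -subr_eq0 -normr_eq0 -(w0in Ox) -/(e x') ex.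
    by rewrite w0in// ex mul0r mulr0 addr0.
  have -> : (rho / 2 <= `|x' - y'|) = true.
    have [vx|vx] := eqVneq (vb x') 0; last first.
      by have [_ h] := vb_supp vx; rewrite ltW// h.
    have wx : w x' != 0.
      by apply: contra_neq ex => wx; rewrite /e vx (w0in Ox) wx subrr normr0.
    by have := @wrho x' y' (or_introl wx) Ox nOy; have := rho0; lra.
  rewrite mulr1 /e w0in//.
  have h1 := ler_distD (w x') (vb x') (w y').
  have h2 := ler_distD (vb x') (w x') 0; rewrite !subr0 in h2.
  rewrite (distrC (w x')) in h2; lra.
have [Ox|nOx] := pselect (Omega x); have [Oy|nOy] := pselect (Omega y).
- rewrite in_Q; last by left.
  by rewrite !mul1r !vin// !w0in// [leLHS]addrC lerDl.
- rewrite in_Q; last by left.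
  rewrite !mul1r vin// vout// (w0out nOy) (vbout nOy) !subr0.
  rewrite (le_trans (cross _ _ Ox nOy))// lerD2l ler_wpM2l// ler_wpM2r//.
  by rewrite lerDl.
- rewrite in_Q; last by right.
  rewrite !mul1r vout// vin// (w0out nOx) (vbout nOx) !sub0r !normrN.
  rewrite (distrC (w x)) (distrC (w x)) (distrC x).
  rewrite (le_trans (cross _ _ Oy nOx))// lerD2l ler_wpM2l// ler_wpM2r//.
  by rewrite lerDr.
- rewrite notin_Q// !mul0r !add0r (w0out nOx) (w0out nOy) subrr normr0.
  by rewrite addr_ge0.
Qed.

(** Integrating [pointwise], the two whole space energies compare by
    [energy_mollify]; that of [w0] is finite and can be subtracted. *)
Let gagliardo_v : (G v <= G w + 2%:E * \int[mu \x mu]_z (far_ (rho / 2) e z)%:E)%E.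
Proof.
have me2 : measurable_fun setT (fun z => (far_ (rho / 2) e z)%:E).
  by apply/measurable_EFinP; exact: measurable_far.
have far2 z : (0 <= (far_ (rho / 2) e z)%:E)%E by rewrite lee_fin far_ge0.
have Ifar : (0 <= \int[mu \x mu]_z (far_ (rho / 2) e z)%:E)%E by exact: integral_ge0.
have mE (f : E -> R) : measurable_fun setT f -> measurable_fun setT
    (fun z : E * E => (`|f z.1 - f z.2| * K (z.1 - z.2))%:E).
  exact: measurable_energy_density.
have E0 (f : E -> R) (z : E * E) : (0 <= (`|f z.1 - f z.2| * K (z.1 - z.2))%:E)%E.
  by rewrite lee_fin energy_density_ge0.
have Q0 (f : E -> R) (z : E * E) :
    (0 <= (\1_(Qset Omega) z * (`|f z.1 - f z.2| * K (z.1 - z.2)))%:E)%E.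
  by rewrite lee_fin.
have : (G v + energy s w0 <= (G w + 2%:E * \int[mu \x mu]_z (far_ (rho / 2) e z)%:E) + energy s w0)%E.
  apply: (@le_trans _ _ ((G w + energy s vb) + 2%:E * \int[mu \x mu]_z (far_ (rho / 2) e z)%:E)%E).
    rewrite (indQ v) (indQ w) /energy.
    rewrite -(ge0_integralZl _ measurableT me2 (fun z _ => far2 z)); last by rewrite lee_fin.
    have m2f : measurable_fun setT (fun z => (2%:E * (far_ (rho / 2) e z)%:E)%E).
      exact: measurable_funeM.
    have f20 z : (0 <= 2%:E * (far_ (rho / 2) e z)%:E)%E by rewrite mule_ge0// lee_fin.
    rewrite -(ge0_integralD _ measurableT (fun z _ => Q0 v z) (mQf mv) (fun z _ => E0 w0 z) (mE _ mw0)).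
    rewrite -(ge0_integralD _ measurableT (fun z _ => Q0 w z) (mQf mw) (fun z _ => E0 vb z) (mE _ mvb)).
    rewrite -(ge0_integralD _ measurableT _ _ (fun z _ => f20 z) m2f); last 2 first.
    - by move=> z _; rewrite adde_ge0.
    - by apply: emeasurable_funD; [exact: (mQf mw)|exact: (mE _ mvb)].
    apply: ge0_le_integral; first exact: measurableT.
    - by move=> z _; rewrite adde_ge0.
    - by apply: emeasurable_funD; [exact: (mQf mv)|exact: (mE _ mw0)].
    - apply: emeasurable_funD => //.
      by apply: emeasurable_funD; [exact: (mQf mw)|exact: (mE _ mvb)].
    move=> [x y] _; rewrite -EFinM -!EFinD lee_fin /far_ /=.
    have := ler_wpM2r (kernel_ge0 s (x - y)) (pointwise x y).
    by congr (_ <= _); ring.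
  rewrite -addeA [X in (_ + X <= _)%E]addeC addeA; apply: leeD2l.
  exact: (energy_mollify kP mw0 w0M s mvb).
have w0fin : energy s w0 \is a fin_num.
  rewrite ge0_fin_numE ?energy_w0//; apply: integral_ge0 => z _; exact: E0.
by rewrite leeD2rE.
Qed.

(** In [Omega], [v] is Lipschitz and bounded, so [s]-Hoelder; across the boundary,
    it vanishes at both points unless they are at distance at least
    [rho / 2]. *)
Let v_quotient : exists2 C, 0 < C & forall x y, Qset Omega (x, y) ->
  `|v x - v y| <= C * enorm (x - y) `^ s.
Proof.
have [L L0 vL] := vb_lip.
pose C := 2 * M * (1 + (rho / 2) `^ (- s)) + L + 1.
have rs : 0 <= (rho / 2) `^ (- s) by rewrite powR_ge0.
have MR : 0 <= M * (rho / 2) `^ (- s) by rewrite mulr_ge0.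
have C0 : 0 < C by rewrite ltr_wpDl// addr_ge0// !mulr_ge0// addr_ge0.
exists C => // x y Qxy.
apply: (@le_trans _ _ (C * `|x - y| `^ s)); last first.
  rewrite ler_wpM2l ?(ltW C0)// ge0_ler_powR ?(ltW s0)// ?nnegrE ?enorm_ge0//.
  exact: norm_le_enorm.
have d0 : 0 <= `|x - y| by [].
have nvM x' y' : `|v x' - v y'| <= 2 * M.
  have nv x'' : `|v x''| <= M by rewrite /v; case: ifP.
  by rewrite mulr_natl mulr2n (le_trans (ler_normB _ _))// lerD.
have cross x' y' : Omega x' -> ~ Omega y' -> `|v x' - v y'| <= C * `|x' - y'| `^ s.
  move=> Ox nOy; have [->|vxy] := eqVneq (v x' - v y') 0.
    by rewrite normr0 mulr_ge0 ?powR_ge0// ltW.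
  have far_xy : rho / 2 <= `|x' - y'|.
    have [vx|vx] := eqVneq (vb x') 0; last first.
      by have [_ h] := vb_supp vx; rewrite ltW// h.
    have wy : w y' != 0.
      by apply: contra_neq vxy => wy; rewrite vin// vout// vx wy subrr.
    by have := @wrho x' y' (or_intror wy) Ox nOy; have := rho0; lra.
  rewrite (le_trans (nvM _ _))//.
  have h : 1 <= (rho / 2) `^ (- s) * `|x' - y'| `^ s.
    rewrite powRN mulrC ler_pdivlMr ?powR_gt0 ?divr_gt0// mul1r.
    by apply: ge0_ler_powR; rewrite ?(ltW s0)// ?nnegrE ?divr_ge0 ?(ltW rho0).
  apply: (@le_trans _ _ (2 * M * ((rho / 2) `^ (- s) * `|x' - y'| `^ s))).
    by rewrite ler_peMr// mulr_ge0.
  rewrite mulrA; apply: ler_wpM2r; first exact: powR_ge0.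
  rewrite /C mulrDr mulr1 -!addrA addrCA lerDl.
  by apply: addr_ge0; [exact: mulr_ge0|exact: addr_ge0].
have [Ox|nOx] := pselect (Omega x); have [Oy|nOy] := pselect (Omega y).
- have [le1|gt1] := leP `|x - y| 1.
    rewrite !vin// (le_trans (vL _ _))//.
    apply: (@le_trans _ _ (L * `|x - y| `^ s)).
      rewrite ler_wpM2l//; move: d0; rewrite le_eqVlt => /predU1P[<-|d0].
        by rewrite powR_ge0.
      by apply: ger1_powR; rewrite ?d0//; case/andP: s01 => _ /ltW.
    apply: ler_wpM2r; first exact: powR_ge0.
    by rewrite /C addrAC lerDr addr_ge0// !mulr_ge0// addr_ge0.
  rewrite (le_trans (nvM _ _))//.
  apply: (@le_trans _ _ (C * 1)).
    rewrite mulr1 /C mulrDr mulr1 -!addrA lerDl.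
    by apply: addr_ge0; [rewrite -mulrA mulr_ge0|exact: addr_ge0].
  apply: ler_wpM2l; first exact: ltW.
  have <- : 1 `^ s = 1 :> R by rewrite powR1.
  by apply: ge0_ler_powR; rewrite ?(ltW s0)// ?nnegrE// ltW.
- exact: cross.
- by rewrite distrC (distrC x); exact: cross.
- by case: Qxy.
Qed.

Lemma mollified_competitor : exists v : E -> R,
  [/\ measurable_fun setT v /\ forall x, `|v x| <= M,
      exists2 C, 0 < C & forall x y, Qset Omega (x, y) ->
        `|v x - v y| <= C * enorm (x - y) `^ s,
      (G v <= G w + 2%:E * \int[mu \x mu]_z
        (far_ (rho / 2) (fun x => `|mollify k w0 x - w0 x|) z)%:E)%E &
      forall x, `|v x - w x| <= `|mollify k w0 x - w0 x|].
Proof.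
exists v; split; [|exact: v_quotient|exact: gagliardo_v|].
  by split => // x; have [Ox|nOx] := pselect (Omega x); [rewrite vin|rewrite vout].
move=> x; have [Ox|nOx] := pselect (Omega x); first by rewrite vin// w0in.
by rewrite vout// subrr normr0.
Qed.

Lemma measurable_mollified_error :
  measurable_fun setT (fun x => `|mollify k w0 x - w0 x|).
Proof. exact: me. Qed.

Lemma mollified_error : (\int[mu]_x `|mollify k w0 x - w0 x|%:E <=
  (2 * n.+1%:R `^ (n.+1%:R + s) * eps `^ s)%:E * energy s w0)%E.
Proof.
have -> : 2 * n.+1%:R `^ (n.+1%:R + s) * eps `^ s =
    2 / eps ^+ n.+1 * (n.+1%:R * eps) `^ (n.+1%:R + s).
  have epsn : eps ^+ n.+1 != 0 by rewrite expf_neq0// gt_eqF.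
  have -> : (n.+1%:R * eps) `^ (n.+1%:R + s) =
      n.+1%:R `^ (n.+1%:R + s) * (eps ^+ n.+1 * eps `^ s).
    rewrite powRM ?ler0n ?(ltW eps0)//; congr (_ * _).
    by rewrite powRD ?(gt_eqF eps0) ?implybT// -powR_mulrn// ltW.
  by rewrite -!mulrA; congr (_ * _); rewrite [RHS]mulrCA mulKf.
have h := mollify_L1_error kP mw0 w0M eps0 s0 mvb. exact: h.
Qed.

End mollified.

(** The L1 error of mollification is [O(eps^s)], by [mollify_L1_error] and the
    finiteness of the energy of [w0]; it controls both the distance of the
    competitor to [w] and the excess of its seminorm. *)
Lemma regular_approx (r eta : R) : 0 < eta -> exists v : E -> R,
  [/\ measurable_fun setT v /\ forall x, `|v x| <= M,
      exists2 C, 0 < C & forall x y, Qset Omega (x, y) ->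
        `|v x - v y| <= C * enorm (x - y) `^ s,
      (G v <= G w + eta%:E)%E &
      (\int[mu]_(x in [set x : E | (`|x| <= r)%R]) `|v x - w x|%:E <= eta%:E)%E].
Proof.
move=> eta0; have [C C0 CP] := far_integral_le.
have w0fin : energy s w0 \is a fin_num.
  rewrite ge0_fin_numE ?energy_w0//; apply: integral_ge0 => z _.
  by rewrite lee_fin energy_density_ge0.
pose e := fine (energy s w0).
have e0 : 0 <= e by apply: fine_ge0; apply: integral_ge0 => z _; rewrite lee_fin energy_density_ge0.
pose c1 := 2 * n.+1%:R `^ (n.+1%:R + s) * e.
have c10 : 0 <= c1 by rewrite !mulr_ge0// powR_ge0.
pose c2 := 2 * (C * (rho / 2) `^ (- s)) * c1.
have c20 : 0 <= c2 by rewrite !mulr_ge0// powR_ge0.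
pose d := eta / (c1 + c2 + 1).
have cc : 0 < c1 + c2 + 1 by rewrite ltr_wpDl// addr_ge0.
have d0 : 0 < d by rewrite divr_gt0.
(* So that [eps^s <= d], the L1 error being [c1 eps^s] and the energy error
   [c2 eps^s]. *)
pose eps := Num.min (rho / 2) (d `^ s^-1).
have eps0 : 0 < eps by rewrite lt_min divr_gt0// powR_gt0.
have epsd : eps `^ s <= d.
  have : eps <= d `^ s^-1 by rewrite ge_min lexx orbT.
  move=> /(ge0_ler_powR (ltW s0)); rewrite -powRrM mulVf ?gt_eqF// powRr1 ?(ltW d0)//.
  by apply; rewrite nnegrE ?powR_ge0// ltW.
have eps_rho : eps <= rho / 2 by rewrite ge_min lexx.
have [k kP] := @mollifier_exists R n eps eps0.
have [v [[mv vM] vq Gv vw]] := mollified_competitor eps_rho kP.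
have me := measurable_mollified_error kP.
have err : (\int[mu]_x `|mollify k w0 x - w0 x|%:E <= (c1 * d)%:E)%E.
  have := mollified_error eps0 kP.
  move=> /le_trans; apply.
  rewrite -(fineK w0fin) -EFinM lee_fin mulrAC -/e -/c1.
  exact: ler_wpM2l.
have etaE : eta = (c1 + c2 + 1) * d by rewrite mulrC divfK// gt_eqF.
exists v; split => //.
  apply: (le_trans Gv); apply: leeD2l.
  apply: (@le_trans _ _ (2%:E * ((C * (rho / 2) `^ (- s))%:E * (c1 * d)%:E))%E).
    apply: lee_wpmul2l; first by rewrite lee_fin.
    apply: (le_trans (CP (rho / 2) _ _ me _)) => //; first exact: divr_gt0.
    by apply: lee_wpmul2l => //; rewrite lee_fin mulr_ge0// powR_ge0.
  rewrite -!EFinM lee_fin mulrA -/c2 mulrA etaE; apply: ler_wpM2r; first exact: ltW.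
  by rewrite addrAC lerDr addr_ge0.
apply: (@le_trans _ _ (\int[mu]_x `|mollify k w0 x - w0 x|%:E)%E); last first.
  apply: (le_trans err); rewrite lee_fin etaE ler_wpM2r ?(ltW d0)//.
  by rewrite -addrA lerDl addr_ge0.
apply: (@le_trans _ _ (\int[mu]_(x in [set x : E | (`|x| <= r)%R]) `|mollify k w0 x - w0 x|%:E)%E).
  apply: ge0_le_integral => //.
  - exact: measurable_norm_le.
  - by apply/measurable_EFinP/measurable_funTS; apply: measurableT_comp => //; exact: measurable_funB.
  - by apply/measurable_EFinP/measurable_funTS.
  by move=> x _; rewrite lee_fin.
apply: ge0_subset_integral => //.
  exact: measurable_norm_le.
exact/measurable_EFinP.
Qed.

End regularisation.

(** * Recovery sequences *)

Section gamma_limit.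
Context {R : realType} {n : nat}.
Local Notation E := 'rV[R]_n.+1.
Local Notation mu := (leb n.+1).
Variables (Omega : set E) (s : R).
Hypotheses (bO : bounded_set Omega) (oO : open Omega)
  (lO : lipschitz_boundary Omega) (s0 : 0 < s) (s1 : s < 1).
Local Notation G := (gagliardo Omega s).

(** [t^p = t^(p - 1) t <= C^(p - 1) t] for the Hoelder quotient [t]; on the diagonal
    both densities are quotients by 0. *)
Lemma density_le_quotient (p C : R) (v : E -> R) (z : E * E) : 1 < p -> 0 < C ->
  `|v z.1 - v z.2| <= C * enorm (z.1 - z.2) `^ s ->
  density s p v z <= C `^ (p - 1) * density s 1 v z.
Proof.
move=> p1 C0 vC; have p0 : 0 < p by exact: lt_trans p1.
have := enorm_ge0 (z.1 - z.2); rewrite le_eqVlt => /predU1P[z0|z0].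
  rewrite /density -z0 !powR0; first by rewrite !invr0 !mulr0.
  - by rewrite gt_eqF// addr_gt0 ?ltr0n// mulr1.
  - by rewrite gt_eqF// addr_gt0 ?ltr0n// mulr_gt0.
rewrite !density_quotient// mulrA ler_pM2r ?invr_gt0 ?exprn_gt0//.
have es : 0 < enorm (z.1 - z.2) `^ s by exact: powR_gt0.
set t := _ / _.
have t0 : 0 <= t by rewrite divr_ge0// ltW.
have tC : t <= C by rewrite ler_pdivrMr.
move: t0; rewrite le_eqVlt => /predU1P[<-|t0].
  by rewrite powR0 ?gt_eqF// mulr_ge0// powR_ge0.
have -> : t `^ p = t `^ (p - 1) * t `^ 1.
  by rewrite -powRD ?subrK// (gt_eqF t0) implybT.
apply: ler_wpM2r; first exact: powR_ge0.
by apply: ge0_ler_powR; rewrite ?nnegrE ?subr_ge0 ?(ltW p1) ?(ltW t0) ?(ltW C0).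
Qed.

(** For a fixed function with bounded Hoelder quotients, the seminorms with
    exponent [p] are asymptotically at most the one with exponent 1. *)
Lemma gagliardo_le_quotient (p C : R) (v : E -> R) : 1 < p -> 0 < C ->
  measurable_fun setT v ->
  (forall x y, Qset Omega (x, y) -> `|v x - v y| <= C * enorm (x - y) `^ s) ->
  (G p v <= (C `^ (p - 1))%:E * G 1 v)%E.
Proof.
move=> p1 C0 mv vC; have mQ := measurable_Qset oO.
have md q : measurable_fun (Qset Omega) (fun z => (density s q v z)%:E).
  by apply/measurable_EFinP/measurable_funTS; exact: measurable_density.
have Cp : 0 <= C `^ (p - 1) by exact: powR_ge0.
have dE q : G q v = (\int[mu \x mu]_(z in Qset Omega) (density s q v z)%:E)%E by [].
rewrite !dE -ge0_integralZl//; last first.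
- by move=> z _; rewrite lee_fin density_ge0.
apply: ge0_le_integral => //.
- by move=> z _; rewrite lee_fin density_ge0.
- exact: measurable_funeM.
by move=> [x y] Qz; rewrite -EFinM lee_fin density_le_quotient//; exact: vC.
Qed.

Lemma regular_competitor (u : E -> R) (r eta : R) : L1loc u -> (G 1 u < +oo)%E ->
  0 < eta -> exists (v : E -> R) (C : R),
  [/\ L1loc v,
      0 < C /\ (forall x y, Qset Omega (x, y) -> `|v x - v y| <= C * enorm (x - y) `^ s),
      (G 1 v <= G 1 u + eta%:E)%E &
      (\int[mu]_(x in [set x : E | (`|x| <= r)%R]) `|v x - u x|%:E <= eta%:E)%E].
Proof.
move=> lu Gu eta0; have eta2 : 0 < eta / 2 by rewrite divr_gt0.
have s01 : 0 < s < 1 by rewrite s0.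
have [w [M [rho [[mw wM rho0 wrho] [Gw wu]]]]] := cutoff_approx oO s01 r bO lO lu eta2.
have Gwoo : (G 1 w < +oo)%E by rewrite (le_lt_trans Gw)// lte_add_pinfty// ltry.
have [v [[mv vM] [C C0 vC] Gv vw]] := regular_approx bO oO s01 mw wM rho0 wrho Gwoo r eta2.
exists v, C; split => //; first exact: bounded_L1loc vM.
  apply: (le_trans Gv); apply: (le_trans (leeD2r _ Gw)).
  by rewrite -addeA -EFinD -splitr.
pose D : set E := [set x | `|x| <= r].
have mD : measurable D := measurable_norm_le r.
have md (f g : E -> R) : measurable_fun setT f -> measurable_fun setT g ->
    measurable_fun D (fun x => `|f x - g x|%:E).
  move=> mf mg; apply/measurable_EFinP; apply: measurable_funTS.
  by apply: measurableT_comp => //; exact: measurable_funB.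
apply: (@le_trans _ _ (\int[mu]_(x in D) (`|v x - w x|%:E + `|w x - u x|%:E))%E).
  apply: ge0_le_integral => //; first exact: md lu.1.
    by apply: emeasurable_funD; apply: md => //; exact: lu.1.
  by move=> x _; rewrite -EFinD lee_fin ler_distD.
rewrite ge0_integralD//; [|exact: md|exact: md lu.1].
by rewrite [eta]splitr EFinD leeD.
Qed.

Lemma powR_exponent_cvg (C : R) (p_ : R^nat) e : 0 < C -> p_ @ \oo --> (1 : R) ->
  0 < e -> \forall k \near \oo, C `^ (p_ k - 1) <= 1 + e.
Proof.
move=> C0 cp e0.
have : (fun k => C `^ (p_ k - 1)) @ \oo --> (1 : R).
  rewrite (_ : (fun k => _) = (fun k => expR ((p_ k - 1) * ln C))); last first.
    by apply/funext => k; rewrite /powR gt_eqF.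
  suff : (fun k => expR ((p_ k - 1) * ln C)) @ \oo --> expR ((1 - 1) * ln C).
    by rewrite subrr mul0r expR0.
  apply: (continuous_cvg _ (@continuous_expR R _)).
  by apply: cvgMl; apply: cvgB => //; exact: cvg_cst.
move=> /cvgrPdist_le/(_ _ e0); apply: filterS => k; rewrite ler_norml; lra.
Qed.

(** Take for [j_ k] the largest [j <= k] whose threshold [N j], from which
    [P j] holds, has been reached at [k]. *)
Lemma diagonal_index (P : nat -> nat -> Prop) :
  (forall j, \forall k \near \oo, P j k) ->
  exists j_ : nat -> nat, (\forall k \near \oo, P (j_ k) k) /\
    forall J, \forall k \near \oo, (J <= j_ k)%N.
Proof.
move=> nP.
have [N NP] : {N : nat -> nat & forall j k, (N j <= k)%N -> P j k}.
  apply: (@choice _ _ (fun j N => forall k, (N <= k)%N -> P j k)) => j.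
  by have [N _ NP] := nP j; exists N.
exists (fun k => \max_(j < k.+1 | (N j <= k)%N) j)%N; split.
  exists (N 0%N) => // k /= N0k.
  have [|j Nj ->] := @eq_bigmax_cond 'I_k.+1 [pred j : 'I_k.+1 | (N j <= k)%N] (fun j => j).
    by apply/card_gt0P; exists ord0; rewrite inE.
  exact: NP.
move=> J; exists (maxn J (N J)) => // k /=; rewrite geq_max => /andP[Jk NJk].
by apply: (@leq_bigmax_cond _ (fun j : 'I_k.+1 => (N j <= k)%N) (fun j => j) (Ordinal (n:=k.+1) (m:=J) Jk)).
Qed.

(** Competitors [v j] for the tolerances [1 / (j + 1)], whose Hoelder constants
    [C j] may blow up, are used along indices growing so slowly that
    [C (j_ k) ^ (p_ k - 1) <= 1 + 1 / (j_ k + 1)]. *)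
Lemma recovery_sequence (u : E -> R) (p_ : R^nat) : L1loc u -> (G 1 u < +oo)%E ->
  (forall k, 1 < p_ k) -> p_ @ \oo --> (1 : R) ->
  exists u_ : (E -> R)^nat, [/\ forall k, L1loc (u_ k), L1loc_cvg u_ u &
    forall a : R, (G 1 u < a%:E)%E -> \forall k \near \oo, (G (p_ k) (u_ k) <= a%:E)%E].
Proof.
move=> lu Gu p1 cp.
have e0 (j : nat) : 0 < j.+1%:R^-1 :> R by rewrite invr_gt0.
have {}vP (j : nat) : exists vC : (E -> R) * R,
  [/\ L1loc vC.1,
      0 < vC.2 /\ (forall x y, Qset Omega (x, y) ->
        `|vC.1 x - vC.1 y| <= vC.2 * enorm (x - y) `^ s),
      (G 1 vC.1 <= G 1 u + (j.+1%:R^-1)%:E)%E &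
      (\int[mu]_(x in [set x : E | (`|x| <= j%:R)%R]) `|vC.1 x - u x|%:E <= (j.+1%:R^-1)%:E)%E].
  by have [v [C vP]] := regular_competitor j%:R lu Gu (e0 j); exists (v, C).
have [vC {}vP] := choice vP.
pose v j := (vC j).1; pose C j := (vC j).2.
have [j_ [jP joo]] : exists j_ : nat -> nat,
    (\forall k \near \oo, C (j_ k) `^ (p_ k - 1) <= 1 + (j_ k).+1%:R^-1) /\
    forall J, \forall k \near \oo, (J <= j_ k)%N.
  apply: (@diagonal_index (fun j k => C j `^ (p_ k - 1) <= 1 + j.+1%:R^-1)) => j.
  by apply: powR_exponent_cvg => //; have [_ []] := vP j.
have small (e : R) : 0 < e -> \forall k \near \oo, (j_ k).+1%:R^-1 <= e.
  move=> e_gt0; have [J _ Je] := near_infty_natSinv_lt (PosNum e_gt0).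
  by apply: filterS (joo J) => k Jk; apply: ltW; exact: Je.
exists (fun k => v (j_ k)); split.
- by move=> k; have [] := vP (j_ k).
- move=> K cK.
  have [B BK] : exists B, forall x, K x -> `|x| <= B.
    have [B [_ BK]] := compact_bounded cK; exists (B + 1) => x.
    by apply: BK; rewrite ltrDl.
  have mK : measurable K.
    by rewrite -(setCK K); apply: measurableC; apply: open_measurable_rV;
      rewrite openC; apply: compact_closed => //; exact: norm_hausdorff.
  have I0 k : (0 <= \int[mu]_(x in K) `|v (j_ k) x - u x|%:E)%E by exact: integral_ge0.
  have IK : forall e : R, 0 < e -> \forall k \near \oo,
      (\int[mu]_(x in K) `|v (j_ k) x - u x|%:E <= e%:E)%E.
    move=> e e_gt0; near=> k.
    have [lv _ _ vu] := vP (j_ k).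
    have je : (j_ k).+1%:R^-1 <= e by near: k; exact: small.
    apply: (@le_trans _ _ ((j_ k).+1%:R^-1)%:E); last by rewrite lee_fin.
    apply: le_trans vu; apply: ge0_subset_integral => //.
    + exact: measurable_norm_le.
    + apply/measurable_EFinP; apply: measurable_funTS; apply: measurableT_comp => //.
      by apply: measurable_funB; [exact: lv.1|exact: lu.1].
    move=> x /BK xB /=; apply: (le_trans xB).
    apply: (@le_trans _ _ (Num.truncn B).+1%:R); first exact/ltW/truncnS_gt.
    by rewrite ler_nat; near: k; exact: joo.
  apply: cvg_einf_esup.
    apply: limn_einf_ge => a; rewrite lte_fin => a0; near=> k.
    by apply: le_trans (I0 k); rewrite lee_fin ltW.
  by apply: limn_esup_le => a; rewrite lte_fin => /IK.
- move=> a.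
  have Gu0 := gagliardo_ge0 Omega s 1 u.
  move GE : (G 1 u) Gu Gu0 => [g||]// _ g0 ga.
  rewrite lee_fin in g0; rewrite lte_fin in ga.
  (* Chosen so that [(1 + e) (g + e) <= a]. *)
  pose e := Num.min 1 ((a - g) / (g + 2)).
  have g2 : 0 < g + 2 by rewrite ltr_wpDl.
  have e_gt0 : 0 < e by rewrite lt_min ltr01 divr_gt0// subr_gt0.
  have e_le1 : e <= 1 by rewrite ge_min lexx.
  have ea : (1 + e) * (g + e) <= a.
    have : e <= (a - g) / (g + 2) by rewrite ge_min lexx orbT.
    rewrite ler_pdivlMr//; have : e * e <= e by rewrite ler_piMr// ltW.
    lra.
  near=> k.
  have [lv [C0 vC'] Gv _] := vP (j_ k).
  have je : (j_ k).+1%:R^-1 <= e by near: k; exact: small.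
  have Ce : C (j_ k) `^ (p_ k - 1) <= 1 + (j_ k).+1%:R^-1 by near: k.
  apply: (le_trans (gagliardo_le_quotient (p1 k) C0 lv.1 vC')).
  apply: (@le_trans _ _ ((1 + e)%:E * (g + e)%:E)%E); last by rewrite -EFinM lee_fin.
  apply: lee_pmul.
  + by rewrite lee_fin powR_ge0.
  + exact: gagliardo_ge0.
  + by rewrite lee_fin (le_trans Ce)// lerD2l.
  + by apply: (le_trans Gv); rewrite GE -EFinD lee_fin lerD2l.
Unshelve. all: by end_near. Qed.

Lemma ext_energy_liminf (u : E -> R) (u_ : (E -> R)^nat) (p_ : R^nat) :
  L1loc u -> (forall k, L1loc (u_ k)) -> L1loc_cvg u_ u ->
  (forall k, 1 < p_ k) -> p_ @ \oo --> (1 : R) ->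
  (ext_energy Omega s 1 u <= limn_einf (fun k => ext_energy Omega s (p_ k) (u_ k)))%E.
Proof.
move=> lu lu_ cu p1 cp; rewrite ext_energyE// mulr1.
have p0 k : 0 < p_ k by exact: lt_trans (p1 k).
apply: limn_einf_ge => a aG.
have [a0|a0] := ltP a 0.
  near=> k; rewrite (ext_energyE _ _ (p0 k) (lu_ k)).
  apply: (@le_trans _ _ 0%E); first by rewrite lee_fin ltW.
  by rewrite mule_ge0 ?gagliardo_ge0// lee_fin invr_ge0 mulr_ge0// ltW.
have [b ab bG] : exists2 b : R, 2 * a < b & (b%:E < G 1 u)%E.
  move: aG (gagliardo_ge0 Omega s 1 u); move: (G 1 u) => [g||]//; last first.
    by move=> _ _; exists (2 * a + 1); rewrite ?ltry// ltrDl.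
  rewrite -EFinM lte_fin => ag _; exists (a + g / 2); rewrite ?lte_fin; lra.
have nb := gagliardo_liminf oO s0 lu lu_ cu p1 cp bG.
have np : \forall k \near \oo, 2 * p_ k * a <= b.
  have : (fun k => 2 * p_ k * a) @ \oo --> 2 * 1 * a.
    by apply: cvgMl; apply: cvgMr.
  rewrite mulr1 => /cvgrPdist_le/(_ (b - 2 * a)).
  rewrite subr_gt0 => /(_ ab); apply: filterS => k; rewrite ler_norml; lra.
near=> k; rewrite (ext_energyE _ _ (p0 k) (lu_ k)).
have p2 : 0 < 2 * p_ k by rewrite mulr_gt0.
apply: (@le_trans _ _ ((2 * p_ k)^-1%:E * b%:E)%E).
  rewrite -EFinM lee_fin mulrC ler_pdivlMr// mulrC; near: k; exact: np.
apply: lee_wpmul2l; first by rewrite lee_fin invr_ge0 ltW.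
by apply: ltW; near: k; exact: nb.
Unshelve. all: by end_near. Qed.

(** When the seminorm of [u] is infinite there is nothing to bound, and the
    constant sequence does. *)
Lemma ext_energy_limsup (u : E -> R) (p_ : R^nat) : L1loc u ->
  (forall k, 1 < p_ k) -> p_ @ \oo --> (1 : R) ->
  exists u_ : (E -> R)^nat, [/\ forall k, L1loc (u_ k), L1loc_cvg u_ u &
    (limn_esup (fun k => ext_energy Omega s (p_ k) (u_ k)) <= ext_energy Omega s 1 u)%E].
Proof.
move=> lu p1 cp.
have p0 k : 0 < p_ k by exact: lt_trans (p1 k).
have [Gu|Gu] := eqVneq (G 1 u) +oo%E.
  exists (fun=> u); split => //.
    move=> K _; under eq_fun do under eq_integral do rewrite subrr normr0.
    by rewrite integral0; exact: cvg_cst.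
  by rewrite (ext_energyE Omega s ltr01 lu) Gu gt0_muley ?leey// lte_fin invr_gt0 mulr_gt0.
have [|u_ [lu_ cu Gu_]] := recovery_sequence lu _ p1 cp; first by rewrite ltey.
exists u_; split => //; rewrite ext_energyE// mulr1.
apply: limn_esup_le => a Ga.
have G2a : (G 1 u < (2 * a)%:E)%E.
  move: Ga Gu (gagliardo_ge0 Omega s 1 u); move: (G 1 u) => [g||]// + _ _.
  by rewrite -EFinM !lte_fin; lra.
have a0 : 0 < 2 * a by rewrite -lte_fin (le_lt_trans (gagliardo_ge0 Omega s 1 u)).
apply: filterS (Gu_ _ G2a) => k Gk; rewrite (ext_energyE _ _ (p0 k) (lu_ k)).
have p2 : 0 < 2 * p_ k by rewrite mulr_gt0.
apply: (@le_trans _ _ ((2 * p_ k)^-1%:E * (2 * a)%:E)%E).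
  by apply: lee_wpmul2l => //; rewrite lee_fin invr_ge0 ltW.
rewrite -EFinM lee_fin mulrC ler_pdivrMr//; have := p1 k; nra.
Qed.

End gamma_limit.

Theorem theorem1p7 (R : realType) (n : nat) (Omega : set 'rV[R]_n.+1) (s : R)
    (bounded_Omega : bounded_set Omega) (open_Omega : open Omega)
    (lipschitz_Omega : lipschitz_boundary Omega)
    (s_gt0 : 0 < s) (s_lt1 : s < 1) :
  Gamma_cvg_at_right (fun p u => ext_energy Omega s p u) 1
    (fun u => ext_energy Omega s 1 u).
Proof.
move=> u lu p_ p1 cp; split=> [u_ lu_ cu|].
  exact: (ext_energy_liminf open_Omega s_gt0).
have [u_ [lu_ cu Eu]] := ext_energy_limsup bounded_Omega open_Omega lipschitz_Omega s_gt0 s_lt1 lu p1 cp.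
exists u_; split => //; apply: cvg_einf_esup => //.
exact: (ext_energy_liminf open_Omega s_gt0).
Qed.
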